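(* The following three classes of computational problems have the same computational power up to log-space equivalence, i.e., for every problem $P$ in any one of the classes there exists, in each of the other two classes, a problem that is log-space equivalent to $P$: (1) the problems described by monadic extensional ESO sentences; (2) the problems described by extensional ESO sentences; (3) the complements of problems in HerFO.
   Context: All signatures are finite and relational, and all structures have non-empty domains. An ESO (existential second-order) $\tau$-sentence has the form $\exists R_1,\dots,R_k.\,\phi$, where $R_1,\dots,R_k$ are relation symbols not in $\tau$ and $\phi$ is a first-order $(\tau\cup\{R_1,\dots,R_k\})$-sentence (the first-order part). The problem described by a sentence is the class of finite $\tau$-structures satisfying it, viewed as the decision problem: given a finite $\tau$-structure (encoded as a string), does it belong to the class? An ESO $\tau$-sentence $\Psi$ is extensional if for every existentially quantified predicate $R$ there is a distinct symbol $R'\in\tau$ of the same arity such that $\Psi$ contains a conjunct $\forall\bar x\,(R'(\bar x)\Rightarrow R(\bar x))$, and $R'$ does not appear anywhere else in $\Psi$. It is monadic if every existentially quantified symbol is unary. For a first-order $\tau$-sentence $\phi$, $\mathrm{Her}(\phi)$ is the class of finite $\tau$-structures $\mathbb A$ such that all non-empty (induced) substructures of $\mathbb A$ satisfy $\phi$. HerFO (hereditary first-order logic) is the collection of all classes of the form $\mathrm{Her}(\phi)$ with $\phi$ a first-order sentence. The complement of a problem is taken within the class of all finite structures of its signature. Two problems are log-space equivalent if each has a log-space computable many-one reduction to the other. *)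

(* Defs.v *)
From mathcomp Require Import all_boot.

Set Implicit Arguments.
Unset Strict Implicit.
Unset Printing Implicit Defensive.

(** * Finite relational signatures, first-order formulas, finite structures *)

Record signature := Signature { symbol :> finType; arity : symbol -> nat }.

(** Variables are named by natural numbers. *)
Inductive formula (tau : signature) : Type :=
| FEq of nat & nat
| FRel (R : tau) of (arity R).-tuple nat
| FNot of formula tau
| FAnd of formula tau & formula tau
| FOr of formula tau & formula tau
| FImp of formula tau & formula tau
| FAll of nat & formula tau
| FEx of nat & formula tau.

Arguments FEq {tau} _ _.
Arguments FRel {tau} R _.

Fixpoint free_vars (tau : signature) (phi : formula tau) : seq nat :=
  match phi with
  | FEq x y => [:: x; y]
  | FRel _ x => x
  | FNot p => free_vars p
  | FAnd p q | FOr p q | FImp p q => free_vars p ++ free_vars q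
  | FAll x p | FEx x p => [seq y <- free_vars p | y != x]
  end.

Record sentence (tau : signature) := Sentence {
  sentence_formula :> formula tau;
  sentence_closed : free_vars sentence_formula == [::]
}.

Fixpoint mentions (tau : signature) (S : tau) (phi : formula tau) : bool :=
  match phi with
  | FEq _ _ => false
  | FRel R _ => R == S
  | FNot p => mentions S p
  | FAnd p q | FOr p q | FImp p q => mentions S p || mentions S q
  | FAll _ p | FEx _ p => mentions S p
  end.

Fixpoint conjuncts (tau : signature) (phi : formula tau) : seq (formula tau) :=
  match phi with
  | FAnd p q => conjuncts p ++ conjuncts q
  | _ => [:: phi]
  end.

Record structure (tau : signature) := Structure {
  dom :> finType;
  dom_gt0 : 0 < #|dom|;
  interp : forall R : tau, (arity R).-tuple dom -> bool
}.

Definition update (D : Type) (v : nat -> D) (x : nat) (a : D) : nat -> D :=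
  fun y => if y == x then a else v y.

Fixpoint sat (tau : signature) (A : structure tau) (v : nat -> A)
    (phi : formula tau) : bool :=
  match phi with
  | FEq x y => v x == v y
  | FRel R x => interp (map_tuple v x)
  | FNot p => ~~ sat v p
  | FAnd p q => sat v p && sat v q
  | FOr p q => sat v p || sat v q
  | FImp p q => sat v p ==> sat v q
  | FAll x p => [forall a, sat (update v x a) p]
  | FEx x p => [exists a, sat (update v x a) p]
  end.

(** The valuation is irrelevant, as [phi] is closed and [A] is non-empty. *)
Definition models (tau : signature) (A : structure tau) (phi : sentence tau) :
  Prop := forall v : nat -> A, sat v phi.

(** * Hereditary first-order logic *)

Lemma card_substructure (T : finType) (U : {set T}) :
  0 < #|U| -> 0 < #|{: {x : T | x \in U}}|.
Proof. by rewrite card_sig. Qed.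

Definition substructure (tau : signature) (A : structure tau) (U : {set A})
    (U_gt0 : 0 < #|U|) : structure tau :=
  @Structure tau {x : A | x \in U} (card_substructure U_gt0)
    (fun R t => interp (map_tuple val t)).

Definition Her (tau : signature) (phi : sentence tau) (A : structure tau) :
  Prop := forall (U : {set A}) (U_gt0 : 0 < #|U|),
    models (substructure U_gt0) phi.

(** * Existential second-order logic *)

(** The disjoint sum enforces that quantified symbols are not in [tau]. *)
Definition signature_sum (tau rho : signature) : signature :=
  @Signature (tau + rho)%type
    (fun S => match S with inl R => arity R | inr R => arity R end).

Record eso (tau : signature) := Eso {
  quantified : signature;
  fo_part : sentence (signature_sum tau quantified)
}.

Definition expansion (tau rho : signature) (A : structure tau)
    (I : forall R : rho, (arity R).-tuple A -> bool) :
    structure (signature_sum tau rho) :=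
  @Structure (signature_sum tau rho) A (dom_gt0 A)
    (fun S => match S return (@arity (signature_sum tau rho) S).-tuple A -> bool
              with inl R => @interp tau A R | inr R => I R end).

Definition eso_models (tau : signature) (A : structure tau) (Psi : eso tau) :
  Prop := exists I : forall R : quantified Psi, (arity R).-tuple A -> bool,
    models (expansion I) (fo_part Psi).

(** [chi] is the formula forall xs, R'(xs) => R(xs), for some list [xs] of
    distinct variables. The tuples [x] and [y] are this same list at the types
    required by [R'] and [R], so the two arities have to coincide. *)
Definition extension_clause (sigma : signature) (R' R : sigma)
    (chi : formula sigma) : Prop :=
  exists (x : (arity R').-tuple nat) (y : (arity R).-tuple nat),
    [/\ tval x = tval y, uniq x
      & chi = foldr (@FAll sigma) (FImp (FRel R' x) (FRel R y)) x].

Definition extensional (tau : signature) (Psi : eso tau) : Prop :=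
  exists prime : quantified Psi -> tau,
    injective prime /\
    forall R : quantified Psi,
      let R' : signature_sum tau (quantified Psi) := inl (prime R) in
      exists (s1 s2 : seq (formula (signature_sum tau (quantified Psi)))) chi,
        [/\ conjuncts (fo_part Psi) = s1 ++ chi :: s2,
            extension_clause R' (inr R) chi
          & ~~ has (mentions R') (s1 ++ s2)].

Definition monadic (tau : signature) (Psi : eso tau) : Prop :=
  forall R : quantified Psi, arity R = 1.

(** * Log-space computable functions on binary words *)

Inductive move := MoveLeft | MoveStay | MoveRight.

Variant input_symbol := LeftEnd | Bit of bool | RightEnd.

(** Deterministic machines with a two-way read-only input tape delimited by end
    markers, finitely many one-way infinite work tapes, and a write-only output
    tape. *)
Record transducer := Transducer {
  state : finType;
  start : state;
  halting : pred state;
  work_symbol : finType;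
  blank : work_symbol;
  tapes : nat;
  (** new state, input head move, symbol written and head move on each work
      tape, bit appended to the output (if any) *)
  transition : state -> input_symbol -> {ffun 'I_tapes -> work_symbol} ->
    state * move * {ffun 'I_tapes -> work_symbol} * ('I_tapes -> move)
    * option bool
}.

Record config (M : transducer) := Config {
  cstate : state M;
  input_head : nat;
  work_tape : 'I_(tapes M) -> nat -> work_symbol M;
  work_head : 'I_(tapes M) -> nat;
  output : seq bool
}.

(** Cell 0 holds the left end marker, the bits of [w] are in cells
    1, ..., size w, and the right end marker is in cell (size w).+1. *)
Definition read_input (w : seq bool) (i : nat) : input_symbol :=
  if i is j.+1 then nth RightEnd (map Bit w) j else LeftEnd.

Definition move_head (m : move) (i : nat) : nat :=
  match m with MoveLeft => i.-1 | MoveStay => i | MoveRight => i.+1 end.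

Definition initial (M : transducer) : config M :=
  @Config M (start M) 0 (fun _ _ => blank M) (fun _ => 0) [::].

Definition step (M : transducer) (w : seq bool) (C : config M) : config M :=
  if halting (cstate C) then C else
  let: (q, mi, written, mw, out) :=
    transition (cstate C) (read_input w (input_head C))
      [ffun j => work_tape C j (work_head C j)] in
  @Config M q
    (minn (move_head mi (input_head C)) (size w).+1)
    (fun j i => if i == work_head C j then written j else work_tape C j i)
    (fun j => move_head (mw j) (work_head C j))
    (if out is Some b then rcons (output C) b else output C).

Definition run (M : transducer) (w : seq bool) (t : nat) : config M :=
  iter t (step w) (initial M).

Definition logspace_computable (f : seq bool -> seq bool) : Prop :=
  exists (M : transducer) (c : nat), forall w : seq bool,
    (exists t, halting (cstate (run M w t)) /\ output (run M w t) = f w) /\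
    (forall t j, work_head (run M w t) j < c * (trunc_log 2 (size w)).+1).

(** * Computational problems and log-space reductions *)

Fixpoint all_tuples (D : finType) (r : nat) : seq (r.-tuple D) :=
  match r with
  | 0 => [:: [tuple]]
  | r'.+1 => [seq cons_tuple a t | a <- enum D, t <- all_tuples D r']
  end.

(** The size of the domain in unary, followed by the table of each relation,
    with tuples listed in lexicographic order. *)
Definition encode (tau : signature) (A : structure tau) : seq bool :=
  nseq #|A| true ++ false ::
  flatten [seq [seq @interp tau A R t | t <- all_tuples A (arity R)]
          | R <- enum tau].

Record problem := Problem {
  psig : signature;
  instance :> structure psig -> Prop
}.

Definition logspace_reduces (P Q : problem) : Prop :=
  exists f : seq bool -> seq bool,
    logspace_computable f /\
    forall A : structure (psig P), exists B : structure (psig Q),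
      f (encode A) = encode B /\ (P A <-> Q B).

Definition logspace_equivalent (P Q : problem) : Prop :=
  logspace_reduces P Q /\ logspace_reduces Q P.

Definition described_by (P : problem) (Psi : eso (psig P)) : Prop :=
  forall A : structure (psig P), P A <-> eso_models A Psi.

Definition extensional_ESO (P : problem) : Prop :=
  exists Psi : eso (psig P), extensional Psi /\ described_by Psi.

Definition monadic_extensional_ESO (P : problem) : Prop :=
  exists Psi : eso (psig P),
    [/\ monadic Psi, extensional Psi & described_by Psi].

Definition HerFO (P : problem) : Prop :=
  exists phi : sentence (psig P), forall A, P A <-> Her phi A.

Definition complement (P : problem) : problem :=
  @Problem (psig P) (fun A => ~ P A).

Definition co_HerFO (P : problem) : Prop :=
  exists C : structure (psig P) -> Prop,
    HerFO (Problem C) /\ forall A, P A <-> complement (Problem C) A.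

Definition same_power (K L : problem -> Prop) : Prop :=
  (forall P, K P -> exists Q, L Q /\ logspace_equivalent P Q) /\
  (forall P, L P -> exists Q, K Q /\ logspace_equivalent P Q).

(* Main.v *)
From mathcomp Require Import all_boot zify.
From Stdlib Require Import FunctionalExtensionality Classical.
Require Import Defs.

(** The equivalences come from two constructions on structures, both of which
    are first-order interpretations and therefore computable in logarithmic space.

    Extensional sentences ([extensional_coding]). Let [Psi] quantify relations [R]
    above given relations [R']. Add to a structure [A], for every [R] and every
    tuple [t] outside [R'], a new element that points to [t]. A set of new elements
    that are deleted, or switched off by a unary predicate, is the same thing as a
    choice of relations [R] above [R']: put [t] in [R] when no active element
    points to [t]. Tuples of [R'] have no such element, so they are forced into
    [R]; this is why extensional sentences, and not all second-order ones, arise.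
    With a unary predicate the choice is a monadic extensional sentence. With
    deletion it is the existence of an induced substructure with a first-order
    property, that is the complement of a hereditary class, provided that the
    elements of [A] cannot be deleted. For this purpose [A] carries a linear order
    and a relation that sends each element to its successor and the last one to
    the first; the property demands that every element have a successor, and a
    non-empty set closed under it is everything ([complete_substructure]).

    The reverse reduction must cope with structures that are no codes. The
    conditions on codes split into universal ones ([sound]) and the existence of
    successors ([complete]). Structures that violate a universal condition are
    declared positive: the condition is inherited by substructures, so this does
    not spoil the sound ones. Sound structures that are incomplete are negative.
    All others code some [A], which can be read off. So a single problem belongs
    to both classes and is equivalent to [Psi].

    Complements of hereditary classes ([co_HerFO_monadic]). Quantify the set of
    elements to be removed, above a given set of removed elements. A structure [A]
    is the same instance as [A] with nothing removed, and an instance of the new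
    problem is the same as the substructure on the elements that are left.

    Logarithmic space. Structured programs on tapes are compiled to transducers
    ([exec_reaches]); registers are binary counters bounded by the input length;
    routines on registers are closed under bounded sums and loops that write
    ([computable_loop]). On encodings these evaluate first-order formulas that may
    refer to the order of the domain ([definable_sat], [definable_less]), and
    write the encoding of an interpreted structure ([writable_description]). *)

Set Implicit Arguments.
Unset Strict Implicit.
Unset Printing Implicit Defensive.

(** * Structured programs on a read-only input and work tapes *)

(** A blank, the mark of cell [0], or a bit. *)
Definition cell : finType := option (option bool).

Section Programs.

Variable k : nat.

Record memory := Memory {
  head : nat;
  tape : 'I_k -> nat -> cell;
  pos : 'I_k -> nat;
  written : seq bool
}.

Definition effect : Type :=
  move * {ffun 'I_k -> cell} * ('I_k -> move) * option bool.

Definition action := input_symbol -> {ffun 'I_k -> cell} -> effect.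

Definition test := input_symbol -> {ffun 'I_k -> cell} -> bool.

Inductive prog :=
| PAct of action
| PSeq of prog & prog
| PIf of test & prog & prog
| PWhile of test & prog.

(** Tests and jumps are performed as steps that rewrite what they read. *)
Definition stay : action :=
  fun _ f => (MoveStay, f, fun _ => MoveStay, None).

Section Semantics.

Variables (w : seq bool) (b : nat).

Definition scanned (m : memory) : {ffun 'I_k -> cell} :=
  [ffun j => tape m j (pos m j)].

Definition check (t : test) (m : memory) : bool :=
  t (read_input w (head m)) (scanned m).

Definition perform (a : action) (m : memory) : memory :=
  let: (mi, wr, mw, o) := a (read_input w (head m)) (scanned m) in
  Memory (minn (move_head mi (head m)) (size w).+1)
    (fun j i => if i == pos m j then wr j else tape m j i)
    (fun j => move_head (mw j) (pos m j))
    (if o is Some c then rcons (written m) c else written m).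

Definition fits (m : memory) : Prop :=
  head m <= (size w).+1 /\ forall j, pos m j < b.

(** Big-step semantics in which every intermediate memory respects the bound [b]
    on the work heads, so that a derivation also proves the space bound. *)
Inductive exec : prog -> memory -> memory -> Prop :=
| ExecAct a m : fits m -> fits (perform a m) -> exec (PAct a) m (perform a m)
| ExecSeq p q m1 m2 m3 : exec p m1 m2 -> exec q m2 m3 -> exec (PSeq p q) m1 m3
| ExecIf t p q m m' : fits m ->
    exec (if check t m then p else q) m m' -> exec (PIf t p q) m m'
| ExecStop t p m : fits m -> ~~ check t m -> exec (PWhile t p) m m
| ExecLoop t p m1 m2 m3 : fits m1 -> check t m1 -> exec p m1 m2 ->
    exec (PWhile t p) m2 m3 -> exec (PWhile t p) m1 m3.

(** The rewritten tape agrees with the old one cell by cell, so the equality of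
    memories needs functional extensionality. *)
Lemma perform_stay m : head m <= (size w).+1 -> perform stay m = m.
Proof.
case: m => i tp ps o /= hi; rewrite /perform /=; congr Memory.
- exact/minn_idPl.
- apply: functional_extensionality => j; apply: functional_extensionality => x.
  by rewrite /scanned ffunE /=; case: eqP => [->|].
Qed.

Lemma exec_fits p m m' : exec p m m' -> fits m /\ fits m'.
Proof.
by elim=> {p m m'} // [p q m1 m2 m3 _ [? _] _ [_ ?]|t p m1 m2 m3 ? _ _ _ _ [_ ?]].
Qed.

End Semantics.

(** * Compilation to a transducer *)

Definition instruction := input_symbol -> {ffun 'I_k -> cell} -> nat * effect.

Fixpoint length_of (p : prog) : nat :=
  match p with
  | PAct _ => 1
  | PSeq p q => length_of p + length_of q
  | PIf _ p q => (length_of p + (length_of q).+1).+1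
  | PWhile _ p => (length_of p).+2
  end.

Definition goto (n : nat) : instruction := fun i f => (n, stay i f).

Fixpoint compile (p : prog) (n : nat) : seq instruction :=
  match p with
  | PAct a => [:: fun i f => (n.+1, a i f)]
  | PSeq p q => compile p n ++ compile q (n + length_of p)
  | PIf t p q =>
      (fun i f => (if t i f then n.+1 else (n + length_of p).+2, stay i f))
      :: compile p n.+1
      ++ goto (n + length_of (PIf t p q))
      :: compile q (n + length_of p).+2
  | PWhile t p =>
      (fun i f => (if t i f then n.+1 else (n + length_of p).+2, stay i f))
      :: compile p n.+1 ++ [:: goto n]
  end.

Lemma size_compile p n : size (compile p n) = length_of p.
Proof.
elim: p n => //= [p IHp q IHq|t p IHp q IHq|t p IHp] n.
- by rewrite size_cat IHp IHq.
- by rewrite size_cat /= IHp IHq.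
- by rewrite size_cat /= IHp addn1.
Qed.

Section Machine.

Variable code : seq instruction.

(** The state is the program counter, and the last one halts. *)
Definition machine : transducer :=
  @Transducer 'I_(size code).+1 ord0 (pred1 ord_max) cell None k
    (fun q i f => let: (n, (mi, wr, mw, o)) := nth (goto 0) code q i f in
                  (inord n, mi, wr, mw, o)).

Definition configuration (n : nat) (m : memory) : config machine :=
  @Config machine (inord n) (head m) (@tape m) (@pos m) (written m).

Variables (w : seq bool) (b : nat).

Definition within (C : config machine) := forall j, work_head C j < b.

Definition reaches (C D : config machine) := exists t,
  iter t (step w) C = D /\ forall t', t' <= t -> within (iter t' (step w) C).

Lemma reaches_trans D C E : reaches C D -> reaches D E -> reaches C E.
Proof.
move=> [t [<- ht]] [u [<- hu]]; exists (u + t); split; first by rewrite iterD.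
move=> t' le_t'; have [/ht//|/ltnW lt_t] := leqP t' t.
rewrite -(subnK lt_t) iterD; apply: hu.
by rewrite leq_subLR addnC.
Qed.

(** Jumps are absolute, hence the code of a subprogram depends on where it is. *)
Definition block n (s : seq instruction) :=
  exists c1 c2, code = c1 ++ s ++ c2 /\ size c1 = n.

Lemma block_cat n s1 s2 :
  block n (s1 ++ s2) -> block n s1 /\ block (n + size s1) s2.
Proof.
move=> [c1 [c2 [Dcode <-]]]; split.
  by exists c1, (s2 ++ c2); rewrite Dcode -catA.
by exists (c1 ++ s1), c2; rewrite size_cat Dcode -!catA.
Qed.

Lemma block_cons n e s : block n (e :: s) -> block n [:: e] /\ block n.+1 s.
Proof. by rewrite -cat1s -addn1; apply: block_cat. Qed.

Lemma reaches_step n e m n' m' : block n [:: e] ->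
  fits w b m -> fits w b m' ->
  (e (read_input w (head m)) (scanned m)).1 = n' ->
  perform w (fun i f => (e i f).2) m = m' ->
  reaches (configuration n m) (configuration n' m').
Proof.
move=> [c1 [c2 [Dcode <-]]] [_ hm] [_ hm'] <- Dm'; rewrite -{}Dm' in hm' *.
have lt_c1: size c1 < size code by rewrite Dcode size_cat /= addnS ltnS leq_addr.
have Dstep: step w (configuration (size c1) m)
  = configuration (e (read_input w (head m)) (scanned m)).1
      (perform w (fun i f => (e i f).2) m).
  rewrite /step /= -val_eqE /= inordK; last exact: ltnW.
  have De: nth (goto 0) code (size c1) = e by rewrite Dcode nth_cat ltnn subnn.
  rewrite ltn_eqF // De.
  by rewrite /perform -/(scanned m); case: (e _ _) => ? [[[? ?] ?] ?].
exists 1; split=> // -[|[|//]] _ /=; first exact: hm.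
by rewrite Dstep; exact: hm'.
Qed.

(** Compiler correctness, by induction on the derivation: each constructor of
    [exec] is one machine step followed by the runs of the subprograms. *)
Lemma exec_reaches p m m' : exec w b p m m' -> forall n, block n (compile p n) ->
  reaches (configuration n m) (configuration (n + length_of p) m').
Proof.
elim=> {p m m'} [a m hm hm'|p q m1 m2 m3 _ IHp _ IHq|t p q m m' hm hpq IH
  |t p m hm hneg|t p m1 m2 m3 hm ht hp IHp hw IHw] n /= code_n.
- by apply: (reaches_step code_n) => //=; rewrite addn1.
- have [code_p] := block_cat code_n; rewrite size_compile => code_q.
  by apply: reaches_trans (IHp _ code_p) _; rewrite addnA; apply: IHq.
- have [code_t /block_cat[code_p]] := block_cons code_n.
  rewrite size_compile => /block_cons[code_g code_q].
  have [_ hm'] := exec_fits hpq.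
  have branch n' : (if check w t m then n.+1 else (n + length_of p).+2) = n' ->
      reaches (configuration n m) (configuration n' m).
    by move=> Dn'; apply: (reaches_step code_t) => //; apply: perform_stay hm.1.
  case: ifP hpq IH branch => _ _ IH branch; apply: reaches_trans (branch _ erefl) _.
    apply: reaches_trans (IH _ code_p) _; apply: (reaches_step code_g) => //.
    exact: perform_stay hm'.1.
  by rewrite addnS addnA addnS -!addSn; apply: IH.
- have [code_t _] := block_cons code_n; apply: (reaches_step code_t) => //.
    by rewrite -/(check w t m) (negPf hneg) !addnS.
  exact: perform_stay hm.1.
- have [code_t /block_cat[code_p]] := block_cons code_n.
  rewrite size_compile => code_g; have [_ hm2] := exec_fits hp.
  have enter: reaches (configuration n m1) (configuration n.+1 m1).
    apply: (reaches_step code_t) => //; first by rewrite -/(check w t m1) ht.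
    exact: perform_stay hm.1.
  apply: reaches_trans enter _; apply: reaches_trans (IHp _ code_p) _.
  apply: reaches_trans (IHw _ code_n); apply: (reaches_step code_g) => //.
  exact: perform_stay hm2.1.
Qed.

End Machine.

Definition blank_memory : memory :=
  Memory 0 (fun _ _ => None) (fun _ => 0) [::].

(** A halted machine keeps its configuration, so the bound proved along the run
    holds at all times. *)
Lemma exec_logspace (p : prog) (c : nat) (f : seq bool -> seq bool) :
  (forall w, exists2 m,
     exec w (c * (trunc_log 2 (size w)).+1) p blank_memory m & written m = f w) ->
  logspace_computable f.
Proof.
move=> Hp; exists (machine (compile p 0)), c => w; set b := c * _.
have [m pm Dout] := Hp w; set code := compile p 0.
have [t [Dt ht]] : reaches w b (configuration code 0 blank_memory)
                                 (configuration code (0 + length_of p) m).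
  by apply: exec_reaches pm _ _; exists [::], [::]; rewrite cats0.
have D0: configuration code 0 blank_memory = initial (machine code).
  by rewrite /configuration /initial /=; congr Config; apply: val_inj; rewrite /= inordK.
rewrite D0 in Dt ht.
have stop: halting (cstate (run (machine code) w t)).
  by rewrite /run Dt /= -val_eqE /= inordK size_compile.
split; first by exists t; split=> //; rewrite /run Dt.
move=> u j; have [le_u|/ltnW le_t] := leqP u t; first exact: ht.
suff ->: run (machine code) w u = run (machine code) w t by apply: ht (leqnn t) j.
rewrite -(subnK le_t) /run iterD -/(run (machine code) w t).
elim: (u - t) => //= d ->; rewrite /step.
by move: stop; rewrite /= => ->.
Qed.

End Programs.

(** * Binary counters on tapes *)

Fixpoint binary_succ (s : seq bool) : seq bool :=
  match s with
  | [::] => [:: true]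
  | false :: s' => true :: s'
  | true :: s' => false :: binary_succ s'
  end.

Definition digits (n : nat) : seq bool := iter n binary_succ [::].

Fixpoint binary_value (s : seq bool) : nat :=
  if s is c :: s' then c + (binary_value s').*2 else 0.

Lemma binary_value_succ s : binary_value (binary_succ s) = (binary_value s).+1.
Proof. by elim: s => [|[] s IHs] //=; rewrite IHs. Qed.

Lemma digitsK : cancel digits binary_value.
Proof. by elim=> //= n IHn; rewrite binary_value_succ IHn. Qed.

Lemma binary_value_last (c : bool) s : last c s -> 2 ^ size s <= binary_value (c :: s).
Proof.
elim: s c => [[]//|c' s IHs] c /IHs.
rewrite [size _]/= expnS -[binary_value (c :: _)]/(c + (binary_value (c' :: s)).*2)%N.
by move: (2 ^ _) (binary_value _) => x y; lia.
Qed.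

(** There are no leading zeros, which makes the representation of a number
    unique and of logarithmic size. *)
Lemma last_digits n : last true (digits n).
Proof.
elim: n => //= n; elim: (digits n) => //= c s IHs.
case: c; case: s IHs => [|[] s] //= IHs; try by move/IHs.
Qed.

Lemma size_digits n : size (digits n) <= (trunc_log 2 n).+1.
Proof.
have := last_digits n; rewrite -[in trunc_log _ _](digitsK n).
case: (digits n) => // c s hs.
by apply: trunc_log_max (binary_value_last (hs : last c s)).
Qed.

Lemma size_digits_succ n v : v <= n.+1 -> size (digits v) <= (trunc_log 2 n).+2.
Proof.
move=> le_v; apply: leq_trans (size_digits v) _; rewrite ltnS.
apply: leq_trans (leq_trunc_log 2 le_v) _; case: n {le_v} => // n.
apply: leq_trans (@leq_trunc_log 2 _ (n.+1).*2 _) _; first by lia.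
by rewrite trunc_log2_double.
Qed.

Definition cells (s : seq cell) : nat -> cell := nth None s.

Definition bits (s : seq bool) : seq cell := Some None :: map (fun c => Some (Some c)) s.

Definition counter (v : nat) : nat -> cell := cells (bits (digits v)).

(** * Programs on one tape *)

Section OneTape.

Variables (k : nat) (w : seq bool) (b : nat).
Implicit Types (m : memory k) (j : 'I_k) (t : nat -> cell).
Local Notation exec := (exec w b).
Local Notation fits := (fits w b).

(** Programs on tape [j] run on memories of this form, where [m] fixes the rest. *)
Definition put m j t h : memory k :=
  Memory (head m) (fun i => if i == j then t else tape m i)
    (fun i => if i == j then h else pos m i) (written m).

Lemma fits_put m j t h : fits m -> h < b -> fits (put m j t h).
Proof. by move=> [? hm] hb; split=> //= i; case: eqP. Qed.

Definition on_tape j (g : cell -> cell * move) : action k := fun _ f =>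
  (MoveStay, [ffun i => if i == j then (g (f j)).1 else f i],
   fun i => if i == j then (g (f j)).2 else MoveStay, None).

Definition tape_test j (P : cell -> bool) : test k := fun _ f => P (f j).

Lemma perform_on_tape m j g t h : fits m ->
  perform w (on_tape j g) (put m j t h)
  = put m j (fun i => if i == h then (g (t h)).1 else t i)
      (move_head (g (t h)).2 h).
Proof.
move=> [hm _]; rewrite /perform /= !ffunE /= eqxx; congr Memory.
- exact/minn_idPl.
- apply: functional_extensionality => i; apply: functional_extensionality => x.
  rewrite !ffunE /=; case: (i == j) => //.
  by case: (x =P pos m i) => // ->.
- by apply: functional_extensionality => i; case: eqP.
Qed.

Lemma check_tape_test m j P t h : check w (tape_test j P) (put m j t h) = P (t h).
Proof. by rewrite /check /tape_test ffunE /= eqxx. Qed.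

Lemma exec_on_tape m j g t h t' h' : fits m -> h < b -> h' < b ->
  (forall i, t' i = if i == h then (g (t h)).1 else t i) ->
  h' = move_head (g (t h)).2 h ->
  exec (PAct (on_tape j g)) (put m j t h) (put m j t' h').
Proof.
move=> hm hh hh' Dt' Dh'.
have <-: perform w (on_tape j g) (put m j t h) = put m j t' h'.
  by rewrite perform_on_tape // Dh'; congr put; apply: functional_extensionality.
apply: ExecAct; first exact: fits_put.
by rewrite perform_on_tape // -Dh'; apply: fits_put.
Qed.

Definition advance j : prog k := PAct (on_tape j (fun c => (c, MoveRight))).

Lemma exec_advance m j t h : fits m -> h.+1 < b ->
  exec (advance j) (put m j t h) (put m j t h.+1).
Proof.
by move=> hm hb; apply: exec_on_tape => // [|i]; [exact: ltnW|case: eqP => // ->].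
Qed.

Definition rewind j : prog k :=
  PWhile (tape_test j (predC1 (Some None)))
    (PAct (on_tape j (fun c => (c, MoveLeft)))).

Lemma exec_rewind m j s h : fits m -> h < b ->
  exec (rewind j) (put m j (cells (bits s)) h) (put m j (cells (bits s)) 0).
Proof.
move=> hm; elim: h => [|h IHh] hb.
  by apply: ExecStop; rewrite ?check_tape_test //; apply: fits_put.
have not_mark: cells (bits s) h.+1 != Some None.
  rewrite /cells /=; have [lt_h|le_h] := ltnP h (size s).
    by rewrite (nth_map false).
  by rewrite nth_default ?size_map.
apply: ExecLoop (IHh (ltnW hb)); first exact: fits_put.
  by rewrite check_tape_test.
by apply: exec_on_tape => // [|i]; [exact: ltnW|case: eqP => // ->].
Qed.

Definition increment j : prog k :=
  PSeq (advance j)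
  (PSeq (PWhile (tape_test j (pred1 (Some (Some true))))
     (PAct (on_tape j (fun _ => (Some (Some false), MoveRight)))))
  (PSeq (PAct (on_tape j (fun _ => (Some (Some true), MoveStay))))
     (rewind j))).

(** The carry turns the leading ones into zeros; the first zero, or the first
    blank, becomes a one. *)
Lemma exec_increment m j v : fits m -> (size (digits v)).+1 < b ->
  exec (increment j) (put m j (counter v) 0) (put m j (counter v.+1) 0).
Proof.
move=> hm hb; apply: ExecSeq; first by apply: exec_advance => //; lia.
suff carry s s' : (size s' + size s).+1 < b -> exists h, exists2 t,
  exec (PWhile (tape_test j (pred1 (Some (Some true))))
     (PAct (on_tape j (fun _ => (Some (Some false), MoveRight)))))
   (put m j (cells (bits (s' ++ s))) (size s').+1) (put m j t h)
  & h < b /\ exec (PAct (on_tape j (fun _ => (Some (Some true), MoveStay))))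
     (put m j t h) (put m j (cells (bits (s' ++ binary_succ s))) h).
  have [h [t run1 [hh run2]]] := carry (digits v) [::] hb.
  by apply: ExecSeq run1 _; apply: ExecSeq run2 _; apply: exec_rewind.
elim: s s' => [|[] s IHs] s' hs; first 1 last.
- have [|h [t run1 [hh run2]]] := IHs (rcons s' false).
    by rewrite size_rcons /= in hs *; lia.
  exists h, t; last by split=> //; rewrite -cat_rcons.
  rewrite size_rcons in run1; apply: ExecLoop run1.
  + by apply: fits_put => //=; lia.
  + by rewrite check_tape_test /cells /= map_cat nth_cat size_map ltnn subnn.
  + apply: exec_on_tape => //= [||i]; [lia|by rewrite /= in hs; lia|].
    rewrite /cells; case: i => //= i; rewrite eqSS cat_rcons !map_cat !nth_cat size_map.
    have [lt_i|le_i] := ltnP i; first by rewrite ltn_eqF.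
    case: eqP => [->|ne_i]; first by rewrite subnn.
    by have ->: i - size s' = (i - (size s').+1).+1 by lia.
- exists (size s').+1, (cells (bits (s' ++ false :: s))).
    apply: ExecStop; first by apply: fits_put => //; lia.
    by rewrite check_tape_test /cells /= map_cat nth_cat size_map ltnn subnn.
  split; first by lia.
  apply: exec_on_tape => //= [||i]; [lia|lia|].
  rewrite /cells; case: i => //= i; rewrite eqSS !map_cat !nth_cat size_map.
  have [lt_i|le_i] := ltnP i; first by rewrite ltn_eqF.
  case: eqP => [->|ne_i]; first by rewrite subnn.
  by have ->: i - size s' = (i - (size s').+1).+1 by lia.
- exists (size s').+1, (cells (bits s')); rewrite ?cats0.
    apply: ExecStop; first by apply: fits_put => //; lia.
    by rewrite check_tape_test /cells /= nth_default ?size_map.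
  split; first by lia.
  apply: exec_on_tape => //= [||i]; [lia|lia|].
  rewrite /cells; case: i => //= i; rewrite eqSS !map_cat !nth_cat size_map.
  have [lt_i|le_i] := ltnP i; first by rewrite ltn_eqF.
  case: eqP => [->|ne_i]; first by rewrite subnn.
  by rewrite !nth_default ?size_map //=; lia.
Qed.

Definition reset j : prog k :=
  PSeq (PWhile (tape_test j (predC1 None)) (PAct (on_tape j (fun c => (c, MoveRight)))))
  (PSeq (PAct (on_tape j (fun c => (c, MoveLeft))))
   (PWhile (tape_test j (predC1 (Some None)))
      (PAct (on_tape j (fun _ => (None, MoveLeft)))))).

(** Erasing from the far end back to the mark leaves the representation of [0],
    without stale digits. *)
Lemma exec_reset m j v : fits m -> (size (digits v)).+1 < b ->
  exec (reset j) (put m j (counter v) 0) (put m j (counter 0) 0).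
Proof.
move=> hm hb; set s := digits v in hb *.
apply: (@ExecSeq _ _ _ _ _ _ (put m j (counter v) (size s).+1)).
  have scan s1 s2 : s = s1 ++ s2 -> exec
     (PWhile (tape_test j (predC1 None)) (PAct (on_tape j (fun c => (c, MoveRight)))))
     (put m j (counter v) (size s1).+1) (put m j (counter v) (size s).+1).
    elim: s2 s1 => [|c s2 IHs] s1 Ds.
      rewrite Ds cats0; apply: ExecStop.
        by apply: fits_put => //; move: hb; rewrite Ds cats0.
      by rewrite check_tape_test /counter -/s Ds cats0 /cells /= nth_default ?size_map.
    have lt_s1: (size s1).+2 < b by move: hb; rewrite Ds size_cat /=; lia.
    have := IHs (rcons s1 c); rewrite cat_rcons size_rcons => /(_ Ds).
    apply: ExecLoop; first by apply: fits_put => //; lia.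
      rewrite check_tape_test /counter -/s Ds /cells /= map_cat nth_cat.
      by rewrite size_map ltnn subnn.
    exact: exec_advance.
  apply: ExecLoop (scan [::] s erefl); first by apply: fits_put => //; lia.
    by rewrite check_tape_test.
  by apply: exec_advance => //; lia.
apply: (@ExecSeq _ _ _ _ _ _ (put m j (counter v) (size s))).
  by apply: exec_on_tape => // [|i]; [lia|case: eqP => // ->].
rewrite /counter -/s; elim/last_ind: s hb => [|s c IHs] hb.
  by apply: ExecStop; rewrite ?check_tape_test //; apply: fits_put => //; lia.
rewrite size_rcons in hb *.
apply: ExecLoop (IHs _); last by lia.
- by apply: fits_put => //; lia.
- by rewrite check_tape_test /cells /= map_rcons nth_rcons size_map ltnn eqxx.
- apply: exec_on_tape => //= [||i]; [lia|lia|].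
  rewrite /cells; case: i => //= i; rewrite eqSS map_rcons nth_rcons size_map.
  case: ltngtP => // [lt_i|->]; last by rewrite nth_default ?size_map.
  by rewrite nth_default ?size_map // ltnW.
Qed.

End OneTape.

Lemma update_same (D : Type) (s : nat -> D) r x : update s r x r = x.
Proof. by rewrite /update eqxx. Qed.

Lemma update_other (D : Type) (s : nat -> D) r x j : j != r -> update s r x j = s j.
Proof. by rewrite /update => /negPf->. Qed.

Lemma update_update (D : Type) (s : nat -> D) r x y :
  update (update s r x) r y = update s r y.
Proof. by apply: functional_extensionality => j; rewrite /update; case: eqP. Qed.

Lemma update_id (D : Type) (s : nat -> D) r : update s r (s r) = s.
Proof. by apply: functional_extensionality => j; rewrite /update; case: eqP => // ->. Qed.

(** * Comparison of registers *)

Section Registers.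

Variables (k : nat) (w : seq bool) (b : nat).
Local Notation exec := (exec w b).
Local Notation limit := (size w).+1.

(** One cell more than the digits of any value up to [limit]: scans stop on the
    first blank. *)
Definition roomy := forall v, v <= limit -> (size (digits v)).+1 < b.

Hypothesis room : roomy.

Definition reg (r : nat) : 'I_k.+1 := inord r.

(** The memories between two register operations: every work head is back at
    cell [0], and tape [r] holds the value of register [r]. *)
Definition frame (i : nat) (s : nat -> nat) (o : seq bool) : memory k.+1 :=
  Memory i (fun j => counter (s j)) (fun _ => 0) o.

(** Register [k] permanently holds the largest value that registers may take. *)
Definition proper (i : nat) (s : nat -> nat) :=
  [/\ i <= limit, forall r, s r <= limit & s k = limit].

Lemma b_gt0 : 0 < b.
Proof. by have := room (leq0n limit); case: b. Qed.

Lemma fits_frame i s o : i <= limit -> fits w b (frame i s o).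
Proof. by move=> hi; split=> //= _; apply: b_gt0. Qed.

Lemma put_frame i s o r v : r <= k ->
  put (frame i s o) (reg r) (counter v) 0 = frame i (update s r v) o.
Proof.
move=> hr; rewrite /put /=; congr Memory; apply: functional_extensionality => j.
  by rewrite -val_eqE /= inordK // /update; case: eqP.
by case: eqP.
Qed.

Definition equal_test (r1 r2 : nat) : test k.+1 := fun _ f =>
  (f (reg r1) == None) && (f (reg r2) == None).

(** Both heads advance while they read the same symbol; the digits are equal if
    and only if the heads stop on two blanks. *)
Definition compare (r1 r2 : nat) : prog k.+1 :=
  PWhile (fun _ f => (f (reg r1) == f (reg r2)) && (f (reg r1) != None))
    (PAct (fun _ f => (MoveStay, f,
       fun j => if (j == reg r1) || (j == reg r2) then MoveRight else MoveStay, None))).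

Definition rewind2 (r1 r2 : nat) : prog k.+1 :=
  PSeq (rewind (reg r1)) (rewind (reg r2)).

Lemma size_bits s : size (bits s) = (size s).+1.
Proof. by rewrite /= size_map. Qed.

Lemma None_bits s : None \notin bits s.
Proof. by rewrite inE /=; elim: s. Qed.

Lemma exec_compare r1 r2 i s o : r1 <= k -> r2 <= k -> r1 != r2 -> proper i s ->
  exists m, [/\ exec (compare r1 r2) (frame i s o) m,
    fits w b m, check w (equal_test r1 r2) m = (s r1 == s r2) &
    exec (rewind2 r1 r2) m (frame i s o)].
Proof.
move=> hr1 hr2 ne12 [hi hs _].
have ne_reg : (reg r1 == reg r2) = false.
  by rewrite -val_eqE /= !inordK // (negPf ne12).
pose M h : memory k.+1 := Memory i (fun j => counter (s j))
  (fun j => if (j == reg r1) || (j == reg r2) then h else 0) o.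
have M0: frame i s o = M 0.
  by congr Memory; apply: functional_extensionality => j; rewrite if_same.
have read1 h : scanned (M h) (reg r1) = nth None (bits (digits (s r1))) h.
  by rewrite ffunE /= eqxx inordK.
have read2 h : scanned (M h) (reg r2) = nth None (bits (digits (s r2))) h.
  by rewrite ffunE /= eqxx orbT inordK.
have fitM h : h < b -> fits w b (M h).
  by move=> hb; split=> //= j; case: ifP => // _; apply: b_gt0.
have scan a1 a2 c : bits (digits (s r1)) = c ++ a1 -> bits (digits (s r2)) = c ++ a2 ->
    exists h, [/\ h < b, exec (compare r1 r2) (M (size c)) (M h) &
      check w (equal_test r1 r2) (M h) = (a1 == a2)].
  elim: a1 a2 c => [|x1 a1 IHa] a2 c D1 D2; have lt_c: size c < b.
  - have := room (hs r1); have: size c <= size (bits (digits (s r1))).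
      by rewrite D1 size_cat leq_addr.
    by rewrite size_bits; lia.
  - exists (size c); split=> //.
      apply: ExecStop; first exact: fitM.
      by rewrite /check read1 D1 cats0 nth_default ?andbF.
    rewrite /check /equal_test read1 read2 D1 D2 cats0 nth_default // eqxx /=.
    case: a2 D2 => [|x2 a2] D2; first by rewrite cats0 nth_default.
    rewrite nth_cat ltnn subnn /=; apply: contraNF (None_bits (digits (s r2))).
    by rewrite D2 => /eqP<-; rewrite mem_cat inE eqxx orbT.
  - have := room (hs r1); have: size c <= size (bits (digits (s r1))).
      by rewrite D1 size_cat leq_addr.
    by rewrite size_bits; lia.
  have x1N: x1 != None.
    apply: contraNneq (None_bits (digits (s r1))) => <-.
    by rewrite D1 mem_cat inE eqxx orbT.
  have N1: nth None (bits (digits (s r1))) (size c) = x1.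
    by rewrite D1 nth_cat ltnn subnn.
  have [[a Da]|ne_x] : (exists a, a2 = x1 :: a) \/ nth None a2 0 <> x1.
  - case: a2 D2 => [|x2 a2] _; first by right; apply/eqP; rewrite eq_sym.
    by case: (x2 =P x1) => [->|]; [left; exists a2|right].
  - have [||h [hb run ch]] := IHa a (rcons c x1); rewrite ?cat_rcons -?Da //.
    exists h; split=> //; last by rewrite ch Da eqseq_cons eqxx.
    rewrite size_rcons in run; apply: ExecLoop run.
    + exact: fitM.
    + by rewrite /check read1 read2 N1 D2 Da nth_cat ltnn subnn /= eqxx.
    + have <-: perform w (fun _ f => (MoveStay, f, fun j => if (j == reg r1) ||
         (j == reg r2) then MoveRight else MoveStay, None)) (M (size c))
         = M (size c).+1.
        rewrite /perform /=; congr Memory; first exact/minn_idPl.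
          apply: functional_extensionality => j.
          apply: functional_extensionality => x; rewrite ffunE.
          by case: (x =P _) => // ->.
        by apply: functional_extensionality => j; case: ifP.
      apply: ExecAct; first exact: fitM.
      split; first by rewrite /perform /= geq_minr.
      move=> j /=; case: ifP => _ /=; last exact: b_gt0.
      have := room (hs r1).
      have: (size c).+1 <= size (bits (digits (s r1))).
        by rewrite D1 size_cat /= addnS ltnS leq_addr.
      by rewrite size_bits; apply: leq_ltn_trans.
  - have N2: nth None (bits (digits (s r2))) (size c) = nth None a2 0.
      by rewrite D2 nth_cat ltnn subnn.
    exists (size c); split=> //.
      apply: ExecStop; first exact: fitM.
      by rewrite /check read1 read2 N1 N2 eq_sym (introF eqP ne_x).
    rewrite /check /equal_test read1 N1 (negPf x1N); apply/esym/eqP => E.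
    by apply: ne_x; rewrite -E.
have [h [hb run ch]] := scan _ _ [::] erefl erefl.
exists (M h); split; [by rewrite M0|exact: fitM| |].
  by rewrite ch; apply/eqP/eqP => [[/inj_map E]|-> //]; apply: (can_inj digitsK);
     apply: E => x y [].
have put_M m r : r <= k -> tape m (reg r) = counter (s r) ->
    m = put m (reg r) (counter (s r)) (pos m (reg r)).
  move=> hr Dt; rewrite /put -Dt; case: m {Dt} => ? t p ? /=.
  by congr Memory; apply: functional_extensionality => j; case: eqP => // ->.
apply: (@ExecSeq _ _ _ _ _ _ (put (M h) (reg r1) (counter (s r1)) 0)).
  rewrite [X in exec _ X](@put_M _ r1) //=; last by rewrite inordK.
  by rewrite eqxx; apply: exec_rewind => //; apply: fitM.
have D: tape (put (M h) (reg r1) (counter (s r1)) 0) (reg r2) = counter (s r2).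
  by rewrite /= eq_sym ne_reg inordK.
rewrite [X in exec _ X](@put_M _ r2) //.
have ->: frame i s o = put (put (M h) (reg r1) (counter (s r1)) 0) (reg r2) (counter (s r2)) 0.
  congr Memory; apply: functional_extensionality => j /=.
    case: eqP => [->|_]; first by rewrite inordK.
    by case: eqP => [->|_]; first by rewrite inordK.
  by case: eqP => //; case: eqP.
apply: exec_rewind; first by apply: fits_put; [exact: fitM|exact: b_gt0].
by rewrite /= eq_sym ne_reg eqxx orbT.
Qed.

(** * Programs on registers *)

(** Weakest-precondition style: the final registers are only described by [Q],
    which leaves scratch registers unspecified. *)
Definition yields (p : prog k.+1) i s o (Q : nat -> (nat -> nat) -> seq bool -> Prop) :=
  exists i' s' o', [/\ exec p (frame i s o) (frame i' s' o'), proper i' s' & Q i' s' o'].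

Lemma yields_seq p q i s o Q R : yields p i s o Q ->
  (forall i' s' o', proper i' s' -> Q i' s' o' -> yields q i' s' o' R) ->
  yields (PSeq p q) i s o R.
Proof.
move=> [i1 [s1 [o1 [run1 h1 q1]]]] /(_ _ _ _ h1 q1) [i2 [s2 [o2 [run2 h2 r2]]]].
by exists i2, s2, o2; split=> //; apply: ExecSeq run2.
Qed.

Lemma yields_weaken p i s o (Q R : nat -> (nat -> nat) -> seq bool -> Prop) :
  yields p i s o Q ->
  (forall i' s' o', proper i' s' -> Q i' s' o' -> R i' s' o') -> yields p i s o R.
Proof. by move=> [i' [s' [o' [run h q]]]] QR; exists i', s', o'; split; auto. Qed.

Definition skip : prog k.+1 := PAct (@stay k.+1).

Lemma yields_skip i s o (Q : nat -> (nat -> nat) -> seq bool -> Prop) :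
  proper i s -> Q i s o -> yields skip i s o Q.
Proof.
move=> hs q; exists i, s, o; split=> //; have [hi _ _] := hs.
rewrite -{2}(@perform_stay _ w (frame i s o)) //.
apply: ExecAct; first exact: fits_frame.
by rewrite perform_stay //; apply: fits_frame.
Qed.

Lemma proper_update i s r v : proper i s -> r < k -> v <= limit ->
  proper i (update s r v).
Proof.
move=> [hi hs hk] hr hv; split=> // [j|]; rewrite /update; case: eqP => //.
by move=> Dk; rewrite Dk ltnn in hr.
Qed.

Lemma yields_increment i s o r (Q : nat -> (nat -> nat) -> seq bool -> Prop) :
  proper i s -> r < k -> s r < limit -> Q i (update s r (s r).+1) o ->
  yields (increment (reg r)) i s o Q.
Proof.
move=> hs hr lt_r q; exists i, (update s r (s r).+1), o; split=> //; last first.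
  exact: proper_update.
have [hi hle _] := hs; have hr' := ltnW hr.
rewrite -{1}(update_id s r) -!put_frame //; apply: exec_increment.
  exact: fits_frame.
exact: room.
Qed.

Lemma yields_reset i s o r (Q : nat -> (nat -> nat) -> seq bool -> Prop) :
  proper i s -> r < k -> Q i (update s r 0) o -> yields (reset (reg r)) i s o Q.
Proof.
move=> hs hr q; exists i, (update s r 0), o; split=> //; last first.
  exact: proper_update.
have [hi hle _] := hs; have hr' := ltnW hr.
rewrite -{1}(update_id s r) -!put_frame //; apply: exec_reset.
  exact: fits_frame.
exact: room.
Qed.

Definition if_equal r1 r2 (p q : prog k.+1) : prog k.+1 :=
  PSeq (compare r1 r2)
    (PIf (equal_test r1 r2) (PSeq (rewind2 r1 r2) p) (PSeq (rewind2 r1 r2) q)).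

Lemma yields_if_equal r1 r2 p q i s o Q :
  r1 <= k -> r2 <= k -> r1 != r2 -> proper i s ->
  (s r1 = s r2 -> yields p i s o Q) -> (s r1 <> s r2 -> yields q i s o Q) ->
  yields (if_equal r1 r2 p q) i s o Q.
Proof.
move=> hr1 hr2 ne12 hs Hp Hq.
have [m [run1 hm ch run2]] := exec_compare o hr1 hr2 ne12 hs.
have : yields (if s r1 == s r2 then p else q) i s o Q.
  by case: eqP => [/Hp|/Hq].
move=> [i' [s' [o' [run h' q']]]]; exists i', s', o'; split=> //.
apply: ExecSeq run1 _; apply: ExecIf => //; rewrite ch.
by move: run; case: ifP => _ run; apply: ExecSeq run2 run.
Qed.

(** The heads are left where the comparison stopped, so that the loop test is a
    test on scanned symbols; they are rewound inside the loop. *)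
Definition until_equal r1 r2 (p : prog k.+1) : prog k.+1 :=
  PSeq (compare r1 r2)
    (PSeq (PWhile (fun i f => ~~ equal_test r1 r2 i f)
       (PSeq (rewind2 r1 r2) (PSeq p (compare r1 r2))))
     (rewind2 r1 r2)).

(** [I v] is the loop invariant after [v] rounds, and the registers become equal
    after exactly [n] rounds: this gives termination. *)
Lemma yields_until_equal (I : nat -> nat -> (nat -> nat) -> seq bool -> Prop)
    n r1 r2 p i s o :
  r1 <= k -> r2 <= k -> r1 != r2 -> proper i s -> I 0 i s o ->
  (forall v i s o, I v i s o -> (s r1 == s r2) = (v == n)) ->
  (forall v i s o, v < n -> proper i s -> I v i s o -> yields p i s o (I v.+1)) ->
  yields (until_equal r1 r2 p) i s o (I n).
Proof.
move=> hr1 hr2 ne12 hs I0 HI Hp.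
suff loop d v i1 s1 o1 m : v + d = n -> proper i1 s1 -> I v i1 s1 o1 ->
    fits w b m -> check w (equal_test r1 r2) m = (s1 r1 == s1 r2) ->
    exec (rewind2 r1 r2) m (frame i1 s1 o1) ->
    exists i' s' o', [/\ exec (PSeq (PWhile (fun i f => ~~ equal_test r1 r2 i f)
       (PSeq (rewind2 r1 r2) (PSeq p (compare r1 r2)))) (rewind2 r1 r2))
       m (frame i' s' o'), proper i' s' & I n i' s' o'].
  have [m [run1 hm ch run2]] := exec_compare o hr1 hr2 ne12 hs.
  have [i' [s' [o' [run h' q']]]] := loop n 0 _ _ _ _ erefl hs I0 hm ch run2.
  by exists i', s', o'; split=> //; apply: ExecSeq run1 run.
elim: d v i1 s1 o1 m => [|d IHd] v i1 s1 o1 m Dn h1 Iv hm; rewrite (HI _ _ _ _ Iv).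
  rewrite addn0 in Dn; rewrite Dn eqxx in Iv * => ch run2.
  exists i1, s1, o1; split=> //; apply: ExecSeq run2.
  by apply: ExecStop => //; rewrite negbK.
have lt_v: v < n by rewrite -Dn addnS ltnS leq_addr.
rewrite ltn_eqF // => ch run2.
have [i2 [s2 [o2 [run h2 Iv2]]]] := Hp _ _ _ _ lt_v h1 Iv.
have [m2 [run3 hm2 ch2 run4]] := exec_compare o2 hr1 hr2 ne12 h2.
have [|i' [s' [o' [run' h' q']]]] := IHd v.+1 i2 s2 o2 m2 _ h2 Iv2 hm2 ch2 run4.
  by rewrite addSnnS.
exists i', s', o'; split=> //.
inversion run' as [|p0 q0 m0 mm m3 runw runr| | |]; subst.
apply: ExecSeq runr; apply: ExecLoop runw => //; first by rewrite /check; move/negbT: ch.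
by apply: ExecSeq run2 _; apply: ExecSeq run run3.
Qed.

End Registers.

(** * Copying, adding and moving the input head *)

Section MoreRegisters.

Variables (k : nat) (w : seq bool) (b : nat).
Hypothesis room : roomy w b.
Local Notation limit := (size w).+1.
Local Notation yields := (yields w b).
Local Notation proper := (proper k w).

Definition copy (r r' : nat) : prog k.+1 :=
  PSeq (reset (reg k r)) (until_equal r r' (increment (reg k r))).

Lemma yields_copy i s o r r' (Q : nat -> (nat -> nat) -> seq bool -> Prop) :
  proper i s -> r < k -> r' <= k -> r != r' -> Q i (update s r (s r')) o ->
  yields (copy r r') i s o Q.
Proof.
move=> hs hr hr' ne q; have hk := ltnW hr; have ne' : r' != r by rewrite eq_sym.
pose I v i1 s1 o1 := [/\ i1 = i, s1 = update s r v & o1 = o].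
apply: (yields_seq (Q := I 0)); first by apply: yields_reset.
move=> i1 s1 o1 h1 I0.
apply: (yields_weaken (Q := I (s r'))) => [|_ _ _ _ [-> -> ->] //].
apply: yields_until_equal => // [v i2 s2 o2 [_ -> _]|v i2 s2 o2 lt_v h2 [D2 Ds2 Do2]].
  by rewrite update_same update_other.
have [_ le_s _] := hs.
apply: yields_increment => //; first by rewrite Ds2 update_same (leq_trans lt_v).
by split=> //; rewrite Ds2 update_same update_update.
Qed.

(** Saturation at the limit keeps all values within the space bound, whatever
    the input word. *)
Definition saturating_increment (r : nat) : prog k.+1 :=
  if_equal r k (skip k) (increment (reg k r)).

Lemma yields_saturating_increment i s o r
    (Q : nat -> (nat -> nat) -> seq bool -> Prop) :
  proper i s -> r < k -> Q i (update s r (minn limit (s r).+1)) o ->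
  yields (saturating_increment r) i s o Q.
Proof.
move=> hs hr q; have [_ le_s sk] := hs.
apply: yields_if_equal => //; [exact: ltnW|by rewrite ltn_eqF| |]; rewrite sk => D.
  by apply: yields_skip => //; move: q; rewrite D (minn_idPl _) // -D update_id.
have lt_r: s r < limit by rewrite ltn_neqAle le_s andbT; apply/eqP.
by apply: yields_increment => //; move: q; rewrite (minn_idPr _).
Qed.

Definition add_to (r a c : nat) : prog k.+1 :=
  PSeq (reset (reg k c))
    (until_equal c a (PSeq (increment (reg k c)) (saturating_increment r))).

Lemma yields_add_to i s o r a c (Q : nat -> (nat -> nat) -> seq bool -> Prop) :
  proper i s -> r < k -> a < k -> c < k -> uniq [:: r; a; c] ->
  Q i (update (update s c (s a)) r (minn limit (s r + s a))) o ->
  yields (add_to r a c) i s o Q.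
Proof.
move=> hs hr ha hc; rewrite /= !inE !negb_or -!andbA andbT => /and3P[ra rc ac] q.
have ca : c != a by rewrite eq_sym. have cr : c != r by rewrite eq_sym.
have ar : a != r by rewrite eq_sym.
pose I v i1 s1 o1 := [/\ i1 = i,
  s1 = update (update s c v) r (minn limit (s r + v)) & o1 = o].
have [_ le_s _] := hs.
apply: (yields_seq (Q := I 0)).
  apply: yields_reset => //; split=> //.
  by rewrite addn0 (minn_idPr (le_s r)) -(update_other s 0 rc) update_id.
move=> i1 s1 o1 h1 I0.
apply: (yields_weaken (Q := I (s a))) => [|_ _ _ _ [-> -> ->] //].
apply: yields_until_equal => //; try exact: ltnW.
  by move=> v i2 s2 o2 [_ -> _]; rewrite update_other // update_same !update_other.
move=> v i2 s2 o2 lt_v h2 [-> Ds2 ->].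
have D2c: s2 c = v by rewrite Ds2 update_other ?update_same.
apply: (yields_seq (Q := fun i3 s3 o3 =>
  [/\ i3 = i, s3 = update s2 c v.+1 & o3 = o])).
  have [_ _ hk] := h2; have [_ hle hk'] := hs; have [hi _ _] := hs.
  apply: yields_increment; rewrite ?D2c //; last exact: leq_trans (le_s a).
  by split=> //; case: h2.
move=> i3 s3 o3 h3 [Di Ds Do]; rewrite {}Di {}Ds {}Do in h3 *.
apply: yields_saturating_increment => //; split=> //.
rewrite update_other // Ds2 update_same; apply: functional_extensionality => j.
rewrite /update; case: eqP => // _; first by lia.
by case: eqP.
Qed.

Definition set_one (r : nat) : prog k.+1 :=
  PSeq (reset (reg k r)) (increment (reg k r)).

Lemma yields_set_one i s o r (Q : nat -> (nat -> nat) -> seq bool -> Prop) :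
  proper i s -> r < k -> Q i (update s r 1) o -> yields (set_one r) i s o Q.
Proof.
move=> hs hr q.
apply: (yields_seq (Q := fun i1 s1 o1 => [/\ i1 = i, s1 = update s r 0 & o1 = o])).
  exact: yields_reset.
move=> i1 s1 o1 h1 [Di Ds Do]; rewrite {}Di {}Ds {}Do in h1 *.
apply: yields_increment; rewrite ?update_same //.
by rewrite update_update.
Qed.

Definition emit (c : bool) : prog k.+1 :=
  PAct (fun _ f => (MoveStay, f, fun _ => MoveStay, Some c)).

Lemma yields_emit i s o c (Q : nat -> (nat -> nat) -> seq bool -> Prop) :
  proper i s -> Q i s (rcons o c) -> yields (emit c) i s o Q.
Proof.
move=> hs q; exists i, s, (rcons o c); split=> //; have [hi _ _] := hs.
have D: perform w (fun _ f => (MoveStay, f, fun _ => MoveStay, Some c)) (frame k i s o)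
    = frame k i s (rcons o c).
  have := @perform_stay _ w (frame k i s o) hi.
  by rewrite /perform /= => -[D1 D2]; rewrite D1 D2.
by rewrite -D; apply: ExecAct; rewrite ?D; apply: (fits_frame _ room).
Qed.

Definition home : prog k.+1 :=
  PWhile (fun i _ => if i is LeftEnd then false else true)
    (PAct (fun _ f => (MoveLeft, f, fun _ => MoveStay, None))).

Definition right : prog k.+1 :=
  PAct (fun _ f => (MoveRight, f, fun _ => MoveStay, None)).

Lemma perform_head mi i s o : i <= limit ->
  perform w (fun _ f => (mi, f, fun _ => MoveStay, None)) (frame k i s o)
  = frame k (minn (move_head mi i) limit) s o.
Proof.
move=> hi; have := @perform_stay _ w (frame k i s o) hi.
by rewrite /perform /= => -[D1 D2]; rewrite D2.
Qed.

Lemma yields_right i s o (Q : nat -> (nat -> nat) -> seq bool -> Prop) :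
  proper i s -> Q (minn i.+1 limit) s o -> yields right i s o Q.
Proof.
move=> hs q; exists (minn i.+1 limit), s, o; have [hi hle hk] := hs.
split=> //; last by split=> //; apply: geq_minr.
rewrite -(perform_head MoveRight) //; apply: ExecAct; first exact: (fits_frame _ room).
by rewrite perform_head //; apply: (fits_frame _ room); apply: geq_minr.
Qed.

Lemma yields_home i s o (Q : nat -> (nat -> nat) -> seq bool -> Prop) :
  proper i s -> Q 0 s o -> yields home i s o Q.
Proof.
move=> [hi hle hk] q; exists 0, s, o; split=> //.
elim: i hi => [|i IHi] hi.
  by apply: ExecStop => //; apply: (fits_frame _ room).
have hf := fits_frame k room s o hi.
apply: ExecLoop (IHi (ltnW hi)) => //.
  rewrite /check /= ltnS in hi *.
  have [lt_i|le_i] := ltnP i (size w); first by rewrite (nth_map false).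
  by rewrite nth_default ?size_map.
have D := perform_head MoveLeft s o hi.
rewrite /= (minn_idPl (ltnW hi)) in D; rewrite -D; apply: ExecAct => //.
by rewrite D; apply: (fits_frame _ room); apply: ltnW.
Qed.

End MoreRegisters.

(** * Computable routines *)

(** A routine maps the input word and the registers to a number, left in a
    register, and a word, appended to the output. *)
Definition routine := seq bool -> (nat -> nat) -> nat * seq bool.

Definition agree (m : nat) (s s' : nat -> nat) := forall j, j < m -> s j = s' j.

(** Registers below [m] are preserved; the number is stored, truncated at the
    limit, in register [m]; the registers above [m] are scratch. *)
Definition realizes k (p : prog k.+1) (m : nat) (F : routine) :=
  forall w b, roomy w b -> forall i s o, proper k w i s ->
  yields w b p i s o (fun _ s' o' =>
    [/\ agree m s s', s' m = minn (size w).+1 (F w s).1 & o' = o ++ (F w s).2]).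

(** A routine may read the registers below [n]. The program must exist for every
    position [m] of the result, which is what makes closure under composition
    work: the scratch space of one part starts above the results of the others. *)
Definition computable (n : nat) (F : routine) :=
  (forall w s s', agree n s s' -> F w s = F w s') /\
  exists h, forall k m, n <= m -> m + h < k -> exists p : prog k.+1, realizes p m F.

Lemma agree_trans m s1 s2 s3 : agree m s1 s2 -> agree m s2 s3 -> agree m s1 s3.
Proof. by move=> h1 h2 j hj; rewrite h1 ?h2. Qed.

Lemma agree_le m n s s' : n <= m -> agree m s s' -> agree n s s'.
Proof. by move=> le_n h j hj; apply: h; apply: leq_trans le_n. Qed.

Lemma agree_update m s r x : m <= r -> agree m s (update s r x).
Proof. by move=> le_m j hj; rewrite update_other //; lia. Qed.

Lemma agree_update2 m s r x r' x' : m <= r -> m <= r' ->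
  agree m s (update (update s r x) r' x').
Proof. by move=> hr hr'; apply: agree_trans (agree_update _ _ hr) (agree_update _ _ hr'). Qed.

Lemma agree_sym m s s' : agree m s s' -> agree m s' s.
Proof. by move=> h j /h. Qed.

Lemma computable_widen m n F : n <= m -> computable n F -> computable m F.
Proof.
move=> le_nm [sF [h pF]]; split=> [w s s' /(agree_le le_nm)/sF//|].
by exists h => k m' le_m; apply: pF; apply: leq_trans le_m.
Qed.

Lemma eq_computable n F F' : (forall w s, F w s = F' w s) ->
  computable n F -> computable n F'.
Proof.
move=> E; suff -> : F' = F by [].
by apply: functional_extensionality => w; apply: functional_extensionality => s.
Qed.

Lemma computable_var n r : r < n -> computable n (fun _ s => (s r, [::])).
Proof.
move=> hr; split=> [w s s' h|]; first by rewrite h.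
exists 0 => k m le_m; rewrite addn0 => hk; exists (copy k m r) => w b room i s o hs.
have [_ le_s _] := hs.
apply: (yields_copy room) => //; [lia|lia|].
by rewrite cats0 update_same (minn_idPr (le_s r)); split=> //; apply: agree_update.
Qed.

Lemma computable_limit : computable 0 (fun w _ => ((size w).+1, [::])).
Proof.
split=> //; exists 0 => k m _; rewrite addn0 => hk.
exists (copy k m k) => w b room i s o hs; have [_ _ sk] := hs.
apply: (yields_copy room) => //; first by lia.
by rewrite cats0 update_same sk minnn; split=> //; apply: agree_update.
Qed.

Lemma computable_zero : computable 0 (fun _ _ => (0, [::])).
Proof.
split=> //; exists 0 => k m _; rewrite addn0 => hk.
exists (reset (reg k m)) => w b room i s o hs.
apply: (yields_reset room) => //.
by rewrite cats0 update_same; split=> //; apply: agree_update.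
Qed.

Lemma computable_one : computable 0 (fun _ _ => (1, [::])).
Proof.
split=> //; exists 0 => k m _; rewrite addn0 => hk.
exists (set_one k m) => w b room i s o hs.
apply: (yields_set_one room) => //.
by rewrite cats0 update_same; split=> //; apply: agree_update.
Qed.

Lemma computable_emit c : computable 0 (fun _ _ => (0, [:: c])).
Proof.
split=> //; exists 0 => k m _; rewrite addn0 => hk.
exists (PSeq (reset (reg k m)) (emit k c)) => w b room i s o hs.
apply: (yields_seq (Q := fun _ s' o' => s' = update s m 0 /\ o' = o)).
  exact: (yields_reset room).
move=> i1 s1 o1 h1 [Ds Do]; apply: (yields_emit room) => //; rewrite Ds Do cats1.
by rewrite update_same; split=> //; apply: agree_update.
Qed.

Lemma computable_add n F G : computable n F -> computable n G ->
  computable n (fun w s => ((F w s).1 + (G w s).1, (F w s).2 ++ (G w s).2)).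
Proof.
move=> [sF [hF pF]] [sG [hG pG]]; split=> [w s s' h|].
  by rewrite (sF w s s') // (sG w s s').
exists (hF + hG).+2 => k m le_m hk.
have [||p runF] := pF k m; [lia|lia|].
have [||q runG] := pG k m.+1; [lia|lia|].
exists (PSeq p (PSeq q (add_to k m m.+1 m.+2))) => w b room i s o hs.
apply: (yields_seq (runF w b room i s o hs)) => i1 s1 o1 h1 [a1 D1 ->].
apply: (yields_seq (runG w b room i1 s1 _ h1)) => i2 s2 o2 h2 [a2 D2 ->].
apply: (yields_add_to room) => //; [lia|lia|lia|by rewrite /= !inE; lia|].
rewrite catA -(sG w s s1); last exact: agree_le a1.
split=> //.
  apply: agree_trans a1 _; apply: (agree_trans (agree_le (leqnSn m) a2)).
  by apply: agree_update2; lia.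
rewrite update_same D2 -a2 // D1 -(sG w s s1); first by rewrite /=; lia.
exact: agree_le a1.
Qed.

Lemma computable_if n C F G : computable n C -> computable n F -> computable n G ->
  computable n (fun w s =>
    let R := if (C w s).1 == 0 then G w s else F w s in (R.1, (C w s).2 ++ R.2)).
Proof.
move=> [sC [hC pC]] [sF [hF pF]] [sG [hG pG]]; split=> [w s s' h|].
  by rewrite (sC w s s') // (sF w s s') // (sG w s s').
exists (hC + hF + hG).+2 => k m le_m hk.
have [||c runC] := pC k m; [lia|lia|].
have [||p runF] := pF k m; [lia|lia|].
have [||q runG] := pG k m; [lia|lia|].
exists (PSeq c (PSeq (reset (reg k m.+1)) (if_equal m m.+1 q p))) => w b room i s o hs.
apply: (yields_seq (runC w b room i s o hs)) => i1 s1 o1 h1 [a1 D1 ->].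
apply: (yields_seq (Q := (fun i' s' o' =>
  s' = update s1 m.+1 0 /\ o' = o ++ (C w s).2))).
  by apply: (yields_reset room) => //; lia.
move=> i2 s2 o2 h2 [Ds Do].
have a2: agree m s s2.
  by apply: agree_trans a1 _; rewrite Ds; apply: agree_update.
have D2: (s2 m == s2 m.+1) = ((C w s).1 == 0).
  by rewrite Ds update_same update_other ?D1; lia.
apply: (yields_if_equal room) => //; [lia|lia|lia| |] => E.
  move/eqP: E; rewrite D2 => ->.
  apply: yields_weaken (runG w b room i2 s2 o2 h2) _ => i3 s3 o3 _ [a3 D3 ->] /=.
  rewrite (sG w s s2); last exact: agree_le a2.
  by split=> //; [apply: agree_trans a3|rewrite Do catA].
move/eqP: E; rewrite D2 => /negPf->.
apply: yields_weaken (runF w b room i2 s2 o2 h2) _ => i3 s3 o3 _ [a3 D3 ->] /=.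
rewrite (sF w s s2); last exact: agree_le a2.
by split=> //; [apply: agree_trans a3|rewrite Do catA].
Qed.

Lemma computable_eq n F G : computable n F -> computable n G ->
  computable n (fun w s =>
    (nat_of_bool (minn (size w).+1 (F w s).1 == minn (size w).+1 (G w s).1),
     (F w s).2 ++ (G w s).2)).
Proof.
move=> [sF [hF pF]] [sG [hG pG]]; split=> [w s s' h|].
  by rewrite (sF w s s') // (sG w s s').
exists (hF + hG).+2 => k m le_m hk.
have [||p runF] := pF k m; [lia|lia|].
have [||q runG] := pG k m.+1; [lia|lia|].
exists (PSeq p (PSeq q (if_equal m m.+1 (set_one k m) (reset (reg k m))))).
move=> w b room i s o hs.
apply: (yields_seq (runF w b room i s o hs)) => i1 s1 o1 h1 [a1 D1 ->].
apply: (yields_seq (runG w b room i1 s1 _ h1)) => i2 s2 o2 h2 [a2 D2 ->].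
have EG: G w s1 = G w s by apply: sG; apply: agree_sym; apply: agree_le a1.
have a x: agree m s (update s2 m x).
  apply: agree_trans a1 (agree_trans (agree_le (leqnSn m) a2) _).
  exact: agree_update.
rewrite EG in D2 *; rewrite -D1 -D2 (a2 m) // -catA.
apply: (yields_if_equal room) => //; [lia|lia|lia| |] => E.
  rewrite E eqxx; apply: (yields_set_one room) => //; first by lia.
  by rewrite update_same; split=> //; rewrite /=; lia.
rewrite (introF eqP E); apply: (yields_reset room) => //; first by lia.
by rewrite update_same.
Qed.

(** Numbers add up and words are concatenated over the rounds, in which register
    [x] takes the values below the bound. The bound variable [x] is an input
    register, so its value is saved and restored. *)
Lemma computable_loop n x F G : x < n -> computable n F -> computable n G ->
  computable n (fun w s => let B := minn (size w).+1 (F w s).1 in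
    (\sum_(0 <= v < B) (G w (update s x v)).1,
     (F w s).2 ++ flatten [seq (G w (update s x v)).2 | v <- iota 0 B])).
Proof.
move=> hx [sF [hF pF]] [sG [hG pG]]; split=> [w s s' h|].
  have E v: G w (update s x v) = G w (update s' x v).
    by apply: sG => j hj; rewrite /update; case: eqP => // _; apply: h.
  rewrite /= (sF w s s') //; congr pair; first by apply: eq_bigr => v _; rewrite E.
  by congr (_ ++ flatten _); apply: eq_map => v; rewrite E.
exists (hF + hG).+4 => k m le_m hk.
have [||p runF] := pF k m.+1; [lia|lia|].
have [||q runG] := pG k m.+3; [lia|lia|].
exists (PSeq p (PSeq (copy k m.+2 x) (PSeq (reset (reg k m)) (PSeq (reset (reg k x))
  (PSeq (until_equal x m.+1 (PSeq q (PSeq (add_to k m m.+3 m.+4) (increment (reg k x)))))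
    (copy k x m.+2)))))).
move=> w b room i s o hs.
apply: (yields_seq (runF w b room i s o hs)) => i1 s1 o1 h1 [a1 D1 Do1].
set B := minn _ _ in D1 *.
pose I v (i' : nat) s' o' := [/\ forall j, j < m -> j != x -> s' j = s j, s' x = v,
  s' m = minn (size w).+1 (\sum_(0 <= u < v) (G w (update s x u)).1) &
  [/\ s' m.+1 = B, s' m.+2 = s x &
   o' = o ++ (F w s).2 ++ flatten [seq (G w (update s x u)).2 | u <- iota 0 v]]].
have le_B: B <= (size w).+1 by apply: geq_minl.
apply: (yields_seq (Q := (fun _ s' o' =>
  s' = update s1 m.+2 (s x) /\ o' = o ++ (F w s).2))).
  apply: (yields_copy room) => //; [lia|lia|lia|].
  by rewrite -a1; [|lia].
move=> i2 s2 o2 h2 [Ds2 Do2].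
apply: (yields_seq (Q := (fun _ s' o' =>
  s' = update s2 m 0 /\ o' = o2))).
  by apply: (yields_reset room) => //; lia.
move=> i3 s3 o3 h3 [Ds3 Do3].
apply: (yields_seq (Q := I 0)).
  apply: (yields_reset room) => //; first by lia.
  split; rewrite ?update_same //.
  - move=> j hj ne; rewrite Ds3 Ds2 !update_other //; [|lia|lia].
    by rewrite -a1 //; lia.
  - by rewrite big_nil update_other ?Ds3 ?update_same; lia.
  rewrite !update_other ?Ds3 ?Ds2 /=; [|lia|lia].
  rewrite cats0 Do3 Do2; split=> //.
    by rewrite !update_other ?D1; lia.
  by rewrite update_other ?update_same; lia.
move=> i4 s4 o4 h4 I0.
apply: (yields_seq (Q := I B)).
  apply: (yields_until_equal room) => //; [lia|lia|lia| |].
    by move=> v i5 s5 o5 [_ -> _ [-> _ _]].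
  move=> v i5 s5 o5 lt_v h5 [a5 D5x D5m [D5B D5s D5o]].
  have E5: G w s5 = G w (update s x v).
    by apply: sG => j hj; rewrite /update; case: eqP => [->//|/eqP ne]; apply: a5; lia.
  apply: (yields_seq (runG w b room _ _ _ h5)) => i6 s6 o6 h6 [a6 D6 Do6].
  rewrite E5 in D6 Do6.
  apply: (yields_seq (Q := (fun _ s' o' => o' = o6 /\
     s' = update (update s6 m.+4 (s6 m.+3)) m (minn (size w).+1 (s6 m + s6 m.+3))))).
    apply: (yields_add_to room) => //; [lia|lia|lia|by rewrite /= !inE; lia].
  move=> i7 s7 o7 h7 [Do7 Ds7].
  have D7x: s7 x = v by rewrite Ds7 !update_other -?a6 ?D5x; lia.
  apply: (yields_increment room) => //; first by lia.
    by rewrite D7x; apply: leq_trans le_B.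
  split; rewrite ?update_same ?D7x //.
  - move=> j hj ne; rewrite update_other // Ds7 !update_other; [|lia|lia].
    by rewrite -a6 ?a5 //; lia.
  - rewrite update_other; last by lia.
    rewrite Ds7 update_same -a6; last by lia.
    by rewrite D5m D6 big_nat_recr //=; lia.
  rewrite !update_other ?Ds7; [|lia|lia]; rewrite !update_other; [|lia|lia|lia|lia].
  rewrite -!a6 ?D5B ?D5s; [|lia|lia].
  split=> //; rewrite Do7 Do6 D5o -(addn1 v) iotaD map_cat flatten_cat /= cats0 !catA.
  by rewrite add0n.
move=> i5 s5 o5 h5 [a5 D5x D5m [D5B D5s D5o]].
apply: (yields_copy room) => //; [lia|lia|lia|].
split=> //; last by rewrite update_other; [exact: D5m|lia].
by move=> j hj; rewrite /update; case: eqP => [->|/eqP ne]; rewrite ?D5s ?a5.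
Qed.

(** The input head walks from the left end marker while a register counts up to
    the position; the marker is the extra [right] before the loop. *)
Lemma computable_bit n F : computable n F ->
  computable n (fun w s => (nat_of_bool (nth false w (F w s).1), (F w s).2)).
Proof.
move=> [sF [hF pF]]; split=> [w s s' h|]; first by rewrite (sF w s s').
exists hF.+2 => k m le_m hk.
have [||p runF] := pF k m; [lia|lia|].
exists (PSeq p (PSeq (home k) (PSeq (right k) (PSeq (reset (reg k m.+1))
  (PSeq (until_equal m.+1 m (PSeq (increment (reg k m.+1)) (right k)))
    (PIf (fun i _ => if i is Bit true then true else false)
       (set_one k m) (reset (reg k m)))))))) => w b room i s o hs.
apply: (yields_seq (runF w b room i s o hs)) => i1 s1 o1 h1 [a1 D1 ->].
set n1 := minn _ _ in D1; set o2 := o ++ _.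
have le_n1: n1 <= (size w).+1 by apply: geq_minl.
pose I v i' s' o' := [/\ i' = minn v.+1 (size w).+1, s' = update s1 m.+1 v & o' = o2].
apply: (yields_seq (Q := (fun i' s' o' =>
  [/\ i' = 0, s' = s1 & o' = o2]))); first exact: yields_home.
move=> i3 s3 o3 h3 [D3 Ds3 Do3].
apply: (yields_seq (Q := (fun i' s' o' =>
  [/\ i' = minn 1 (size w).+1, s' = s1 & o' = o2]))).
  by apply: (yields_right room) => //; rewrite D3.
move=> i4 s4 o4 h4 [D4 Ds4 Do4].
apply: (yields_seq (Q := I 0)).
  by apply: (yields_reset room) => //; [lia|split=> //; rewrite Ds4].
move=> i5 s5 o5 h5 I0.
apply: (yields_seq (Q := I n1)).
  apply: (yields_until_equal room) => //; [lia|lia|lia| |].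
    by move=> v i6 s6 o6 [_ -> _]; rewrite update_same update_other ?D1; lia.
  move=> v i6 s6 o6 lt_v h6 [D6 Ds6 Do6].
  apply: (yields_seq (Q := (fun i' s' o' =>
    [/\ i' = i6, s' = update s1 m.+1 v.+1 & o' = o2]))).
    apply: (yields_increment room) => //; first by lia.
      by rewrite Ds6 update_same; apply: leq_trans le_n1.
    by rewrite Ds6 update_update update_same.
  move=> i7 s7 o7 h7 [D7 Ds7 Do7]; apply: (yields_right room) => //; split=> //.
  by rewrite D7 D6; lia.
move=> i6 s6 o6 h6 [D6 Ds6 Do6].
have a6 v: agree m s (update s6 m v).
  apply: agree_trans a1 _; rewrite Ds6.
  by apply: agree_update2; lia.
have Dbit: (if read_input w i6 is Bit true then true else false)
    = nth false w (F w s).1.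
  rewrite D6 /n1; have [lt_F|le_F] := ltnP (F w s).1 (size w).
    have -> : minn (minn (size w).+1 (F w s).1).+1 (size w).+1 = (F w s).1.+1 by lia.
    by rewrite /= (nth_map false) //; case: nth.
  rewrite nth_default //.
  have -> : minn (minn (size w).+1 (F w s).1).+1 (size w).+1 = (size w).+1 by lia.
  by rewrite /= nth_default ?size_map.
suff [i7 [s7 [o7 [run h7 q7]]]] : yields w b
    (if nth false w (F w s).1 then set_one k m else reset (reg k m)) i6 s6 o6
    (fun _ s' o' => [/\ agree m s s',
       s' m = minn (size w).+1 (nat_of_bool (nth false w (F w s).1)) & o' = o2]).
  exists i7, s7, o7; split=> //; apply: ExecIf; first by have [? _ _] := h6; apply: fits_frame.
  by rewrite /check Dbit.
case: nth.
  apply: (yields_set_one room) => //; first by lia.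
  by rewrite update_same; split=> //; lia.
apply: (yields_reset room) => //; first by lia.
by rewrite update_same.
Qed.

(** * From routines to transducers *)

(** The initialisation marks cell [0] of all tapes, and computes the limit by
    walking over the input. *)
Lemma computable_logspace n F : computable n F ->
  logspace_computable (fun w => (F w (fun _ => 0)).2).
Proof.
move=> [sF [h pF]].
have [||p runF] := pF (n + h).+1 n; [lia|lia|]; set k := (n + h).+1 in p runF.
pose marks : prog k.+1 := PAct (fun _ _ =>
  (MoveStay, [ffun _ => Some None], fun _ => MoveStay, None)).
pose measure := PSeq marks (PWhile (fun i _ => if i is RightEnd then false else true)
  (PSeq (increment (reg k k)) (right k))).
apply: (@exec_logspace _ (PSeq measure p) 4) => w; set b := 4 * _.
have room : roomy w b.
  by move=> v /size_digits_succ; rewrite /b; lia.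
pose s0 v := update (fun _ => 0) k v.
have fit i v : i <= (size w).+1 -> fits w b (frame k i (s0 v) [::]).
  exact: fits_frame.
have run0 : exec w b marks (blank_memory k.+1) (frame k 0 (s0 0) [::]).
  have D: perform w (fun _ _ => (MoveStay, [ffun _ => Some None], fun _ => MoveStay, None))
     (blank_memory k.+1) = frame k 0 (s0 0) [::].
    congr Memory; apply: functional_extensionality => j.
    apply: functional_extensionality => x; rewrite ffunE /counter /s0 /update if_same.
    by case: x => [|[]].
  rewrite -D; apply: ExecAct; last by rewrite D; apply: fit.
  by split=> //= j; rewrite /b; lia.
have loop d v : v + d = (size w).+1 -> exec w b
    (PWhile (fun i _ => if i is RightEnd then false else true)
       (PSeq (increment (reg k k)) (right k)))
    (frame k v (s0 v) [::]) (frame k (size w).+1 (s0 (size w).+1) [::]).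
  elim: d v => [|d IHd] v; rewrite ?addn0 => Dv.
    rewrite Dv; apply: ExecStop; first exact: fit.
    by rewrite /check /= nth_default ?size_map.
  have le_v: v <= size w by lia.
  have := IHd v.+1; rewrite addSnnS => /(_ Dv); apply: ExecLoop.
  - by apply: fit; lia.
  - rewrite /check /=; case: v le_v {Dv} => //= v le_v.
    by rewrite (nth_map false).
  apply: (@ExecSeq _ _ _ _ _ _ (frame k v (s0 v.+1) [::])).
    rewrite -{1}(update_id (s0 v) k) -(put_frame v _ [::] _ (leqnn k)).
    have ->: frame k v (s0 v.+1) [::] = put (frame k v (s0 v) [::]) (reg k k)
        (counter (s0 v k).+1) 0.
      by rewrite put_frame // /s0 update_update update_same.
    apply: exec_increment; first by apply: fit; lia.
    by apply: room; rewrite /s0 update_same; lia.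
  have Dr := perform_head k MoveRight (s0 v.+1) [::] (leqW le_v).
  rewrite /= (minn_idPl _) // in Dr; rewrite -Dr; apply: ExecAct.
    by apply: fit; lia.
  by rewrite Dr; apply: fit.
have h0: proper k w (size w).+1 (s0 (size w).+1).
  split=> //; last by rewrite /s0 update_same.
  by move=> r; rewrite /s0 /update; case: ifP.
have [i' [s' [o' [run _ [_ _ Do]]]]] := runF w b room _ _ [::] h0.
exists (frame k i' s' o').
  by apply: ExecSeq run; apply: ExecSeq run0 _; apply: loop.
rewrite /= Do; congr (_.2); apply: sF => j hj.
by rewrite /s0 update_other // /k; lia.
Qed.

(** Registers used as bound variables need not count as inputs. *)
Lemma computable_narrow n m F : computable m F ->
  (forall w s s', agree n s s' -> F w s = F w s') -> computable n F.
Proof.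
move=> [_ [h pF]] sF; split=> //; exists (m + h).+1 => k m' le_m hk.
have [||p runp] := pF k (m' + m).+1; [lia|lia|].
exists (PSeq p (copy k m' (m' + m).+1)) => w b room i s o hs.
apply: (yields_seq (runp w b room i s o hs)) => i1 s1 o1 h1 [a1 D1 ->].
apply: (yields_copy room) => //; [lia|lia|lia|].
rewrite update_same D1; split=> //.
apply: agree_trans (agree_le _ a1) (agree_update _ _ (leqnn _)); lia.
Qed.

(** * Numerical routines *)

Definition numerical n (f : seq bool -> (nat -> nat) -> nat) :=
  computable n (fun w s => (f w s, [::])).

Lemma numerical_widen m n f : n <= m -> numerical n f -> numerical m f.
Proof. exact: computable_widen. Qed.

Lemma numerical_add n f g : numerical n f -> numerical n g ->
  numerical n (fun w s => f w s + g w s).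
Proof. by move=> hf hg; apply: eq_computable (computable_add hf hg). Qed.

Lemma numerical_if n c f g : numerical n c -> numerical n f -> numerical n g ->
  numerical n (fun w s => if c w s == 0 then g w s else f w s).
Proof.
move=> hc hf hg; apply: eq_computable (computable_if hc hf hg) => w s /=.
by case: eqP.
Qed.

Lemma numerical_zero n : numerical n (fun _ _ => 0).
Proof. exact: computable_widen computable_zero. Qed.

Lemma numerical_one n : numerical n (fun _ _ => 1).
Proof. exact: computable_widen computable_one. Qed.

Lemma numerical_not n f : numerical n f -> numerical n (fun w s => nat_of_bool (f w s == 0)).
Proof.
move=> hf; apply: eq_computable (numerical_if hf (numerical_zero n) (numerical_one n)).
by move=> w s; case: eqP.
Qed.

Lemma numerical_loop n x f g : x < n -> numerical n f -> numerical n g ->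
  numerical n (fun w s =>
    \sum_(0 <= v < minn (size w).+1 (f w s)) g w (update s x v)).
Proof.
move=> hx hf hg; apply: eq_computable (computable_loop hx hf hg) => w s /=.
by congr pair; elim: (iota _ _).
Qed.

(** A product is a sum of equal terms. *)
Lemma numerical_mul n f g : numerical n f -> numerical n g ->
  numerical n (fun w s => minn (size w).+1 (f w s) * g w s).
Proof.
move=> hf hg; have [[sf _] [sg _]] := (hf, hg).
apply: (computable_narrow (m := n.+1)); last first.
  by move=> w s s' h; case: (sf w s s' h) (sg w s s' h) => -> [->].
apply: eq_computable (numerical_loop (ltnSn n) (numerical_widen (leqnSn n) hf)
  (numerical_widen (leqnSn n) hg)) => w s /=.
congr pair; rewrite (eq_bigr (fun _ => g w s)); first by rewrite sum_nat_const_nat subn0.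
by move=> v _; have [->] := sg w s (update s n v) (agree_update _ _ (leqnn n)).
Qed.

Lemma numerical_bit n f : numerical n f ->
  numerical n (fun w s => nat_of_bool (nth false w (f w s))).
Proof. exact: computable_bit. Qed.

(** [s x < s y] holds when [s x] is one of the values below [s y]. *)
Lemma numerical_less n x y : x < n -> y < n ->
  numerical n (fun w s => \sum_(0 <= v < minn (size w).+1 (s y))
    nat_of_bool (minn (size w).+1 v == minn (size w).+1 (s x))).
Proof.
move=> hx hy; have widen z : z < n -> z < n.+1 by lia.
apply: (computable_narrow (m := n.+1)); last by move=> w s s' h; rewrite !h.
have heq : numerical n.+1 (fun w s => nat_of_bool
    (minn (size w).+1 (s n) == minn (size w).+1 (s x))).
  exact: computable_eq (computable_var (ltnSn n)) (computable_var (widen _ hx)).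
apply: eq_computable (numerical_loop (ltnSn n) (computable_var (widen _ hy)) heq).
move=> w s /=; congr pair; apply: eq_bigr => v _.
by rewrite update_same update_other //; lia.
Qed.

(** The number of positions before the first [false], that is the unary prefix
    of an encoding. *)
Definition domain_size (w : seq bool) : nat :=
  \sum_(0 <= v < minn (size w).+1 (size w).+1)
    nat_of_bool (\sum_(0 <= u < minn (size w).+1 (v + 1))
       nat_of_bool (nat_of_bool (nth false w u) == 0) == 0).

Lemma numerical_domain_size n : numerical n (fun w _ => domain_size w).
Proof.
apply: computable_widen (leq0n n) _; apply: (computable_narrow (m := 2)) => //.
have h0 := numerical_not (numerical_bit (@computable_var 2 1 isT)).
have h1 := numerical_loop (isT : 1 < 2) (numerical_add (@computable_var 2 0 isT)
  (numerical_one 2)) h0.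
apply: eq_computable (numerical_loop (isT : 0 < 2)
  (computable_widen (isT : 0 <= 2) computable_limit) (numerical_not h1)) => w s /=.
by congr pair; apply: eq_bigr => v _.
Qed.

(** * Encodings of structures *)

Section Encoding.

Variables (tau : signature) (A : structure tau).

Definition table (R : tau) : seq bool :=
  [seq @interp tau A R t | t <- all_tuples A (arity R)].

Lemma encodeE :
  encode A = nseq #|A| true ++ false :: flatten [seq table R | R <- enum tau].
Proof. by []. Qed.

Lemma size_all_tuples (D : finType) r : size (all_tuples D r) = #|D| ^ r.
Proof. by elim: r => //= r IHr; rewrite size_allpairs IHr -cardE expnS. Qed.

Lemma domain_size_encode : domain_size (encode A) = #|A|.
Proof.
have bitE u : nth false (encode A) u = (u < #|A|) || (nth false (encode A) u && (#|A| < u)).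
  rewrite encodeE nth_cat size_nseq; case: ltngtP => [lt_u|lt_u|->].
  - by rewrite nth_nseq lt_u.
  - by rewrite andbT.
  - by rewrite subnn.
rewrite /domain_size minnn (eq_big_nat _ _ (F2 := fun v => nat_of_bool (v < #|A|))).
  have le_n: #|A| <= (size (encode A)).+1.
    by rewrite encodeE size_cat size_nseq -addnS leq_addr.
  rewrite (big_cat_nat _ le_n) //= (eq_big_nat _ _ (F2 := fun _ => 1)); last first.
    by move=> v /andP[_ ->].
  rewrite sum_nat_const_nat subn0 muln1 big_nat_cond big1 ?addn0 // => v.
  by rewrite andbT => /andP[le_v _]; rewrite ltnNge le_v.
move=> v /andP[_ lt_v]; rewrite addn1 (minn_idPr lt_v); congr nat_of_bool.
have [lt_vA|le_Av] := ltnP v #|A|.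
  apply/eqP; rewrite big_nat_cond big1 // => u; rewrite andbT => /andP[_ le_u].
  by rewrite bitE (leq_ltn_trans _ lt_vA).
rewrite (big_cat_nat _ (n := #|A|)) //=; last by apply: leq_trans le_Av _.
rewrite (big_ltn (m := #|A|)) //=.
by rewrite bitE ltnn andbF /= addnCA.
Qed.

(** The rank of [t] among the tuples over [A] in lexicographic order. *)
Fixpoint lexicographic (t : seq A) : nat :=
  if t is a :: t' then enum_rank a * #|A| ^ size t' + lexicographic t' else 0.

(** The position of the table of [R] in the encoding. *)
Definition block_start (R : tau) : nat :=
  #|A|.+1 + \sum_(S <- take (index R (enum tau)) (enum tau)) #|A| ^ arity S.

Lemma nth_flatten_uniform (T : Type) (x : T) ss q i j :
  all (fun s => size s == q) ss -> i < size ss -> j < q ->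
  nth x (flatten ss) (i * q + j) = nth x (nth [::] ss i) j.
Proof.
elim: ss i => //= s ss IHs [|i] /andP[/eqP Ds all_q] hi hj; rewrite nth_cat Ds.
  by rewrite mul0n add0n hj.
by rewrite mulSn -addnA ltnNge leq_addr /= addKn IHs.
Qed.

Lemma lexicographic_lt t : lexicographic t < #|A| ^ size t.
Proof.
elim: t => //= a t IHt; rewrite expnS.
apply: (@leq_trans ((enum_rank a).+1 * #|A| ^ size t)).
  by rewrite mulSn addnC ltn_add2r.
by rewrite leq_mul2r ltn_ord orbT.
Qed.

Lemma nth_all_tuples r (t0 t : r.-tuple A) :
  nth t0 (all_tuples A r) (lexicographic t) = t.
Proof.
elim: r t0 t => [|r IHr] t0 t; first by rewrite (tuple0 t0) (tuple0 t).
case/tupleP: t => a t /=; rewrite nth_flatten_uniform.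
- rewrite (nth_map a); last by rewrite -cardE.
  rewrite nth_enum_rank (nth_map t) ?IHr ?size_all_tuples //.
  by rewrite -{2}(size_tuple t) lexicographic_lt.
- by apply/allP => s /mapP[b _ ->]; rewrite size_map size_all_tuples size_tuple.
- by rewrite size_map -cardE.
- by rewrite size_tuple -{2}(size_tuple t) lexicographic_lt.
Qed.

Lemma nth_encode (R : tau) (t : (arity R).-tuple A) :
  nth false (encode A) (block_start R + lexicographic t) = interp t.
Proof.
set s := take (index R (enum tau)) (enum tau).
have Ds: enum tau = s ++ R :: drop (index R (enum tau)).+1 (enum tau).
  have hR: index R (enum tau) < size (enum tau) by rewrite index_mem mem_enum.
  by rewrite -[LHS](cat_take_drop (index R (enum tau))) (drop_nth R hR) nth_index ?mem_enum.
have Dsize: size (flatten [seq table R' | R' <- s]) = \sum_(S <- s) #|A| ^ arity S.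
  elim: s {Ds} => [|R' s IHs]; first by rewrite big_nil.
  by rewrite big_cons /= size_cat IHs size_map size_all_tuples.
rewrite encodeE nth_cat size_nseq ltnNge (leq_trans (leqnSn _)) /=; last first.
  by rewrite /block_start -addnA leq_addr.
rewrite /block_start -/s !addSn -!addnA subSn ?leq_addr // addKn /=.
rewrite Ds map_cat flatten_cat nth_cat Dsize ltnNge leq_addr /= addKn.
have lt_t : lexicographic t < size (all_tuples A (arity R)).
  by rewrite size_all_tuples -[X in _ ^ X](size_tuple t) lexicographic_lt.
by rewrite nth_cat size_map lt_t (nth_map t) // nth_all_tuples.
Qed.

End Encoding.

(** * Expressible functions of a structure *)

(** A relation as a predicate of sequences: this spares casts between equal
    arities. *)
Definition holds (tau : signature) (A : structure tau) (R : tau) (s : seq A) : bool :=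
  if insub s is Some t then @interp tau A R t else false.

Lemma holds_tuple (tau : signature) (A : structure tau) (R : tau)
  (t : (arity R).-tuple A) : holds R t = interp t.
Proof. by rewrite /holds valK. Qed.

Definition ranks (T : finType) (v : nat -> T) (i : nat) : nat := enum_rank (v i).

Lemma ranks_update (T : finType) (v : nat -> T) x a :
  ranks (update v x a) = update (ranks v) x (enum_rank a).
Proof.
by apply: functional_extensionality => i; rewrite /ranks /update; case: eqP.
Qed.

Lemma iota_ranks (T : finType) : [seq val (enum_rank a) | a <- enum T] = iota 0 #|T|.
Proof.
apply: (@eq_from_nth _ 0); first by rewrite size_map size_iota -cardE.
move=> i; rewrite size_map -cardE => lt_i; rewrite nth_iota // add0n.
case: (pickP T) => [a _|T0]; last by rewrite eq_card0 in lt_i.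
rewrite (nth_map a) -?cardE //.
by rewrite -[i]/(val (Ordinal lt_i)) -(enum_val_nth a) enum_valK.
Qed.

Section Expressible.

Variable tau : signature.
Implicit Types A : structure tau.

(** A function of a structure and a valuation, computed from the encoding and the
    ranks of the values. The valuation only enters through ranks, so quantifiers
    over the domain are bounded loops. *)
Definition expressible (f : forall A, (nat -> A) -> nat * seq bool) : Prop :=
  exists n F, computable n F /\ forall A v, F (encode A) (ranks v) = f A v.

Definition definable (q : forall A, (nat -> A) -> bool) : Prop :=
  expressible (fun A v => (nat_of_bool (q A v), [::])).

Definition writable (g : forall A, (nat -> A) -> seq bool) : Prop :=
  expressible (fun A v => (0, g A v)).

Lemma eq_expressible f f' : (forall A v, f A v = f' A v) ->
  expressible f -> expressible f'.
Proof. by move=> E [n [F [cF DF]]]; exists n, F; split=> // A v; rewrite DF. Qed.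

Lemma eq_definable q q' : (forall A v, q A v = q' A v) -> definable q -> definable q'.
Proof. by move=> E; apply: eq_expressible => A v; rewrite E. Qed.

Lemma eq_writable g g' : (forall A v, g A v = g' A v) -> writable g -> writable g'.
Proof. by move=> E; apply: eq_expressible => A v; rewrite E. Qed.

Lemma expressible_add f g : expressible f -> expressible g ->
  expressible (fun A v => ((f A v).1 + (g A v).1, (f A v).2 ++ (g A v).2)).
Proof.
move=> [n [F [cF DF]]] [m [G [cG DG]]]; exists (maxn n m).
exists (fun w s => ((F w s).1 + (G w s).1, (F w s).2 ++ (G w s).2)); split.
  apply: computable_add; [apply: computable_widen cF|apply: computable_widen cG]; lia.
by move=> A v; rewrite DF DG.
Qed.

Lemma expressible_if q f g : definable q -> expressible f -> expressible g ->
  expressible (fun A v => if q A v then f A v else g A v).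
Proof.
move=> [l [C [cC DC]]] [n [F [cF DF]]] [m [G [cG DG]]]; exists (maxn l (maxn n m)).
eexists; split.
  apply: computable_if; [apply: computable_widen cC|
    apply: computable_widen cF|apply: computable_widen cG]; lia.
by move=> A v; rewrite /= DF DG DC /=; case: (q A v); rewrite /= -surjective_pairing.
Qed.

Lemma expressible_loop x f : expressible f ->
  expressible (fun A v => (\sum_(a <- enum A) (f A (update v x a)).1,
    flatten [seq (f A (update v x a)).2 | a <- enum A])).
Proof.
move=> [n [F [cF DF]]]; exists (maxn n x.+1); eexists; split.
  apply: (computable_loop (x := x)); [by rewrite leq_max leqnn orbT| |].
    exact: (numerical_domain_size (maxn n x.+1)).
  by apply: computable_widen cF; apply: leq_maxl.
move=> A v /=; rewrite domain_size_encode (minn_idPr _); last first.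
  by rewrite encodeE size_cat size_nseq -addnS leq_addr.
rewrite /index_iota subn0 -(iota_ranks A) big_map -map_comp.
congr pair; first by apply: eq_bigr => a _; rewrite -DF ranks_update.
by congr flatten; apply: eq_map => a /=; rewrite -DF ranks_update.
Qed.

(** * Definable queries *)

Lemma definable_const b : definable (fun _ _ => b).
Proof.
exists 0, (fun _ _ => (nat_of_bool b, [::])); split=> //.
by case: b; [apply: computable_one|apply: computable_zero].
Qed.

Lemma definable_if q q1 q2 : definable q -> definable q1 -> definable q2 ->
  definable (fun A v => if q A v then q1 A v else q2 A v).
Proof.
move=> h h1 h2; apply: eq_expressible (expressible_if h h1 h2) => A v.
by case: (q A v).
Qed.

Lemma definable_not q : definable q -> definable (fun A v => ~~ q A v).
Proof. by move=> h; apply: definable_if h (definable_const _) (definable_const _). Qed.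

Lemma definable_and q1 q2 : definable q1 -> definable q2 ->
  definable (fun A v => q1 A v && q2 A v).
Proof. by move=> h1 h2; apply: definable_if h1 h2 (definable_const _). Qed.

Lemma definable_or q1 q2 : definable q1 -> definable q2 ->
  definable (fun A v => q1 A v || q2 A v).
Proof. by move=> h1 h2; apply: definable_if h1 (definable_const _) h2. Qed.

Lemma definable_imp q1 q2 : definable q1 -> definable q2 ->
  definable (fun A v => q1 A v ==> q2 A v).
Proof. by move=> h1 h2; apply: definable_if h1 h2 (definable_const _). Qed.

Lemma definable_exists x q : definable q ->
  definable (fun A v => [exists a, q A (update v x a)]).
Proof.
move=> /(expressible_loop x)[n [F [cF DF]]]; exists n; eexists; split.
  apply: computable_if cF _ _.
    exact: computable_widen computable_one.
  exact: computable_widen computable_zero.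
move=> A v; rewrite /= DF /= big_enum /= sum_nat_eq0.
have -> : flatten [seq [::] | a <- enum A] = [::] :> seq bool by elim: (enum A).
case: existsP => [[a qa]|no_a].
  by case: forallP => // /(_ a); rewrite inE /= eqb0 qa.
by case: forallP => // -[] a; apply/implyP=> _; rewrite eqb0; apply/negP => qa; case: no_a; exists a.
Qed.

Lemma definable_forall x q : definable q ->
  definable (fun A v => [forall a, q A (update v x a)]).
Proof.
move=> /definable_not/(definable_exists x)/definable_not; apply: eq_definable => A v.
by rewrite negb_exists; apply: eq_forallb => a; rewrite negbK.
Qed.

Lemma rank_lt_size A (a : A) : enum_rank a < size (encode A).
Proof.
apply: leq_trans (ltn_ord _) _.
by rewrite encodeE size_cat size_nseq leq_addr.
Qed.

Lemma definable_eq x y : definable (fun A v => v x == v y).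
Proof.
exists (maxn x y).+1; eexists; split.
  apply: computable_eq; first by apply: (computable_var (r := x)); rewrite ltnS leq_maxl.
  by apply: (computable_var (r := y)); rewrite ltnS leq_maxr.
move=> A v; rewrite /= /ranks.
rewrite !(minn_idPr (leqW (ltnW (rank_lt_size _)))); congr (nat_of_bool _, _).
by apply/eqP/eqP => [/val_inj/enum_rank_inj|->].
Qed.

(** The encoding lists the domain in the order of ranks: this is the linear order
    that reductions may use. *)
Lemma definable_less x y : definable (fun A v => enum_rank (v x) < enum_rank (v y)).
Proof.
exists (maxn x y).+1; eexists; split.
  by apply: (numerical_less (x := x) (y := y)); rewrite ltnS ?leq_maxl ?leq_maxr.
move=> A v; congr pair; rewrite /ranks.
have le_x := rank_lt_size (v x); have le_y := rank_lt_size (v y).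
rewrite (minn_idPr (leqW (ltnW le_y))).
move: (enum_rank (v x) : nat) (enum_rank (v y) : nat) le_x le_y => i j lt_i lt_j.
rewrite (eq_big_nat _ _ (F2 := fun u => nat_of_bool (u == i))); last first.
  by move=> u /andP[_ lt_u]; congr nat_of_bool; rewrite !(minn_idPr _) //; lia.
elim: j {lt_j} => [|j IHj]; first by rewrite big_nil.
by rewrite big_nat_recr //= IHj; lia.
Qed.

Fixpoint power (w : seq bool) (r : nat) : nat :=
  if r is r'.+1 then minn (size w).+1 (domain_size w) * power w r' else 1.

Lemma numerical_power n r : numerical n (fun w _ => power w r).
Proof.
elim: r => [|r IHr]; first exact: numerical_one.
exact: numerical_mul (numerical_domain_size n) IHr.
Qed.

Lemma power_encode A r : power (encode A) r = #|A| ^ r.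
Proof.
elim: r => //= r ->; rewrite domain_size_encode expnS (minn_idPr _) //.
by rewrite encodeE size_cat size_nseq -addnS leq_addr.
Qed.

Fixpoint address (w : seq bool) (s : nat -> nat) (xs : seq nat) : nat :=
  if xs is x :: xs' then
    minn (size w).+1 (s x) * power w (size xs') + address w s xs'
  else 0.

Lemma numerical_address n xs : all (fun x => x < n) xs ->
  numerical n (fun w s => address w s xs).
Proof.
elim: xs => [|x xs IHxs] /=; first by move=> _; apply: numerical_zero.
move=> /andP[hx /IHxs hxs]; apply: numerical_add hxs.
exact: numerical_mul (computable_var hx) (numerical_power n _).
Qed.

(** The truth value is a bit of the encoding, at a position that is a polynomial
    in the size of the domain and the ranks. *)
Lemma definable_holds R xs : definable (fun A v => holds R (map v xs)).
Proof.
have [Dsize|neq] := eqVneq (size xs) (arity R); last first.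
  apply: eq_definable (definable_const false) => A v; rewrite /holds insubF //.
  by rewrite size_map (negPf neq).
pose n := (\max_(x <- xs) x).+1.
have hxs : all (fun x => x < n) xs.
  by apply/allP => x hx; rewrite ltnS; apply: (leq_bigmax_seq (P := xpredT) (F := id)).
have start (rs : seq tau) : exists2 f, numerical n f &
    forall A s, f (encode A) s = #|A|.+1 + \sum_(S <- rs) #|A| ^ arity S.
  elim: rs => [|S rs [f hf Df]].
    exists (fun w _ => domain_size w + 1).
      by apply: numerical_add; [apply: numerical_domain_size|apply: numerical_one].
    by move=> A s; rewrite big_nil domain_size_encode addn0 addn1.
  exists (fun w s => power w (arity S) + f w s).
    exact: numerical_add (numerical_power n _) hf.
  by move=> A s; rewrite Df big_cons power_encode addnCA.
have [f hf Df] := start (take (index R (enum tau)) (enum tau)).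
exists n; eexists; split.
  exact: numerical_bit (numerical_add hf (numerical_address hxs)).
move=> A v; congr pair; congr nat_of_bool; rewrite Df -/(block_start A R).
have ht : size (map v xs) == arity R by rewrite size_map Dsize.
rewrite -[map v xs]/(tval (Tuple ht)) holds_tuple -nth_encode; congr (nth _ _ (_ + _)).
rewrite /= {ht Dsize hxs start hf Df f n}; elim: xs => //= x xs <-.
rewrite power_encode size_map (minn_idPr _) //.
exact: leqW (ltnW (rank_lt_size _)).
Qed.

(** Model checking of a fixed first-order formula is in logarithmic space. *)
Lemma definable_sat (phi : formula tau) : definable (fun A v => sat v phi).
Proof.
elim: phi => /= [x y|R t|p IHp|p IHp q IHq|p IHp q IHq|p IHp q IHq|x p IHp|x p IHp].
- exact: definable_eq.
- apply: eq_definable (definable_holds R t) => A v.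
  by rewrite -holds_tuple.
- exact: definable_not.
- exact: definable_and.
- exact: definable_or.
- exact: definable_imp.
- exact: definable_forall IHp.
- exact: definable_exists IHp.
Qed.

(** * Writable words *)

Lemma writable_cat g1 g2 : writable g1 -> writable g2 ->
  writable (fun A v => g1 A v ++ g2 A v).
Proof. exact: expressible_add. Qed.

Lemma writable_word u : writable (fun _ _ => u).
Proof.
elim: u => [|c u IHu]; first exact: definable_const false.
apply: writable_cat (_ : writable (fun _ _ => [:: c])) IHu.
by exists 0; eexists; split; first exact: computable_emit.
Qed.

Lemma writable_if q g1 g2 : definable q -> writable g1 -> writable g2 ->
  writable (fun A v => if q A v then g1 A v else g2 A v).
Proof.
move=> h h1 h2; apply: eq_expressible (expressible_if h h1 h2) => A v.
by case: (q A v).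
Qed.

Lemma writable_bit q : definable q -> writable (fun A v => [:: q A v]).
Proof.
move=> h; apply: eq_writable (writable_if h (writable_word [:: true]) (writable_word [:: false])).
by move=> A v; case: (q A v).
Qed.

Lemma writable_loop x g : writable g ->
  writable (fun A v => flatten [seq g A (update v x a) | a <- enum A]).
Proof.
move=> h; apply: eq_expressible (expressible_loop x h) => A v /=.
by rewrite big1_eq.
Qed.

Lemma writable_sequence (I : Type) (r : seq I) g : (forall i, writable (g i)) ->
  writable (fun A v => flatten [seq g i A v | i <- r]).
Proof.
move=> h; elim: r => [|i r IHr]; first exact: writable_word [::].
exact: writable_cat (h i) IHr.
Qed.

(** Registers start at [0], which is the rank of the first element: the initial
    valuation is constant. *)
Lemma writable_logspace g : writable g -> exists f, logspace_computable f /\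
  forall A, exists v, f (encode A) = g A v.
Proof.
move=> [n [F [cF DF]]]; exists (fun w => (F w (fun _ => 0)).2); split.
  exact: computable_logspace cF.
move=> A; have gt0 := dom_gt0 A; exists (fun _ => enum_val (Ordinal gt0)).
rewrite -[g A _]/(0, g A _).2 -DF; congr (F _ _).2.
by apply: functional_extensionality => i; rewrite /ranks enum_valK.
Qed.

End Expressible.

(** * First-order interpretations *)

Fixpoint words (T : Type) (L : seq T) (r : nat) : seq (seq T) :=
  if r is r'.+1 then [seq a :: t | a <- L, t <- words L r'] else [:: [::]].

Lemma size_words (T : eqType) (L : seq T) r t :
  (t \in words L r) = (size t == r) && all (mem L) t.
Proof.
elim: r t => [|r IHr] [|a t]; rewrite ?inE //=.
  by apply/negP => /allpairsP[] [? ?] [].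
apply/allpairsP/idP => [[[a' t'] /= [La']]|].
  by rewrite IHr => /andP[/eqP<- ht] [-> ->]; rewrite eqxx La'.
rewrite eqSS => /and3P[ht La hl]; exists (a, t); split=> //.
by rewrite IHr ht hl.
Qed.

Lemma all_tuples_words (D : finType) r :
  map val (all_tuples D r) = words (enum D) r.
Proof.
elim: r => //= r <-; rewrite map_allpairs.
by elim: (enum D) => //= a s ->; congr (_ ++ _); rewrite -map_comp.
Qed.

Lemma map_words (T U : Type) (h : T -> U) L r :
  [seq map h t | t <- words L r] = words (map h L) r.
Proof.
elim: r => //= r <-; rewrite map_allpairs.
by move: (words L r) => M; elim: L => //= a L ->; rewrite -!map_comp.
Qed.

Lemma flatten_map_flatten (T U : Type) (h : T -> seq U) ss :
  flatten [seq h x | x <- flatten ss] = flatten [seq flatten (map h s) | s <- ss].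
Proof. by elim: ss => //= s ss IHs; rewrite map_cat flatten_cat IHs. Qed.

Fixpoint updates (D : Type) (v : nat -> D) (o : nat) (s : seq D) : nat -> D :=
  if s is a :: s' then updates (update v o a) o.+1 s' else v.

Lemma updates_below (D : Type) (v : nat -> D) o s i : i < o -> updates v o s i = v i.
Proof.
elim: s v o => //= a s IHs v o hi; rewrite IHs ?(leqW hi) // update_other //.
by rewrite ltn_eqF.
Qed.

Lemma updates_iota (D : Type) (v : nat -> D) o s :
  [seq updates v o s i | i <- iota o (size s)] = s.
Proof.
elim: s v o => //= a s IHs v o; rewrite IHs updates_below // update_same //.
Qed.

(** An element of the interpreted structure is a tuple of elements of [A] labelled
    by a kind [c], of length [dim c]; [present] selects the tuples that count, and
    [related] gives the relations. Labels are finitely many, so they are unfolded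
    statically, and only the tuples are held in registers. *)
Section Interpretation.

Variables (tau sigma : signature) (K : finType) (dim : K -> nat).
Implicit Types A : structure tau.
Variable present : forall A, K -> seq A -> bool.
Variable related : forall A, sigma -> seq (K * seq A) -> bool.

Definition universe A : seq (K * seq A) :=
  flatten [seq [seq (c, s) | s <- words (enum A) (dim c) & present c s] | c <- enum K].

Definition description A : seq bool :=
  nseq (size (universe A)) true ++ false ::
  flatten [seq [seq related R t | t <- words (universe A) (arity R)] | R <- enum sigma].

(** The elements whose coordinates are the values of consecutive variables. *)
Fixpoint places A (o : nat) (cs : seq K) (v : nat -> A) : seq (K * seq A) :=
  if cs is c :: cs' then
    (c, [seq v i | i <- iota o (dim c)]) :: places (o + dim c) cs' v
  else [::].

Definition total (cs : seq K) : nat := sumn (map dim cs).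

Lemma places_rcons A o cs c (v : nat -> A) :
  places o (rcons cs c) v =
  rcons (places o cs v) (c, [seq v i | i <- iota (o + total cs) (dim c)]).
Proof.
rewrite /total; elim: cs o => [|c' cs IHcs] o /=; first by rewrite addn0.
by rewrite IHcs addnA.
Qed.

Lemma places_agree A o cs (v v' : nat -> A) :
  (forall i, i < o + total cs -> v i = v' i) -> places o cs v = places o cs v'.
Proof.
rewrite /total; elim: cs o => //= c cs IHcs o E; congr (_ :: _).
  congr (c, _); apply/eq_in_map => i; rewrite mem_iota => /andP[_ hi].
  by apply: E; lia.
by apply: IHcs => i hi; apply: E; lia.
Qed.

Hypothesis definable_present : forall c o,
  definable (fun A v => present c [seq v i | i <- iota o (dim c)]).

Lemma writable_words o d (g : forall A, (nat -> A) -> seq bool) : writable g ->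
  writable (fun A v => flatten [seq g A (updates v o s) | s <- words (enum A) d]).
Proof.
elim: d o g => [|d IHd] o g hg.
  by apply: eq_writable hg => A v; rewrite /= cats0.
apply: eq_writable (writable_loop o (IHd o.+1 _ hg)) => A v /=.
rewrite flatten_map_flatten -map_comp; congr flatten; apply: eq_map => a /=.
by rewrite -map_comp.
Qed.

(** Nested loops: one static choice of the kind and [dim c] loops for each
    argument. The tuples read so far are the values of the first variables. *)
Lemma writable_table (q : forall A, seq (K * seq A) -> bool) r :
  (forall cs, size cs = r -> definable (fun A v => q A (places 0 cs v))) ->
  writable (fun A _ => [seq q A t | t <- words (universe A) r]).
Proof.
move=> hq; suff inner d cs : size cs + d = r -> writable (fun A v =>
    [seq q A (places 0 cs v ++ t) | t <- words (universe A) d]).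
  exact: inner r [::] erefl.
elim: d cs => [|d IHd] cs; rewrite ?addn0 => hcs.
  by apply: eq_writable (writable_bit (hq cs hcs)) => A v; rewrite /= cats0.
pose body c A (v' : nat -> A) :=
  if present c [seq v' i | i <- iota (total cs) (dim c)]
  then [seq q A (places 0 (rcons cs c) v' ++ t) | t <- words (universe A) d]
  else [::].
have step c : writable (fun A v => flatten [seq
    body c A (updates v (total cs) s) | s <- words (enum A) (dim c)]).
  apply: (writable_words (total cs) (dim c)).
  apply: writable_if (definable_present c _) _ (writable_word _ [::]).
  by apply: IHd; rewrite size_rcons addSnnS.
apply: eq_writable (writable_sequence (enum K) step) => A v /=.
have -> : [seq q A (places 0 cs v ++ t) | t <- [seq b :: t | b <- universe A,
    t <- words (universe A) d]] = flatten [seq [seq q A (places 0 cs v ++ b :: t) |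
    t <- words (universe A) d] | b <- universe A].
  move: (words _ d) => M; elim: (universe A) => //= b bs IHbs.
  by rewrite map_cat IHbs -map_comp.
rewrite [in RHS]/universe flatten_map_flatten -map_comp; congr flatten.
apply: eq_map => c /=.
have : all (fun s => size s == dim c) (words (enum A) (dim c)).
  by apply/allP => s; rewrite size_words => /andP[].
elim: (words (enum A) (dim c)) => //= s ss IHs /andP[/eqP Ds /IHs->].
have Du : [seq updates v (total cs) s i | i <- iota (total cs) (dim c)] = s.
  by rewrite -Ds updates_iota.
rewrite {1}/body Du; case: ifP => //= _; congr (_ ++ _); apply: eq_map => t.
rewrite places_rcons add0n Du cat_rcons; congr (q A (_ ++ _)).
by apply: places_agree => i hi; apply: updates_below.
Qed.

Hypothesis definable_related : forall S cs, size cs = arity S ->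
  definable (fun A v => related S (places 0 cs v)).

Lemma writable_description : writable (fun A _ => description A).
Proof.
apply: writable_cat.
  have h : writable (fun A (_ : nat -> A) => [seq true | t <- words (universe A) 1]).
    by apply: writable_table => cs _; apply: definable_const true.
  apply: eq_writable h => A v /=.
  by elim: (universe A) => //= b bs ->.
apply: (@writable_cat _ (fun _ _ => [:: false])); first exact: writable_word.
by apply: writable_sequence => S; apply: writable_table => cs; apply: definable_related.
Qed.

End Interpretation.

Lemma encode_description (tau sigma : signature) (K : finType) (dim : K -> nat)
    (present : forall A : structure tau, K -> seq A -> bool)
    (related : forall A : structure tau, sigma -> seq (K * seq A) -> bool)
    (A : structure tau) (B : structure sigma) (h : B -> K * seq A) :
  map h (enum B) = universe dim present A ->
  (forall S (t : (arity S).-tuple B), interp t = related A S (map h t)) ->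
  description dim present related A = encode B.
Proof.
move=> Dh Dr; rewrite /description -Dh size_map -cardE encodeE.
congr (_ ++ false :: flatten _); apply: eq_map => S.
rewrite -map_words -all_tuples_words -!map_comp /table.
by apply: eq_map => t /=; rewrite Dr.
Qed.

(** * Translations of first-order formulas *)

Section Translation.

Variables pi sigma : signature.
Variables (guard : nat -> formula sigma) (atomic : pi -> seq nat -> formula sigma).

Fixpoint translate (phi : formula pi) : formula sigma :=
  match phi with
  | FEq x y => FEq x y
  | FRel R t => atomic R t
  | FNot p => FNot (translate p)
  | FAnd p q => FAnd (translate p) (translate q)
  | FOr p q => FOr (translate p) (translate q)
  | FImp p q => FImp (translate p) (translate q)
  | FAll x p => FAll x (FImp (guard x) (translate p))
  | FEx x p => FEx x (FAnd (guard x) (translate p))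
  end.

(** Renaming of symbols, relativisation to a subset, and invariance under
    isomorphisms are all instances, for suitable [g]. *)
Lemma sat_translate (B : structure sigma) (C : structure pi) (g : C -> B) :
  injective g ->
  (forall v x, sat v (guard x) = (v x \in codom g)) ->
  (forall (R : pi) (t : (arity R).-tuple nat) v u,
     {in t, forall i, v i = g (u i)} ->
     sat v (atomic R t) = interp (map_tuple u t)) ->
  forall phi v u, {in free_vars phi, forall i, v i = g (u i)} ->
  sat v (translate phi) = sat u phi.
Proof.
move=> g_inj hguard hatomic.
have bind p x v u c : {in [seq y <- free_vars p | y != x], forall i, v i = g (u i)} ->
    {in free_vars p, forall i, update v x (g c) i = g (update u x c i)}.
  move=> E i hi; rewrite /update; case: eqP => // /eqP ne.
  by apply: E; rewrite mem_filter ne.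
elim=> /= [x y|R t|p IHp|p IHp q IHq|p IHp q IHq|p IHp q IHq|x p IHp|x p IHp] v u E.
- by rewrite !E ?inE ?eqxx ?orbT // (inj_eq g_inj).
- exact: hatomic.
- by rewrite (IHp v u).
- by rewrite (IHp v u) ?(IHq v u) // => i hi; apply: E; rewrite mem_cat hi ?orbT.
- by rewrite (IHp v u) ?(IHq v u) // => i hi; apply: E; rewrite mem_cat hi ?orbT.
- by rewrite (IHp v u) ?(IHq v u) // => i hi; apply: E; rewrite mem_cat hi ?orbT.
- apply/forallP/forallP => [h c|h b].
    have := h (g c); rewrite hguard update_same codom_f /=.
    by rewrite (IHp _ (update u x c)) //; apply: bind.
  rewrite hguard update_same; apply/implyP => /codomP[c ->].
  by rewrite (IHp _ (update u x c)) //; apply: bind.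
- apply/existsP/existsP => [[b]|[c h]].
    rewrite hguard update_same => /andP[/codomP[c ->] h]; exists c.
    by rewrite -(IHp (update v x (g c))) //; apply: bind.
  exists (g c); rewrite hguard update_same codom_f /=.
  by rewrite (IHp _ (update u x c)) //; apply: bind.
Qed.

Lemma mentions_translate S : (forall x, ~~ mentions S (guard x)) ->
  (forall R s, ~~ mentions S (atomic R s)) ->
  forall phi, ~~ mentions S (translate phi).
Proof.
move=> hg ha; elim=> //= [p IHp q IHq|p IHp q IHq|p IHp q IHq|x p IHp|x p IHp];
  by rewrite negb_or ?IHp ?IHq ?hg.
Qed.

End Translation.

Definition atom (sigma : signature) (R : sigma) (s : seq nat) : formula sigma :=
  if insub s is Some t then FRel R t else FNot (FEq 0 0).

Arguments atom : simpl never.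

Lemma sat_atom (sigma : signature) (B : structure sigma) (R : sigma) s (v : nat -> B) :
  sat v (atom R s) = holds R (map v s).
Proof.
rewrite /atom; case: insubP => [t _ <-|neq].
  by rewrite -[map v _]/(tval (map_tuple v t)) holds_tuple.
by rewrite /holds insubF /= ?eqxx // size_map (negPf neq).
Qed.

Lemma mentions_atom (sigma : signature) (R S : sigma) s : R != S -> ~~ mentions S (atom R s).
Proof. by rewrite /atom; case: insub. Qed.

(** The identical translation evaluates the same formula under both valuations. *)
Lemma sat_free_vars (sigma : signature) (B : structure sigma) (phi : formula sigma)
    (u v : nat -> B) :
  {in free_vars phi, u =1 v} -> sat u phi = sat v phi.
Proof.
have tr : forall u v : nat -> B, {in free_vars phi, forall i, u i = id (v i)} ->
    sat u (translate (fun x => FEq x x) (@atom sigma) phi) = sat v phi.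
  apply: (@sat_translate _ _ _ _ B B id) => // [w x|R t w w' E].
    by rewrite /= eqxx; apply/esym/codomP; exists (w x).
  by rewrite sat_atom (_ : map w t = map_tuple w' t) ?holds_tuple //; apply/eq_in_map.
by move=> E; rewrite -(tr v v) // (tr v u) // => i /E.
Qed.

Lemma sat_sentence (sigma : signature) (B : structure sigma) (phi : sentence sigma)
    (u v : nat -> B) : sat u phi = sat v phi.
Proof. by apply: sat_free_vars; rewrite (eqP (sentence_closed phi)). Qed.

Lemma modelsE (sigma : signature) (B : structure sigma) (phi : sentence sigma)
    (v : nat -> B) : models B phi <-> sat v phi.
Proof. by split=> [/(_ v)//|h u]; rewrite (sat_sentence phi u v). Qed.

(** An arbitrary valuation, at which sentences may be evaluated. *)
Definition valuation (sigma : signature) (B : structure sigma) : nat -> B :=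
  fun _ => enum_val (Ordinal (dom_gt0 B)).

(** * Universal closure *)

Lemma sat_foldr_all (sigma : signature) (B : structure sigma) (phi : formula sigma)
    xs (v : nat -> B) :
  sat v (foldr (@FAll sigma) phi xs) <->
  forall u, (forall i, i \notin xs -> u i = v i) -> sat u phi.
Proof.
elim: xs v => [|x xs IHxs] v /=.
  split=> [h u E|]; last by apply.
  by rewrite (_ : u = v) //; apply: functional_extensionality => i; apply: E.
split=> [/forallP h u E|h].
  have /IHxs := h (u x); apply=> i hi; rewrite /update; case: eqP => [->//|/eqP ne].
  by apply: E; rewrite inE negb_or ne.
apply/forallP => a; apply/IHxs => u E; apply: h => i; rewrite inE negb_or => /andP[ne hi].
by rewrite E // update_other.
Qed.

Lemma free_vars_foldr_all (sigma : signature) (phi : formula sigma) xs :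
  free_vars (foldr (@FAll sigma) phi xs) = [seq y <- free_vars phi | y \notin xs].
Proof.
elim: xs => [|x xs IHxs] /=; first by rewrite filter_predT.
by rewrite IHxs -filter_predI; apply: eq_filter => y; rewrite /= inE negb_or.
Qed.

Definition closure_formula (sigma : signature) (phi : formula sigma) : formula sigma :=
  foldr (@FAll sigma) phi (free_vars phi).

Lemma closure_closed (sigma : signature) (phi : formula sigma) :
  free_vars (closure_formula phi) == [::].
Proof.
by rewrite free_vars_foldr_all (eq_in_filter (a2 := pred0)) ?filter_pred0 // => x ->.
Qed.

Definition closure (sigma : signature) (phi : formula sigma) : sentence sigma :=
  Sentence (closure_closed phi).

Lemma sat_closure (sigma : signature) (B : structure sigma) (phi : formula sigma)
    (v : nat -> B) :
  sat v (closure phi) <-> forall u : nat -> B, sat u phi.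
Proof.
split=> [/sat_foldr_all h u|h]; last by apply/sat_foldr_all => u _.
rewrite (sat_free_vars (v := fun i => if i \in free_vars phi then u i else v i)).
  by apply: h => i /negPf->.
by move=> i ->.
Qed.

Lemma mentions_foldr_all (sigma : signature) S (phi : formula sigma) xs :
  mentions S (foldr (@FAll sigma) phi xs) = mentions S phi.
Proof. by elim: xs. Qed.

Lemma has_mentions_conjuncts (sigma : signature) S (phi : formula sigma) :
  has (mentions S) (conjuncts phi) = mentions S phi.
Proof.
by elim: phi => //= *; rewrite ?has_cat ?orbF //; congr (_ || _).
Qed.

(** * Extensional sentences with one unary predicate *)

Section Monadic.

Variables (sigma : signature) (U : sigma) (arity_U : arity U = 1).

Definition unary_signature : signature := @Signature unit (fun _ => 1).

Local Notation sigma' := (signature_sum sigma unary_signature).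

Definition unprime (R : sigma) : sigma' := if R == U then inr tt else inl R.

Definition unprimed (phi : formula sigma) : formula sigma' :=
  translate (fun x => FEq x x) (fun R => atom (unprime R)) phi.

Lemma size_U : size [:: 0] == @arity sigma' (inl U).
Proof. by rewrite /= arity_U. Qed.

Definition inclusion : formula sigma' :=
  FAll 0 (FImp (@FRel sigma' (inl U) (Tuple size_U)) (@FRel sigma' (inr tt) [tuple 0])).

Lemma inclusion_closed phi : free_vars (FAnd inclusion (closure phi)) == [::].
Proof. by rewrite /= (eqP (closure_closed phi)). Qed.

(** The sentence says that some set above the interpretation of [U] satisfies
    [phi] when it is put in the place of [U]. In [phi] every occurrence of [U] is
    replaced by the quantified symbol, so [U] only occurs in the inclusion. *)
Definition superset_eso (phi : formula sigma) : eso sigma :=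
  @Eso sigma unary_signature (Sentence (inclusion_closed (unprimed phi))).

Lemma superset_extensional phi : extensional (superset_eso phi).
Proof.
exists (fun _ => U); split=> [[] [] //|[]] /=.
exists [::], (conjuncts (closure_formula (unprimed phi))), inclusion; split=> //.
  by exists (Tuple size_U), [tuple 0].
rewrite cat0s has_mentions_conjuncts /closure_formula mentions_foldr_all.
apply: mentions_translate => // R s; apply: mentions_atom.
by rewrite /unprime; case: (R =P U) => // ne; apply/eqP => -[].
Qed.

Definition reinterpret (B : structure sigma) (X : {set B}) : structure sigma :=
  @Structure sigma B (dom_gt0 B)
    (fun R t => if R == U then all (mem X) t else interp t).

Lemma holds_reinterpret (B : structure sigma) (X : {set B}) (x : B) :
  @holds _ (reinterpret X) U [:: x] = (x \in X).
Proof.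
have hU : size [:: x] == arity U by rewrite /= arity_U.
by rewrite -[[:: x]]/(tval (Tuple hU)) holds_tuple /= eqxx andbT.
Qed.

Lemma holds_reinterpret_other (B : structure sigma) (X : {set B}) R (s : seq B) :
  R != U -> @holds _ (reinterpret X) R s = @holds _ B R s.
Proof. by rewrite /holds; case: insub => //= t /negPf->. Qed.

Lemma superset_models (B : structure sigma) phi :
  eso_models B (superset_eso phi) <->
  exists X : {set B}, (forall x, holds U [:: x] -> x \in X) /\
    forall u : nat -> reinterpret X, sat u phi.
Proof.
have key (X : {set B}) (I : forall R : unary_signature, (arity R).-tuple B -> bool) :
    (forall x, I tt [tuple x] = (x \in X)) ->
    (models (expansion I) (fo_part (superset_eso phi)) <->
    (forall x, holds U [:: x] -> x \in X) /\ forall u : nat -> reinterpret X, sat u phi).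
  move=> DI; pose v0 := valuation (expansion I).
  have tr (u : nat -> B) : sat (A := expansion I) u (unprimed phi)
      = sat (A := reinterpret X) u phi.
    apply: (@sat_translate _ _ _ _ (expansion I) (reinterpret X) id) => //.
      by move=> v x; rewrite /= eqxx; apply/esym/codomP; exists (v x).
    move=> R t v w E; rewrite sat_atom.
    rewrite (_ : map v t = map_tuple w t); last exact/eq_in_map.
    rewrite -holds_tuple /=; have : size (map w t) = arity R by rewrite size_map size_tuple.
    move: (map w t) => s {t E}; rewrite /unprime; case: (R =P U) => [->|/eqP ne] hs.
      case: s hs => [|x [|y s]]; rewrite arity_U // holds_reinterpret => _.
      by rewrite -DI; apply: (@holds_tuple _ (expansion I) (inr tt) [tuple x]).
    by rewrite holds_reinterpret_other.
  have inc x : sat (A := expansion I) (update v0 0 x)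
      (FImp (@FRel sigma' (inl U) (Tuple size_U)) (@FRel sigma' (inr tt) [tuple 0]))
      = (holds U [:: x] ==> (x \in X)).
    rewrite /= -(@holds_tuple sigma B U) /= update_same; congr (_ ==> _).
    by rewrite -DI; congr (I tt _); apply: val_inj; rewrite /= update_same.
  rewrite (modelsE _ v0); split.
    case/andP => /forallP hinc /sat_closure hphi; split=> [x hx|u].
      by have := etrans (esym (inc x)) (hinc x); rewrite hx.
    by rewrite -(tr u); apply: hphi.
  move=> [hX hphi]; apply/andP; split.
    by apply/forallP => x; apply: (etrans (inc x)); apply/implyP; apply: hX.
  by apply/sat_closure => u; rewrite tr.
split=> [[I hI]|[X hX]].
  exists [set x | I tt [tuple x]]; apply/(key _ I) => // x; by rewrite inE.
by exists (fun _ t => thead t \in X); apply/(key X) => // x; rewrite theadE.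
Qed.

End Monadic.

(** * Reductions by writable words *)

Lemma reduces_by (P Q : problem) (word : structure (psig P) -> seq bool) :
  writable (fun A _ => word A) ->
  (forall A, exists B : structure (psig Q), word A = encode B /\ (P A <-> Q B)) ->
  logspace_reduces P Q.
Proof.
move=> /writable_logspace[f [hf Df]] hw; exists f; split=> // A.
have [v ->] := Df A; exact: hw.
Qed.

Lemma val_enum_sig (T : finType) (U : {set T}) :
  map val (enum {: {x : T | x \in U}}) = [seq x <- enum T | x \in U].
Proof.
have -> : enum {: {x : T | x \in U}} = pmap insub (enum T).
  by rewrite !enumT {1}Finite.enum.unlock.
apply: etrans (pmap_filter (@insubK _ _ {x : T | x \in U}) _) _.
by apply: eq_filter => x; apply: isSome_insub.
Qed.

(** The case of interpretations on a definable subset of the domain. *)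
Lemma unary_interpretation (tau sigma : signature)
    (keep : forall A : structure tau, A -> bool)
    (rel : forall A : structure tau, sigma -> seq A -> bool) :
  (forall x, definable (fun A v => keep A (v x))) ->
  (forall R xs, size xs = arity R -> definable (fun A v => rel A R (map v xs))) ->
  exists word, writable (fun A _ => word A) /\
    forall (A : structure tau) (B : structure sigma) (g : B -> A),
      map g (enum B) = [seq a <- enum A | keep A a] ->
      (forall R (t : (arity R).-tuple B), interp t = rel A R (map g t)) ->
      word A = encode B.
Proof.
move=> hkeep hrel.
pose present (A : structure tau) (_ : unit) (s : seq A) := all (keep A) s.
pose related (A : structure tau) R (t : seq (unit * seq A)) := rel A R (flatten (map snd t)).
exists (description (fun _ => 1) present related); split.
  apply: writable_description => [[] o|R cs hcs].
    by apply: eq_definable (hkeep o) => A v; rewrite /present /= andbT.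
  have := hrel R (iota 0 (size cs)); rewrite size_iota => /(_ hcs).
  apply: eq_definable => A v; congr (rel A R).
  have h o : [seq v i | i <- iota o (size cs)]
      = flatten (map snd (places (fun _ => 1) o cs v)).
    by elim: cs o {hcs} => //= c cs IHcs o; rewrite addn1 IHcs.
  exact: h.
move=> A B g Dg Dr; apply: (encode_description (h := fun b => (tt, [:: g b]))).
  rewrite /universe; have -> : enum (unit : finType) = [:: tt] by rewrite enumT Finite.enum.unlock.
  have -> : words (enum A) 1 = [seq [:: a] | a <- enum A].
    by rewrite /=; elim: (enum A) => //= a s ->.
  rewrite /= cats0 (map_comp (fun a => (tt, [:: a])) g) Dg filter_map -map_comp.
  by congr map; apply: eq_filter => a; rewrite /present /= andbT.
move=> R t; rewrite Dr /related; congr (rel A R).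
by elim: (tval t) => //= b s ->.
Qed.

Lemma logspace_reduces_refl (P : problem) : logspace_reduces P P.
Proof.
have [|R xs _|word [hw Dw]] := @unary_interpretation (psig P) (psig P)
    (fun _ _ => true) (fun A R s => holds R s).
- by move=> x; apply: definable_const.
- exact: definable_holds.
apply: (reduces_by hw) => A; exists A; split=> //.
apply: (Dw A A id); first by rewrite map_id filter_predT.
by move=> R t; rewrite map_id holds_tuple.
Qed.

Lemma logspace_equivalent_refl (P : problem) : logspace_equivalent P P.
Proof. by split; apply: logspace_reduces_refl. Qed.

(** * Trivial problems *)

(** The other constructions need a fixed positive and a fixed negative instance
    as values on ill-formed inputs; problems without them are of every kind. *)
Definition trivial (P : problem) := (forall A, P A) \/ (forall A, ~ P A).

Definition void_signature : signature := @Signature void (fun _ => 0).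

Definition constant_formula (tau : signature) (b : bool) : formula tau :=
  if b then FEq 0 0 else FNot (FEq 0 0).

Definition constant_sentence (tau : signature) (b : bool) : sentence tau :=
  closure (constant_formula tau b).

Lemma models_constant (tau : signature) (A : structure tau) b :
  models A (constant_sentence tau b) <-> b.
Proof.
rewrite (modelsE _ (valuation A)); rewrite sat_closure.
by split=> [/(_ (valuation A))|]; case: b => //=; rewrite eqxx.
Qed.

Lemma trivial_constant (P : problem) : trivial P -> exists b : bool, forall A, P A <-> b.
Proof. by case=> hP; [exists true|exists false] => A; split=> // /hP. Qed.

Lemma trivial_monadic (P : problem) : trivial P -> monadic_extensional_ESO P.
Proof.
move=> /trivial_constant[b hb].
exists (@Eso (psig P) void_signature (constant_sentence _ b)); split.
- by case.
- by exists (fun R : void => match R with end); split; case.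
move=> A; rewrite hb; split=> [hb'|[I]]; last by rewrite models_constant.
by exists (fun R : void => match R with end); rewrite models_constant.
Qed.

Lemma trivial_co_HerFO (P : problem) : trivial P -> co_HerFO P.
Proof.
move=> /trivial_constant[b hb]; exists (fun A => ~~ b); split; last first.
  by move=> A; rewrite hb /=; case: b {hb}; split.
exists (constant_sentence _ (~~ b)) => A; split=> [nb U U_gt0|hA].
  by rewrite models_constant.
have U_gt0 : 0 < #|[set: A]| by rewrite cardsT dom_gt0.
by have := hA _ U_gt0; rewrite models_constant.
Qed.

Lemma nontrivial (P : problem) : ~ trivial P -> (exists A, P A) /\ (exists A, ~ P A).
Proof.
move=> hP; split; apply: NNPP => h; apply: hP; [right|left] => A; last first.
  by apply: NNPP => hA; apply: h; exists A.
by move=> hA; apply: h; exists A.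
Qed.

(** * From hereditary classes to monadic sentences *)

Definition pointed (tau : signature) : signature :=
  @Signature (option tau) (fun R => if R is Some R' then arity R' else 1).

Section Hereditary.

Variables (tau : signature) (phi : sentence tau).

(** The unary symbol holds the elements that are removed. *)
Definition removal_formula : formula (pointed tau) :=
  FAnd (FEx 0 (FNot (@atom (pointed tau) None [:: 0])))
    (FNot (translate (fun x => FNot (@atom (pointed tau) None [:: x]))
       (fun R => @atom (pointed tau) (Some R)) phi)).

Definition removal_eso : eso (pointed tau) :=
  superset_eso (erefl : @arity (pointed tau) None = 1) removal_formula.

Definition removal_problem : problem :=
  @Problem (pointed tau) (fun B => eso_models B removal_eso).

Lemma removal_monadic : monadic_extensional_ESO removal_problem.
Proof.
by exists removal_eso; split=> //; exact: superset_extensional.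
Qed.

Lemma holds_removed (B : structure (pointed tau)) (X : {set B}) x :
  @holds _ (@reinterpret (pointed tau) None B X) None [:: x] = (x \in X).
Proof. exact: holds_reinterpret. Qed.

Lemma sat_removal (B : structure (pointed tau)) (X : {set B})
    (u : nat -> @reinterpret (pointed tau) None B X) :
  sat u removal_formula = [exists b, b \notin X] &&
    ~~ sat u (translate (fun x => FNot (@atom (pointed tau) None [:: x]))
       (fun R => @atom (pointed tau) (Some R)) phi).
Proof.
rewrite /removal_formula /=; congr (_ && _); apply: eq_existsb => b.
by rewrite sat_atom /= update_same holds_removed.
Qed.

(** [g] identifies [C] with what remains of [B]. *)
Definition remainder (B : structure (pointed tau)) (C : structure tau) (g : C -> B) :=
  [/\ injective g, forall b, @holds _ B None [:: b] = (b \notin codom g) &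
   forall R (t : (arity R).-tuple C), interp t = @holds _ B (Some R) (map g t)].

Lemma remainder_sat (B : structure (pointed tau)) (X : {set B}) (C : structure tau)
    (g : C -> B) (u : nat -> B) (v : nat -> C) :
  injective g -> X =i [predC codom g] ->
  (forall R (t : (arity R).-tuple C), interp t = @holds _ B (Some R) (map g t)) ->
  sat (A := @reinterpret (pointed tau) None B X) u removal_formula = ~~ sat v phi.
Proof.
move=> g_inj DX Dg.
pose B' := @reinterpret (pointed tau) None B X.
have tr : sat (A := B') u (translate (fun x => FNot (@atom (pointed tau) None [:: x]))
       (fun R => @atom (pointed tau) (Some R)) phi) = sat v phi.
  apply: (@sat_translate _ _ _ _ B' C g) => //.
  - by move=> w x; rewrite /= sat_atom /= holds_removed DX inE negbK.
  - move=> R t w w' E; rewrite sat_atom holds_reinterpret_other // Dg.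
    by congr holds; rewrite -map_comp; apply/eq_in_map.
  by rewrite (eqP (sentence_closed phi)).
rewrite sat_removal; move: tr => /= ->; case: existsP => //= -[].
by exists (g (v 0)); rewrite DX inE negbK codom_f.
Qed.

(** The sets above the removed part are the complements of the subsets of what
    remains, so removing is choosing a substructure of the remainder. *)
Lemma removal_remainder (B : structure (pointed tau)) (C : structure tau) (g : C -> B) :
  remainder g -> removal_problem B <-> ~ Her phi C.
Proof.
move=> [g_inj DU Dg]; rewrite /removal_problem /= superset_models; split.
  case=> X [hX hphi] hC; set B' := @reinterpret (pointed tau) None B X in hphi.
  have := hphi (valuation B'); rewrite sat_removal => /andP[/existsP[b Xb] _].
  pose W := [set c | g c \notin X].
  have W_gt0 : 0 < #|W|.
    have : ~~ @holds _ B None [:: b] by apply: contra Xb; apply: hX.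
    rewrite DU negbK => /codomP[c Dc]; apply/card_gt0P; exists c.
    by rewrite inE -Dc.
  have := hC W W_gt0; rewrite (modelsE _ (valuation _)) => sat_phi.
  have := hphi (valuation B').
  rewrite (@remainder_sat B X (substructure W_gt0) (g \o val) _ (valuation _)) ?sat_phi //.
  - by apply: inj_comp g_inj val_inj.
  - move=> x; rewrite inE /=; apply/idP/idP => [Xx|h].
      apply/codomP => -[c Dc].
      by have := valP c; rewrite inE -[g _]/((g \o val) c) -Dc Xx.
    apply: contraNT h => Xx; apply/codomP; have : ~~ @holds _ B None [:: x].
      by apply: contra Xx; apply: hX.
    rewrite DU negbK => /codomP[c Dc].
    have Wc : c \in W by rewrite inE -Dc.
    by exists (exist _ c Wc).
  - by move=> R t; rewrite /= Dg map_comp.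
move=> /not_all_ex_not[W] /not_all_ex_not[W_gt0].
rewrite (modelsE _ (valuation _)) => /negP nphi.
exists (~: [set g c | c in W]); split=> [x|u].
  rewrite DU inE; apply: contra => /imsetP[c _ ->]; exact: codom_f.
rewrite (@remainder_sat B _ (substructure W_gt0) (g \o val) _ (valuation _)) //.
- by apply: inj_comp g_inj val_inj.
- move=> x; rewrite !inE /=; congr negb; apply/imsetP/codomP => [[c Wc ->]|[c ->]].
    by exists (exist _ c Wc).
  by exists (val c); first exact: valP.
- by move=> R t; rewrite /= Dg map_comp.
Qed.

(** In this case the remainder would be empty, so it is no structure. *)
Lemma removal_full (B : structure (pointed tau)) :
  (forall b, @holds _ B None [:: b]) -> ~ removal_problem B.
Proof.
move=> hB; rewrite /removal_problem /= superset_models => -[X [hX hphi]].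
set B' := @reinterpret (pointed tau) None B X in hphi.
have := hphi (valuation B'); rewrite sat_removal => /andP[/existsP[b Xb] _].
by case/negP: Xb; apply: hX (hB b).
Qed.

End Hereditary.

(** The reduction from [P] removes nothing; the reduction back deletes the removed
    elements, and returns a fixed negative instance if nothing is left. *)
Lemma co_HerFO_monadic (P : problem) : co_HerFO P ->
  exists Q, monadic_extensional_ESO Q /\ logspace_equivalent P Q.
Proof.
move=> hP; have [|/nontrivial[_ [A0 PA0]]] := classic (trivial P).
  move=> /trivial_monadic; exists P; split=> //; exact: logspace_equivalent_refl.
case: hP => C [[phi Dphi] PC].
have {PC} DP A : P A <-> ~ Her phi A by rewrite PC /= -(Dphi A).
exists (removal_problem phi); split; first exact: removal_monadic.
split.
  have [|R xs hxs|word [hw Dw]] := @unary_interpretation (psig P) (pointed (psig P))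
      (fun _ _ => true) (fun A R s => if R is Some R' then holds R' s else false).
  - by move=> x; apply: definable_const.
  - by case: R hxs => [R|] _; [apply: definable_holds|apply: definable_const].
  apply: (@reduces_by _ (removal_problem phi) _ hw) => A.
  pose B := @Structure (pointed (psig P)) A (dom_gt0 A) (fun R =>
    match R return (@arity (pointed (psig P)) R).-tuple A -> bool with
    | Some R' => @interp _ A R' | None => fun _ => false end).
  have hB (R : psig P) (s : seq A) : @holds _ B (Some R) s = @holds _ A R s by [].
  exists B; split.
    apply: (Dw A B id); first by rewrite map_id filter_predT.
    by case=> [R|] t //=; rewrite map_id holds_tuple.
  rewrite DP; apply: iff_sym; apply: (@removal_remainder _ phi B A id).
  split=> // [b|R t]; last by rewrite map_id hB holds_tuple.
  have -> : b \in codom id by apply/codomP; exists b.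
  by rewrite /holds; case: insub.
have [||word [hw Dw]] := @unary_interpretation (pointed (psig P)) (psig P)
    (fun B b => ~~ @holds _ B None [:: b]) (fun B R s => @holds _ B (Some R) s).
- move=> x; apply: definable_not.
  exact: (@definable_holds (pointed (psig P)) None [:: x]).
- by move=> R xs _; apply: (@definable_holds (pointed (psig P)) (Some R)).
have guard : definable (fun (B : structure (pointed (psig P))) (v : nat -> B) =>
    [exists b, ~~ @holds _ B None [:: b]]).
  have := definable_exists 0 (definable_not (@definable_holds (pointed (psig P)) None [:: 0])).
  apply: eq_definable => A v; apply: eq_existsb => a.
  by rewrite /= update_same.
apply: (@reduces_by (removal_problem phi) P (fun B =>
    if [exists b, ~~ @holds _ B None [:: b]] then word B else encode A0)).
  exact: writable_if guard hw (writable_word _ (encode A0)).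
move=> B; rewrite [psig _]/= in B *.
case: existsP => [[b0 hb0]|full]; last first.
  exists A0; split=> //; split=> // hB; case: (@removal_full _ phi B) => // b.
  by apply/negPn/negP => hb; apply: full; exists b.
pose U := [set b : B | ~~ @holds _ B None [:: b]].
have U_gt0 : 0 < #|U| by apply/card_gt0P; exists b0; rewrite inE.
pose D := @Structure (psig P) {x : B | x \in U} (card_substructure U_gt0)
  (fun R t => @holds _ B (Some R) (map val t)).
exists D; split.
  apply: (Dw B D val) => //; rewrite val_enum_sig; apply: eq_filter => b.
  by rewrite inE.
rewrite DP; apply: (@removal_remainder _ phi B D val); split=> //; first exact: val_inj.
move=> b; apply/idP/idP => [hb|].
  by apply/codomP => -[c Dc]; have := valP c; rewrite inE -Dc hb.
apply: contraNT => hb; have Ub : b \in U by rewrite inE.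
by apply/codomP; exists (exist _ b Ub).
Qed.

(** * Extensional sentences *)

Lemma sat_mentions (sigma : signature) (B : structure sigma)
    (f : forall R : sigma, (arity R).-tuple B -> bool) (phi : formula sigma) (v : nat -> B) :
  (forall R, mentions R phi -> f R =1 @interp sigma B R) ->
  sat (A := Structure (dom_gt0 B) f) v phi = sat v phi.
Proof.
elim: phi v => //= [R t|p IHp|p IHp q IHq|p IHp q IHq|p IHp q IHq|x p IHp|x p IHp] v E.
- by rewrite E ?eqxx.
- by rewrite IHp.
- by rewrite IHp ?IHq // => R h; apply: E; rewrite h ?orbT.
- by rewrite IHp ?IHq // => R h; apply: E; rewrite h ?orbT.
- by rewrite IHp ?IHq // => R h; apply: E; rewrite h ?orbT.
- by apply: eq_forallb => a; rewrite IHp.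
- by apply: eq_existsb => a; rewrite IHp.
Qed.

(** Formulas carry no decidable equality, hence this membership predicate. *)
Fixpoint member (T : Type) (x : T) (s : seq T) : Prop :=
  if s is y :: s' then y = x \/ member x s' else False.

Lemma member_cat (T : Type) (x : T) s1 s2 :
  member x (s1 ++ s2) <-> member x s1 \/ member x s2.
Proof. by elim: s1 => /= [|y s1 IHs]; [|rewrite IHs]; tauto. Qed.

Lemma member_has (T : Type) (p : pred T) x s : member x s -> ~~ has p s -> ~~ p x.
Proof. by elim: s => //= y s IHs [->|/IHs h]; rewrite negb_or => /andP[] // _ /h. Qed.

Lemma sat_conjuncts (sigma : signature) (B : structure sigma) (phi : formula sigma)
    (v : nat -> B) :
  sat v phi <-> forall c, member c (conjuncts phi) -> sat v c.
Proof.
elim: phi => [x y|R t|p _|p IHp q IHq|p _ q _|p _ q _|x p _|x p _];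
  try by split=> [h c [<-|//]|]; [|apply; left].
split=> [/andP[/IHp hp /IHq hq] c|h].
  by rewrite [conjuncts _]/= member_cat => -[/hp|/hq].
by apply/andP; split; [apply/IHp|apply/IHq] => c hc; apply: h;
   rewrite [conjuncts _]/= member_cat; [left|right].
Qed.

Lemma sat_extension_clause (sigma : signature) (B : structure sigma) (R' R : sigma) chi
    (v : nat -> B) :
  extension_clause R' R chi ->
  (sat v chi <-> forall (t' : (arity R').-tuple B) (t : (arity R).-tuple B),
    tval t' = tval t -> interp t' -> interp t).
Proof.
move=> [x [y [Dxy Ux ->]]]; rewrite sat_foldr_all; split=> [h t' t Dt|h u _].
  pose u i := if i \in tval x then nth (v 0) t' (index i x) else v i.
  have Du : map u x = t'.
    apply: (@eq_from_nth _ (v 0)); first by rewrite size_map !size_tuple.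
    move=> i; rewrite size_map => lt_i; rewrite (nth_map 0) // /u mem_nth //.
    by rewrite index_uniq.
  have /h : forall i, i \notin tval x -> u i = v i by move=> i /negPf hi; rewrite /u hi.
  rewrite /= (_ : map_tuple u x = t'); last exact: val_inj.
  rewrite (_ : map_tuple u y = t); first by move/implyP.
  by apply: val_inj; rewrite /= -Dt -Du Dxy.
by apply/implyP; apply: h; rewrite /= Dxy.
Qed.

Section Extensional.

Variables (tau : signature) (Psi : eso tau).
Let rho := quantified Psi.
Let fo := fo_part Psi.
Variable prime : rho -> tau.
Hypothesis prime_clause : forall R : rho,
  let R' : signature_sum tau rho := inl (prime R) in
  exists (s1 s2 : seq (formula (signature_sum tau rho))) chi,
    [/\ conjuncts fo = s1 ++ chi :: s2, extension_clause R' (inr R) chi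
      & ~~ has (mentions R') (s1 ++ s2)].

(** Emptying the symbols [R'] makes the inclusions [R' => R] vacuous and changes
    no other conjunct. *)
Definition erase (A : structure tau) : structure tau :=
  @Structure tau A (dom_gt0 A) (fun R t => (R \notin codom prime) && interp t).

Lemma arity_prime R : arity (prime R) = arity R.
Proof.
have [s1 [s2 [chi [_ [x [y [Dxy _ _]]] _]]]] := prime_clause R.
by have := congr1 size Dxy; rewrite !size_tuple.
Qed.

(** The constraint [R' => R] is separated from the rest of the sentence, which can
    then be evaluated without knowing [R']. *)
Lemma extensional_models (A : structure tau)
    (I : forall R : rho, (arity R).-tuple A -> bool) :
  models (expansion I) fo <->
  models (@expansion tau rho (erase A) I) fo /\
  forall R (t' : (arity (prime R)).-tuple A) (t : (arity R).-tuple A),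
    tval t' = tval t -> interp t' -> I R t.
Proof.
pose v := valuation A.
have cases c : member c (conjuncts fo) ->
    (exists R, extension_clause (inl (prime R) : signature_sum tau rho) (inr R) c) \/
    forall R, ~~ mentions (inl (prime R) : signature_sum tau rho) c.
  move=> hc; apply: NNPP => /not_or_and[no_clause]; apply=> R.
  have [s1 [s2 [chi [Dc clause hs]]]] := prime_clause R.
  move: hc; rewrite Dc member_cat => -[hc|[Dchi|hc]].
  - by apply: member_has hs; rewrite member_cat; left.
  - by case: no_clause; exists R; rewrite -Dchi.
  - by apply: member_has hs; rewrite member_cat; right.
have plain c : (forall R, ~~ mentions (inl (prime R) : signature_sum tau rho) c) ->
    sat (A := @expansion tau rho (erase A) I) v c = sat (A := expansion I) v c.
  move=> hc; apply: (@sat_mentions _ (expansion I)) => -[R|R] // hR t /=.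
  case: codomP => // -[r Dr]; by have := hc r; rewrite -Dr hR.
have erased c R : extension_clause (inl (prime R) : signature_sum tau rho) (inr R) c ->
    sat (A := @expansion tau rho (erase A) I) v c.
  by move=> hc; apply/(sat_extension_clause _ hc) => t' t _ /=; rewrite codom_f.
rewrite (modelsE _ (v : nat -> expansion I)).
rewrite (modelsE _ (v : nat -> @expansion tau rho (erase A) I)); split.
  move=> /sat_conjuncts h; split.
    apply/sat_conjuncts => c hc; case: (cases c hc) => [[R]|hp]; first exact: erased.
    by rewrite plain //; apply: h.
  move=> R; have [s1 [s2 [chi [Dc clause _]]]] := prime_clause R.
  have /h : member chi (conjuncts fo) by rewrite Dc member_cat; right; left.
  by move/(sat_extension_clause _ clause).
move=> [/sat_conjuncts h hI]; apply/sat_conjuncts => c hc.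
case: (cases c hc) => [[R clause]|hp]; last by rewrite -plain //; apply: h.
by apply/(sat_extension_clause _ clause); apply: hI.
Qed.

End Extensional.

(** * Coding relations by optional elements *)

Definition coding_signature (tau rho : signature) : signature :=
  @Signature (tau + rho + (bool + bool))%type (fun R =>
    match R with
    | inl (inl R') => arity R'
    | inl (inr R') => (arity R').+1
    | inr (inl _) => 1
    | inr (inr _) => 2
    end).

Section Symbols.
Variables tau rho : signature.
Definition Base (R : tau) : coding_signature tau rho := inl (inl R).
Definition Code (R : rho) : coding_signature tau rho := inl (inr R).
Definition Old : coding_signature tau rho := inr (inl true).
Definition Off : coding_signature tau rho := inr (inl false).
Definition Less : coding_signature tau rho := inr (inr true).
Definition Next : coding_signature tau rho := inr (inr false).
End Symbols.

Arguments Base {tau rho}.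
Arguments Code {tau rho}.
Arguments Old {tau rho}.
Arguments Off {tau rho}.
Arguments Less {tau rho}.
Arguments Next {tau rho}.
Arguments holds : simpl never.

Section Coding.

Variables (tau : signature) (Psi : eso tau).
Let rho := quantified Psi.
Let fo := fo_part Psi.
Variable prime : rho -> tau.
Local Notation sigma := (coding_signature tau rho).
Implicit Types B : structure sigma.

(** Universal conditions, so that induced substructures inherit them. [Less] is a
    strict order, total on the old elements; if [Next] holds from [x] to [y], then
    [y] comes right after [x], or [x] and [y] are extreme among the old elements;
    an element codes at most one tuple of one relation, and then it is not old. *)
Record sound B : Prop := Sound {
  less_irr : forall x : B, ~~ holds Less [:: x; x];
  less_tr : forall x y z : B,
    holds Less [:: x; y] -> holds Less [:: y; z] -> holds Less [:: x; z];
  less_tot : forall x y : B, holds Old [:: x] -> holds Old [:: y] ->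
    [|| x == y, holds Less [:: x; y] | holds Less [:: y; x]];
  next_adj : forall x y z : B, holds Next [:: x; y] -> holds Old [:: z] ->
    (holds Less [:: x; y] && ~~ (holds Less [:: x; z] && holds Less [:: z; y]))
    || (~~ holds Less [:: z; y] && ~~ holds Less [:: x; z]);
  code_new : forall R (o : B) s, holds (Code R) (o :: s) -> ~~ holds Old [:: o];
  code_inj : forall R R' (o : B) s s', holds (Code R) (o :: s) ->
    holds (Code R') (o :: s') -> R = R' /\ s = s'
}.

(** In a substructure of a sound structure this forces all old elements to be
    present. *)
Definition complete B : Prop :=
  (exists x : B, holds Old [:: x]) /\
  forall x : B, holds Old [:: x] -> exists y, holds Old [:: y] && holds Next [:: x; y].

Definition conjunction (phis : seq (formula sigma)) : formula sigma :=
  foldr (@FAnd sigma) (FEq 0 0) phis.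

Lemma sat_conjunction B (v : nat -> B) phis :
  sat v (conjunction phis) = all (fun phi => sat v phi) phis.
Proof. by elim: phis => //= [|phi phis ->]; rewrite ?eqxx. Qed.

Definition less_axioms : seq (formula sigma) :=
  [:: FNot (atom Less [:: 0; 0]);
      FImp (atom Less [:: 0; 1]) (FImp (atom Less [:: 1; 2]) (atom Less [:: 0; 2]));
      FImp (atom Old [:: 0]) (FImp (atom Old [:: 1])
        (FOr (FEq 0 1) (FOr (atom Less [:: 0; 1]) (atom Less [:: 1; 0]))));
      FImp (atom Next [:: 0; 1]) (FImp (atom Old [:: 2])
        (FOr (FAnd (atom Less [:: 0; 1])
                (FNot (FAnd (atom Less [:: 0; 2]) (atom Less [:: 2; 1]))))
             (FAnd (FNot (atom Less [:: 2; 1])) (FNot (atom Less [:: 0; 2])))))].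

Definition new_axiom (R : rho) : formula sigma :=
  FImp (atom (Code R) (iota 0 (arity R).+1)) (FNot (atom Old [:: 0])).

(** Variable [0] is the coding element; the two coded tuples come next. *)
Definition inj_axiom (R R' : rho) : formula sigma :=
  FImp (atom (Code R) (0 :: iota 1 (arity R)))
    (FImp (atom (Code R') (0 :: iota (arity R).+1 (arity R')))
      (if R == R' then
         conjunction [seq FEq i (i + arity R) | i <- iota 1 (arity R)]
       else FNot (FEq 0 0))).

Definition axioms : formula sigma :=
  conjunction (less_axioms ++ [seq new_axiom R | R <- enum rho]
    ++ [seq inj_axiom R R' | R <- enum rho, R' <- enum rho]).

Lemma holds_size (B : structure sigma) (R : sigma) (s : seq B) :
  holds R s -> size s = arity R.
Proof. by rewrite /holds; case: insubP => // t /eqP. Qed.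

Lemma sat_axioms B (u : nat -> B) : sat u axioms <->
  [/\ all (fun phi => sat u phi) less_axioms, forall R, sat u (new_axiom R)
    & forall R R', sat u (inj_axiom R R')].
Proof.
rewrite sat_conjunction !all_cat all_map; split.
  case/and3P => h1 /allP h2 /all_allpairsP h3; split=> // [R|R R'].
    by apply: h2; rewrite mem_enum.
  by apply: h3; rewrite mem_enum.
case=> h1 h2 h3; apply/and3P; split=> //; first by apply/allP => R _; apply: h2.
by apply/all_allpairsP => R R' _ _; apply: h3.
Qed.

Lemma soundP B : (forall u : nat -> B, sat u axioms) <-> sound B.
Proof.
pose v0 := valuation B; pose val_of s i := nth (v0 0) s i : B.
have map_val_of s1 s2 s3 : map (val_of (s1 ++ s2 ++ s3)) (iota (size s1) (size s2)) = s2.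
  apply: (@eq_from_nth _ (v0 0)); first by rewrite size_map size_iota.
  move=> i; rewrite size_map size_iota => lt_i.
  rewrite (nth_map 0) ?size_iota // nth_iota // /val_of nth_cat ltnNge leq_addr /=.
  by rewrite addKn nth_cat lt_i.
split=> [h|S u]; last first.
  apply/sat_axioms; split=> [|R|R R'].
  - rewrite /= !sat_atom /=; apply/and5P; split=> //; first exact: less_irr.
    + by apply/implyP => h1; apply/implyP; apply: less_tr h1.
    + by apply/implyP => h1; apply/implyP; apply: less_tot.
    + by apply/implyP => h1; apply/implyP; apply: next_adj.
  - by rewrite /= !sat_atom /=; apply/implyP; apply: code_new.
  rewrite /= !sat_atom /=; apply/implyP => h1; apply/implyP => h2.
  have [DR E] := code_inj S h1 h2; move: E; rewrite -{}DR eqxx {h1 h2} => E.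
  rewrite sat_conjunction all_map; apply/allP => i; rewrite mem_iota => /andP[le1 lt_i] /=.
  have := congr1 (nth (v0 0) ^~ i.-1) E; rewrite !(nth_map 0) ?size_iota //; try lia.
  rewrite !nth_iota; try lia; move=> Eu; apply/eqP.
  by rewrite (_ : i = 1 + i.-1) 1?Eu; [congr u|]; lia.
have {}h u := (sat_axioms u).1 (h u).
split=> [x|x y z|x y|x y z|R o s hs|R R' o s s' hs hs'].
- by have [] := h (val_of [:: x]); rewrite /= !sat_atom => /andP[].
- by have [] := h (val_of [:: x; y; z]);
    rewrite /= !sat_atom => /and5P[_ /implyP h1 _ _ _] _ _ /h1 /implyP.
- by have [] := h (val_of [:: x; y]);
    rewrite /= !sat_atom => /and5P[_ _ /implyP h1 _ _] _ _ /h1 /implyP.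
- by have [] := h (val_of [:: x; y; z]);
    rewrite /= !sat_atom => /and5P[_ _ _ /implyP h1 _] _ _ /h1 /implyP.
- have Ds : size s = arity R by have := holds_size hs; case.
  have E : map (val_of (o :: s)) (iota 0 (arity R).+1) = o :: s.
    by rewrite -Ds; have := map_val_of [::] (o :: s) [::]; rewrite cats0.
  have [_ /(_ R) + _] := h (val_of (o :: s)).
  rewrite -[sat _ _]/(sat _ (atom _ _) ==> ~~ sat _ (atom _ _)) !sat_atom E hs.
  exact.
have Ds : size s = arity R by have := holds_size hs; case.
have Ds' : size s' = arity R' by have := holds_size hs'; case.
pose u := val_of ([:: o] ++ s ++ s').
have E : map u (iota 1 (arity R)) = s by rewrite -Ds; apply: (map_val_of [:: o]).
have E' : map u (iota (arity R).+1 (arity R')) = s'.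
  by rewrite -Ds -Ds' /u catA -[X in val_of X]cats0 -catA; apply: (map_val_of ([:: o] ++ s)).
have [_ _ /(_ R R')] := h u.
rewrite /= !sat_atom /= E E' hs hs' /=; case: eqP => [DR|_] /=; last by rewrite eqxx.
rewrite sat_conjunction all_map => /allP hi; split=> //; rewrite -{}DR in E' Ds'.
apply: (@eq_from_nth _ (v0 0)) => [|i]; rewrite Ds ?Ds' // => lt_i.
have /hi /= /eqP : i.+1 \in iota 1 (arity R) by rewrite mem_iota; lia.
by rewrite -E -E' !(nth_map 0) ?size_iota // !nth_iota // add1n addSn addnC => ->.
Qed.

End Coding.

Section CodingSentence.

Variables (tau : signature) (Psi : eso tau).
Let rho := quantified Psi.
Let fo := fo_part Psi.
Variable prime : rho -> tau.
Hypothesis prime_clause : forall R : rho,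
  let R' : signature_sum tau rho := inl (prime R) in
  exists (s1 s2 : seq (formula (signature_sum tau rho))) chi,
    [/\ conjuncts fo = s1 ++ chi :: s2, extension_clause R' (inr R) chi
      & ~~ has (mentions R') (s1 ++ s2)].
Local Notation sigma := (coding_signature tau rho).
Implicit Types (B : structure sigma) (A : structure tau).

Definition complete_formula : formula sigma :=
  FAnd (FEx 0 (atom Old [:: 0]))
    (FAll 0 (FImp (atom Old [:: 0])
       (FEx 1 (FAnd (atom Old [:: 1]) (atom Next [:: 0; 1]))))).

Lemma sat_complete B (v : nat -> B) : sat v complete_formula <-> complete B.
Proof.
rewrite /complete_formula /=; split=> [/andP[/existsP[x hx] /forallP h]|[[x hx] h]].
  split; first by exists x; move: hx; rewrite sat_atom.
  move=> y hy; have := h y; rewrite sat_atom /= update_same hy => /existsP[z].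
  by rewrite !sat_atom /= update_same update_other // update_same; exists z.
apply/andP; split; first by apply/existsP; exists x; rewrite sat_atom.
apply/forallP => y; apply/implyP; rewrite sat_atom /= update_same => /h[z hz].
apply/existsP; exists z; move: hz.
by rewrite !sat_atom /= !update_same update_other // update_same.
Qed.

(** A coding element that is switched off counts as absent. *)
Definition decoded B (R : rho) (s : seq B) : bool :=
  ~~ [exists o, holds (Code R) (o :: s) && ~~ holds Off [:: o]].

Definition fresh (s : seq nat) : nat := (\max_(x <- s) x).+1.

Definition decoding (R : rho) (s : seq nat) : formula sigma :=
  FNot (FEx (fresh s) (FAnd (atom (Code R) (fresh s :: s))
                            (FNot (atom Off [:: fresh s])))).

Lemma sat_decoding B (v : nat -> B) R s : sat v (decoding R s) = decoded R (map v s).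
Proof.
rewrite /decoding /=; congr (~~ _); apply: eq_existsb => o.
rewrite !sat_atom /= update_same; congr (holds _ (_ :: _) && _).
apply/eq_in_map => i hi; apply: update_other; rewrite neq_ltn ltnS.
by rewrite (leq_bigmax_seq (P := xpredT) (F := id)).
Qed.

(** The symbols [R'] are translated to falsity: they are those that are erased. *)
Definition recovery : formula sigma :=
  translate (fun x => atom Old [:: x])
    (fun (R : signature_sum tau rho) s => match R with
     | inl R' => if R' \in codom prime then FNot (FEq 0 0) else atom (Base R') s
     | inr R' => decoding R' s
     end) fo.

Definition embedded A B (g : A -> B) :=
  [/\ injective g, forall b, holds Old [:: b] = (b \in codom g) &
   forall R (t : (arity R).-tuple A), R \notin codom prime ->
     interp t = holds (Base R) (map g t)].

Lemma sat_recovery A B (g : A -> B) (I : forall R : rho, (arity R).-tuple A -> bool)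
    (u : nat -> B) (v : nat -> A) :
  embedded g -> (forall R (t : (arity R).-tuple A), I R t = decoded R (map g t)) ->
  sat u recovery = sat (A := @expansion tau rho (erase prime A) I) v fo.
Proof.
move=> [g_inj Dold Dbase] DI.
apply: (@sat_translate _ _ _ _ B (@expansion tau rho (erase prime A) I) g) => //.
- by move=> w x; rewrite sat_atom /= Dold.
- move=> [R|R] t w w' E; have Dt : map w t = map g (map_tuple w' t).
  + by rewrite -map_comp; apply/eq_in_map.
  + rewrite /=; case: ifP => hR /=; first by rewrite eqxx.
    by rewrite sat_atom Dbase ?hR // -Dt.
  + by rewrite -map_comp; apply/eq_in_map.
  by rewrite sat_decoding /= DI Dt.
by rewrite (eqP (sentence_closed fo)).
Qed.

(** Unsound structures are accepted. Soundness is hereditary, so a sound structure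
    has no unsound substructure that would be accepted by mistake. *)
Definition coding_formula : formula sigma :=
  FOr (FNot (closure (axioms Psi))) (FAnd complete_formula recovery).

Lemma sat_coding B (u : nat -> B) :
  sat u coding_formula <-> (sound B -> complete B /\ sat u recovery).
Proof.
rewrite /coding_formula [sat _ _]/= -/(closure_formula _).
have := sat_closure (axioms Psi) u; rewrite soundP /= => <-.
rewrite -(sat_complete u); case: (sat u (closure_formula _)) => /=.
  by split=> [/andP[]|/(_ isT)[-> ->]].
by split=> // _ [].
Qed.

(** [B] codes [A]: a tuple is in [R'] when it has no active coding element, since
    then no choice of a set of coding elements can take it out of [R]. *)
Definition coded A B (g : A -> B) :=
  embedded g /\ forall R (t : seq A) (t' : (arity (prime R)).-tuple A),
    tval t' = t -> interp t' = decoded R (map g t).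

Lemma coded_models A B (g : A -> B) : coded g ->
  eso_models A Psi <-> exists I : forall R : rho, (arity R).-tuple A -> bool,
    models (@expansion tau rho (erase prime A) I) fo /\
    forall R (t : (arity R).-tuple A), decoded R (map g t) -> I R t.
Proof.
move=> [_ Dprime]; split=> -[I hI]; exists I.
  have [h1 h2] := (extensional_models prime_clause I).1 hI; split=> // R t ht.
  have hs : size t == arity (prime R) by rewrite size_tuple (arity_prime prime_clause).
  by apply: (h2 R (Tuple hs) t erefl); rewrite (Dprime R t).
apply/(extensional_models prime_clause); case: hI => h1 h2; split=> // R t' t Dt ht'.
by apply: h2; rewrite -Dt -(Dprime R t' t').
Qed.

(** The set [X] consists of the elements that code a tuple of [I]. As an element
    codes a single tuple, a tuple outside [I] keeps the active coding element that
    it has for not being decoded. *)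
Lemma switch A B (g : A -> B) (I : forall R : rho, (arity R).-tuple A -> bool) :
  sound B -> injective g ->
  (forall R (t : (arity R).-tuple A), decoded R (map g t) -> I R t) ->
  exists X : {set B}, (forall o, o \in X -> ~~ holds Old [:: o]) /\
    forall R (t : (arity R).-tuple A),
      I R t = ~~ [exists o, [&& holds (Code R) (o :: map g t), ~~ holds Off [:: o] & o \notin X]].
Proof.
move=> S g_inj hI.
exists [set o | [exists R, [exists t : (arity R).-tuple A,
  holds (Code R) (o :: map g t) && I R t]]]; split=> [o|R t].
  by rewrite inE => /existsP[R /existsP[t /andP[/(code_new S)]]].
apply/idP/existsPn => [It o|no_o].
  apply/negP => /and3P[ho _ /negP[]]; rewrite inE; apply/existsP; exists R.
  by apply/existsP; exists t; rewrite ho.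
apply: contraT => nIt; have : ~~ decoded R (map g t) by apply: contra nIt; apply: hI.
rewrite negbK => /existsP[o /andP[ho off_o]].
have := no_o o; rewrite ho off_o /= negbK inE => /existsP[R1 /existsP[t1 /andP[ho1 It1]]].
have [DR Dt] := code_inj S ho1 ho; case: R / DR t nIt {hI no_o ho} Dt => t nIt Dt.
by case/negP: nIt; rewrite -(val_inj (inj_map g_inj Dt)).
Qed.

(** * The coding problem as a monadic extensional problem *)

Definition coding_eso : eso sigma :=
  superset_eso (erefl : arity (Off : sigma) = 1) coding_formula.

Lemma sound_reinterpret B (X : {set B}) : sound (reinterpret Off X) <-> sound B.
Proof.
by split=> -[h1 h2 h3 h4 h5 h6]; (split=> [x|x y z|x y|x y z|R o s|R R' o s s'];
  [have := h1 x|have := h2 x y z|have := h3 x y|have := h4 x y z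
  |have := h5 R o s|have := h6 R R' o s s']); rewrite !holds_reinterpret_other.
Qed.

Lemma complete_reinterpret B (X : {set B}) :
  complete (reinterpret Off X) <-> complete B.
Proof.
split=> -[[x hx] h]; (split; first by exists x; move: hx; rewrite holds_reinterpret_other).
  move=> y hy; have [|z hz] := h y; first by rewrite holds_reinterpret_other.
  by exists z; move: hz; rewrite !holds_reinterpret_other.
move=> y; rewrite holds_reinterpret_other // => /h[z hz].
by exists z; rewrite !holds_reinterpret_other.
Qed.

Lemma coding_eso_unsound B : ~ sound B -> eso_models B coding_eso.
Proof.
move=> nS; apply/superset_models; exists [set x | holds Off [:: x]].
split=> [x|u]; first by rewrite inE.
by apply/sat_coding => /sound_reinterpret.
Qed.

Lemma coding_eso_incomplete B : sound B -> ~ complete B -> ~ eso_models B coding_eso.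
Proof.
move=> S nC /superset_models[X [_ /(_ (valuation _))/sat_coding]].
by rewrite sound_reinterpret complete_reinterpret => /(_ S)[/nC].
Qed.

(** Enlarging [Off] only enlarges the decoded relations, and by [switch] every
    admissible choice of relations arises in this way. *)
Lemma coding_eso_coded A B (g : A -> B) : sound B -> complete B -> coded g ->
  eso_models B coding_eso <-> eso_models A Psi.
Proof.
move=> S C cg; have [[g_inj Dold Dbase] _] := cg.
have embX (X : {set B}) : @embedded A (reinterpret Off X) g.
  by split.
rewrite (coded_models cg) superset_models; split=> [[X [hX h]]|[I [hI1 hI2]]].
  pose I R (t : (arity R).-tuple A) := @decoded (reinterpret Off X) R (map g t).
  exists I; split=> [|R t].
    have /sat_coding := h (valuation _); rewrite sound_reinterpret => /(_ S)[_].
    rewrite (@sat_recovery A (reinterpret Off X) g I _ (valuation A)) //.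
    exact: (modelsE _ _).2.
  apply: contra => /existsP[o /andP[]]; rewrite holds_reinterpret_other //.
  rewrite holds_reinterpret // => ho hoX; apply/existsP; exists o; rewrite ho.
  by apply: contra hoX; apply: hX.
have [X [_ DX]] := switch S g_inj hI2.
exists ([set x | holds Off [:: x]] :|: X); split=> [x hx|u]; first by rewrite !inE hx.
apply/sat_coding => _; split; first exact/complete_reinterpret.
rewrite (@sat_recovery A (reinterpret Off _) g I _ (valuation A)) //.
move=> R t; rewrite DX; congr (~~ _); apply: eq_existsb => o.
by rewrite holds_reinterpret_other // holds_reinterpret // !inE negb_or.
Qed.

(** * The coding problem as the complement of a hereditary class *)

Definition coding_sentence : sentence sigma := closure (FNot coding_formula).

Lemma holds_substructure (pi : signature) (B : structure pi) (U : {set B})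
    (U_gt0 : 0 < #|U|) R (s : seq {x : B | x \in U}) :
  @holds _ (substructure U_gt0) R s = @holds _ B R (map val s).
Proof.
rewrite {1}/holds; case: insubP => [t _ <-|neq].
  by rewrite -[map _ _]/(tval (map_tuple val t)) holds_tuple.
by rewrite /holds insubF // size_map (negPf neq).
Qed.

Lemma not_Her_coding B : ~ Her coding_sentence B <->
  exists (U : {set B}) (U_gt0 : 0 < #|U|) (u : nat -> substructure U_gt0),
    sat u coding_formula.
Proof.
split=> [/not_all_ex_not[U] /not_all_ex_not[U_gt0] h|[U [U_gt0 [u hu]]] /(_ U U_gt0 u)].
  exists U, U_gt0; apply: NNPP => no_u; apply: h => v; apply/sat_closure => u.
  by have : ~~ sat u coding_formula by apply/negP => hu; apply: no_u; exists u.
by move/sat_closure/(_ u) => nu; have : ~~ sat u coding_formula := nu; rewrite hu.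
Qed.

Lemma sound_substructure B (U : {set B}) (U_gt0 : 0 < #|U|) :
  sound B -> sound (substructure U_gt0).
Proof.
move=> S; split=> [x|x y z|x y|x y z|R o s|R R' o s s'];
  rewrite !holds_substructure /=.
- exact: less_irr S _.
- exact: (less_tr S).
- exact: (@less_tot _ _ B S (val x) (val y)).
- exact: (@next_adj _ _ B S (val x) (val y) (val z)).
- exact: (code_new S).
- by move=> h1 /(code_inj S h1)[-> /(inj_map val_inj)].
Qed.

(** If an old [b] were missing, let [x] be the greatest old element present below
    [b], or the greatest one present if none is below [b]. Its successor is
    present. If the successor is above [x], it does not jump over [b], which
    contradicts the choice of [x]. Otherwise it is the least old element and [x]
    the greatest one; then [x] is not below [b], but the successor is. *)
Lemma complete_substructure B (U : {set B}) (U_gt0 : 0 < #|U|) :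
  sound B -> complete (substructure U_gt0) -> forall b, holds Old [:: b] -> b \in U.
Proof.
move=> S [[x0 hx0] hnext] b hb; apply: contraT => nUb.
pose below (x : B) := #|[set z | holds Less [:: z; x]]|.
have below_lt x y : holds Less [:: x; y] -> below x < below y.
  move=> xy; apply: proper_card; apply/properP; split.
    by apply/subsetP => z; rewrite !inE => zx; exact: (less_tr S zx xy).
  by exists x; rewrite inE // (less_irr S).
have old_next (x : B) : x \in U -> holds Old [:: x] ->
    exists y, [/\ y \in U, holds Old [:: y] & holds Next [:: x; y]].
  move=> Ux hx; have [|y /andP[]] := hnext (exist _ x Ux).
    by rewrite holds_substructure.
  by rewrite !holds_substructure /=; exists (val y); split=> //; apply: valP.
have adj x y : holds Next [:: x; y] -> holds Less [:: x; y] ->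
    holds Less [:: x; b] -> ~~ holds Less [:: b; y].
  by move=> xy lt_xy lt_xb; have := next_adj S xy hb; rewrite lt_xy lt_xb /=; case: holds.
pose low := [exists x in U, holds Old [:: x] && holds Less [:: x; b]].
pose P (x : B) := [&& x \in U, holds Old [:: x] & low ==> holds Less [:: x; b]].
have [x1 Px1] : exists x, P x.
  have [/existsP[x /and3P[Ux hx xb]]|nlow] := boolP low.
    by exists x; rewrite /P Ux hx xb implybT.
  rewrite /P (negPf nlow).
  exists (val x0); rewrite (valP x0) /=.
  by move: hx0; rewrite holds_substructure => ->.
have [x /and3P[Ux hx low_x] max_x] := @arg_maxnP _ x1 P below Px1.
have [y [Uy hy xy]] := old_next x Ux hx.
have ne_b z : z \in U -> z != b by apply: contraTneq => ->.
have lt_yb : holds Less [:: y; b] = ~~ holds Less [:: b; y].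
  have := less_tot S hy hb; rewrite (negPf (ne_b y Uy)) /=.
  case: (boolP (holds Less [:: b; y])) => [lt_by _|_]; last by rewrite orbF.
  by apply: contraNF (less_irr S y) => lt; exact: (less_tr S lt lt_by).
have [lt_xy|nlt_xy] := boolP (holds Less [:: x; y]).
  have Py : P y.
    rewrite /P Uy hy; apply/implyP => l.
    by rewrite lt_yb; apply: adj xy lt_xy _; apply: (implyP low_x).
  have le_yx : below y <= below x := max_x y Py.
  by have := below_lt x y lt_xy; rewrite ltnNge le_yx.
have := next_adj S xy hb; rewrite (negPf nlt_xy) /= => /andP[nlt_by nlt_xb].
have nlow : ~~ low by apply: contra nlt_xb; apply: (implyP low_x).
case/negP: nlow; apply/existsP; exists y; by rewrite Uy hy lt_yb.
Qed.

Lemma sound_full B (U_gt0 : 0 < #|[set: B]|) : sound (substructure U_gt0) -> sound B.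
Proof.
move=> S; pose h (x : B) : substructure U_gt0 := exist _ x (in_setT x).
have E R (s : seq B) : holds R s = @holds _ (substructure U_gt0) R (map h s).
  by rewrite holds_substructure -map_comp map_id.
split=> [x|x y z|x y|x y z|R o s|R R' o s s']; rewrite !E /=.
- exact: (less_irr S).
- exact: (less_tr S).
- exact: (@less_tot _ _ _ S (h x) (h y)).
- exact: (@next_adj _ _ _ S (h x) (h y) (h z)).
- exact: (code_new S).
- have h_inj : injective h by move=> a b [].
  by move=> h1 /(code_inj S h1)[-> /(inj_map h_inj)].
Qed.

Lemma Her_unsound B : ~ sound B -> ~ Her coding_sentence B.
Proof.
move=> nS; apply/not_Her_coding; have U_gt0 : 0 < #|[set: B]| by rewrite cardsT dom_gt0.
exists setT, U_gt0, (valuation (substructure U_gt0)).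
by apply/sat_coding => /sound_full.
Qed.

Lemma Her_incomplete B : sound B -> ~ complete B -> Her coding_sentence B.
Proof.
move=> S nC; apply: NNPP => /not_Her_coding[U [U_gt0 [u /sat_coding h]]].
have [C _] := h (sound_substructure U_gt0 S).
have inU := complete_substructure S C; case: C => -[[x Ux] hx] hnext; apply: nC.
rewrite holds_substructure in hx; split=> [|y hy]; first by exists x.
have [|z] := hnext (exist _ y (inU y hy)); first by rewrite holds_substructure.
by rewrite !holds_substructure; exists (val z).
Qed.

(** A substructure that satisfies the formula contains all old elements, so it is
    determined by the coding elements that it omits; these act as if they were
    switched off. *)
Lemma Her_coded A B (g : A -> B) : sound B -> complete B -> coded g ->
  ~ Her coding_sentence B <-> eso_models A Psi.
Proof.
move=> S C cg; have [[g_inj Dold Dbase] _] := cg.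
rewrite (coded_models cg) not_Her_coding.
have emb (U : {set B}) (U_gt0 : 0 < #|U|) (h : A -> substructure U_gt0) :
    (forall a, val (h a) = g a) -> embedded h.
  move=> Dh; have Dm s : map val (map h s) = map g s.
    by rewrite -map_comp; apply: eq_map.
  split=> [a a' E|b|R t hR].
  - by apply: g_inj; rewrite -!Dh E.
  - rewrite holds_substructure Dold; apply/codomP/codomP => [] [a Da]; exists a.
      by apply: val_inj; rewrite Da Dh.
    by rewrite Da Dh.
  - by rewrite holds_substructure Dm Dbase.
have dec (U : {set B}) (U_gt0 : 0 < #|U|) (h : A -> substructure U_gt0) R s :
    (forall a, val (h a) = g a) ->
    @decoded (substructure U_gt0) R (map h s) = ~~ [exists o,
      [&& holds (Code R) (o :: map g s), ~~ holds Off [:: o] & o \in U]].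
  move=> Dh; have Dm : map val (map h s) = map g s by rewrite -map_comp; apply: eq_map.
  congr (~~ _); apply/existsP/existsP => [[o /andP[]]|[o /and3P[ho off_o Uo]]].
    by rewrite !holds_substructure /= Dm => ho off_o; exists (val o); rewrite ho off_o; apply: (valP o).
  by exists (exist _ o Uo); rewrite !holds_substructure /= Dm ho.
split=> [[U [U_gt0 [u /sat_coding h]]]|[I [hI1 hI2]]].
  have [CU sat_u] := h (sound_substructure U_gt0 S).
  have inU a : g a \in U.
    by apply: (complete_substructure S CU); rewrite Dold codom_f.
  pose k a : substructure U_gt0 := exist _ (g a) (inU a).
  exists (fun R t => decoded R (map k t)); split=> [|R t].
    move: sat_u; rewrite (@sat_recovery A _ k (fun R t => decoded R (map k t)) _ (valuation A)) //.
      exact: (modelsE _ _).2.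
    exact: emb.
  rewrite dec //; apply: contra => /existsP[o /and3P[ho off_o _]].
  by apply/existsP; exists o; rewrite ho.
have [X [newX DX]] := switch S g_inj hI2.
have inU a : g a \in ~: X.
  by rewrite inE; apply/negP => /newX; rewrite Dold codom_f.
have U_gt0 : 0 < #|~: X| by apply/card_gt0P; exists (g (valuation A 0)).
pose k a : substructure U_gt0 := exist _ (g a) (inU a).
exists (~: X), U_gt0, (valuation _); apply/sat_coding => _; split.
  have [[x hx] hnext] := C; have oldU y : holds Old [:: y] -> y \in ~: X.
    by rewrite Dold => /codomP[a ->].
  split; first by exists (exist _ x (oldU x hx)); rewrite holds_substructure.
  move=> y; rewrite holds_substructure => /hnext[z hz].
  have /andP[hz1 _] := hz.
  by exists (exist _ z (oldU z hz1)); rewrite !holds_substructure.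
rewrite (@sat_recovery A _ k I _ (valuation A)) //; first exact: emb.
move=> R t; rewrite dec // DX; congr (~~ _); apply: eq_existsb => o.
by rewrite inE.
Qed.

(** * Decoding *)

Definition decoding_relation B (R : tau) (s : seq B) : bool :=
  if [pick r | prime r == R] is Some r then decoded r s else holds (Base R) s.

Definition decoded_structure B (gt0 : 0 < #|[set b : B | holds Old [:: b]]|) :
    structure tau :=
  @Structure tau {b : B | b \in [set b : B | holds Old [:: b]]} (card_substructure gt0)
    (fun R t => decoding_relation R (map val t)).

Hypothesis prime_inj : injective prime.

Lemma coded_decoded B (gt0 : 0 < #|[set b : B | holds Old [:: b]]|) :
  coded (val : decoded_structure gt0 -> B).
Proof.
split=> [|R s t' Dt'].
  split=> [|b|R t hR]; first exact: val_inj.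
    apply/idP/codomP => [hb|[x ->]]; last by have := valP x; rewrite inE.
    have hb' : b \in [set b : B | holds Old [:: b]] by rewrite inE.
    by exists (exist _ b hb').
  rewrite /= /decoding_relation; case: pickP => // r /eqP Dr.
  by rewrite -Dr codom_f in hR.
rewrite /= /decoding_relation; case: pickP => [r /eqP /prime_inj->|/(_ R)].
  by rewrite Dt'.
by rewrite eqxx.
Qed.

Lemma complete_gt0 B : complete B -> 0 < #|[set b : B | holds Old [:: b]]|.
Proof. by case=> -[x hx] _; apply/card_gt0P; exists x; rewrite inE. Qed.

Definition coding_problem : problem := @Problem sigma (fun B => eso_models B coding_eso).

Lemma coding_monadic : monadic_extensional_ESO coding_problem.
Proof. by exists coding_eso; split=> //; exact: superset_extensional. Qed.

(** The two descriptions agree on all structures, and on the coding ones both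
    express the given sentence for the decoded structure. *)
Lemma coding_co_HerFO : co_HerFO coding_problem.
Proof.
exists (Her coding_sentence); split; first by exists coding_sentence.
move=> B /=; have [S|nS] := classic (sound B); last first.
  by split=> _; [apply: Her_unsound|apply: coding_eso_unsound].
have [C|nC] := classic (complete B); last first.
  split=> h; first by case: (coding_eso_incomplete S nC).
  by case: h; apply: Her_incomplete.
have cd := coded_decoded (complete_gt0 C).
by rewrite (coding_eso_coded S C cd) (Her_coded S C cd).
Qed.

End CodingSentence.

(** * The reductions to and from the coding problem *)

Lemma uniq_words (T : eqType) (L : seq T) r : uniq L -> uniq (words L r).
Proof.
move=> uL; elim: r => //= r IHr; apply: allpairs_uniq => //.
by move=> [a s] [b t] _ _ [-> ->].
Qed.

Section Universe.

Variables (tau : signature) (K : finType) (dim : K -> nat).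
Variable present : forall A : structure tau, K -> seq A -> bool.
Variable A : structure tau.

Lemma mem_universe c s :
  ((c, s) \in universe dim present A) = (size s == dim c) && present c s.
Proof.
apply/flatten_mapP/idP => [[c' _ /mapP[s']]|/andP[hs ps]].
  by rewrite mem_filter size_words => /andP[ps /andP[hs _]] [-> ->]; rewrite hs.
exists c; first by rewrite mem_enum.
apply/mapP; exists s => //; rewrite mem_filter ps size_words hs.
by apply/allP => a _; rewrite /= mem_enum.
Qed.

Lemma uniq_universe : uniq (universe dim present A).
Proof.
apply: (@allpairs_uniq_dep K (fun _ => seq A) (K * seq A)%type (fun c s => (c, s))
  (enum K) (fun c => [seq s <- words (enum A) (dim c) | present c s])).
- exact: enum_uniq.
- by move=> c _; apply/filter_uniq/uniq_words/enum_uniq.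
- by move=> [c s] [c' s'] _ _ /= [-> ->].
Qed.

Lemma enum_universe : map val (enum {: seq_sub (universe dim present A)}) = universe dim present A.
Proof. by rewrite enumT Finite.enum.unlock /=; apply: val_seq_sub_enum uniq_universe. Qed.

End Universe.

Section CodingReduction.

Variables (tau : signature) (Psi : eso tau).
Let rho := quantified Psi.
Variable prime : rho -> tau.
Hypothesis prime_inj : injective prime.
Hypothesis arity_prime : forall R, arity (prime R) = arity R.
Local Notation sigma := (coding_signature tau rho).
Local Notation kind := (option rho).
Implicit Type A : structure tau.

(** Old elements are labelled [None]; a tuple labelled [Some r] is the element that
    codes it for [r], present unless the tuple is in [R']. *)
Definition kind_dim (c : kind) : nat := if c is Some r then arity r else 1.

Definition kind_present A (c : kind) (s : seq A) : bool :=
  if c is Some r then ~~ holds (prime r) s else true.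

Definition all_old A (t : seq (kind * seq A)) := all (fun p => ~~ isSome p.1) t.

(** The arguments of a tuple of old elements. *)
Definition names A (t : seq (kind * seq A)) : seq A := flatten (map snd t).

(** Cyclic succession of ranks. *)
Definition follows A (a b : A) : bool :=
  ((enum_rank a < enum_rank b) &&
     ~~ [exists c : A, (enum_rank a < enum_rank c) && (enum_rank c < enum_rank b)])
  || (~~ [exists c : A, enum_rank c < enum_rank b]
      && ~~ [exists c : A, enum_rank a < enum_rank c]).

Definition coding_related A (R : sigma) (t : seq (kind * seq A)) : bool :=
  match R with
  | inl (inl R') => all_old t && holds R' (names t)
  | inl (inr r) =>
      if t is (Some r', s) :: t' then [&& r' == r, all_old t' & names t' == s]
      else false
  | inr (inl b) => if t is [:: (None, _)] then b else false
  | inr (inr b) =>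
      if t is [:: (None, [:: x]); (None, [:: y])] then
        if b then enum_rank x < enum_rank y else follows x y
      else false
  end.

Lemma definable_eq_seq xs ys :
  definable (fun (A : structure tau) v => map v xs == map v ys).
Proof.
elim: xs ys => [|x xs IHxs] [|y ys]; try exact: definable_const.
apply: eq_definable (definable_and (definable_eq tau x y) (IHxs ys)) => A v.
by rewrite /= eqseq_cons.
Qed.

Lemma definable_present c o :
  definable (fun A v => kind_present c [seq v i | i <- iota o (kind_dim c)]).
Proof.
case: c => [r|] /=; last exact: definable_const.
exact: definable_not (definable_holds _ _).
Qed.

Lemma all_old_places A o (cs : seq kind) (v : nat -> A) :
  all_old (places kind_dim o cs v) = all (fun c => ~~ isSome c) cs.
Proof. by elim: cs o => //= c cs IHcs o; rewrite /all_old /= -/(all_old _) IHcs. Qed.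

Lemma names_places A o (cs : seq kind) (v : nat -> A) :
  all (fun c => ~~ isSome c) cs ->
  names (places kind_dim o cs v) = map v (iota o (size cs)).
Proof.
elim: cs o => //= -[r|] cs IHcs o //= hcs.
by rewrite /names /= -/(names _) IHcs // addn1.
Qed.

Lemma definable_follows : definable (fun A v => follows (v 0) (v 1)).
Proof.
pose h x y := definable_less tau x y.
have h1 := definable_exists 2 (definable_and (h 0 2) (h 2 1)).
have h2 := definable_not (definable_exists 2 (h 2 1)).
have h3 := definable_not (definable_exists 2 (h 0 2)).
have := definable_or (definable_and (h 0 1) (definable_not h1)) (definable_and h2 h3).
exact: eq_definable.
Qed.

Lemma definable_related (R : sigma) cs : size cs = arity R ->
  definable (fun A v => coding_related R (places kind_dim 0 cs v)).
Proof.
case: R => [[R|r]|[b|b]] /= hcs.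
- have [old_cs|nold] := boolP (all (fun c : kind => ~~ isSome c) cs).
    apply: eq_definable (definable_holds R (iota 0 (size cs))) => A v.
    by rewrite all_old_places old_cs names_places.
  by apply: eq_definable (definable_const _ false) => A v; rewrite all_old_places (negPf nold).
- case: cs hcs => [|[r'|] cs] hcs; try exact: definable_const.
  have [/andP[/eqP Dr old_cs]|no] := boolP ((r' == r) && all (fun c : kind => ~~ isSome c) cs).
    apply: eq_definable (definable_eq_seq (iota (arity r') (size cs)) (iota 0 (arity r'))).
    by move=> A v /=; rewrite all_old_places old_cs names_places // Dr eqxx add0n.
  apply: eq_definable (definable_const _ false) => A v /=.
  by rewrite andbA all_old_places (negPf no).
- by case: cs hcs => [|[r|] [|c cs]] // _; apply: definable_const.
case: cs hcs => [|[r|] [|[r'|] [|c cs]]] // _; try exact: definable_const.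
case: b; first exact: definable_less.
exact: definable_follows.
Qed.

Section CodingStructure.

Variable A : structure tau.
Local Notation L := (universe kind_dim kind_present A).

Lemma old_in_universe a : (None, [:: a]) \in L.
Proof. by rewrite mem_universe. Qed.

Lemma coding_gt0 : 0 < #|{: seq_sub L}|.
Proof. by apply/card_gt0P; exists (SeqSub (old_in_universe (valuation A 0))). Qed.

Definition coding_structure : structure sigma :=
  @Structure sigma (seq_sub L) coding_gt0
    (fun R t => coding_related R (map val t)).

Local Notation B := coding_structure.

Definition old_element (a : A) : B := SeqSub (old_in_universe a).

Lemma holds_coding (R : sigma) (s : seq B) :
  holds R s = (size s == arity R) && coding_related R (map val s).
Proof.
rewrite /holds; case: insubP => [t ht Dt|]; last by move/negPf->.
by rewrite -Dt size_tuple eqxx.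
Qed.

Lemma element_cases (x : B) : (exists a, x = old_element a) \/
  exists r s, [/\ val x = (Some r, s), size s = arity r & ~~ holds (prime r) s].
Proof.
have : val x \in L := ssvalP x; case Dx: (val x) => [[r|] s]; rewrite mem_universe.
  by move=> /andP[/eqP hs ps]; right; exists r, s.
case: s Dx => [|a [|]] // Dx _; left; exists a; exact: val_inj.
Qed.

Lemma all_old_names (s : seq B) : all_old (map val s) ->
  s = map old_element (names (map val s)).
Proof.
elim: s => //= x s IHs; rewrite /all_old /= => /andP[hx /IHs Ds].
case: (element_cases x) hx => [[a ->] _|[r [s' [-> _ _]]] //].
by rewrite /names /= -/(names _) -Ds.
Qed.

Lemma names_old (s : seq A) :
  all_old (map val (map old_element s)) /\ names (map val (map old_element s)) = s.
Proof.
elim: s => //= a s [IH1 IH2]; split; first exact: IH1.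
by rewrite /names /= -/(names _) IH2.
Qed.

Lemma sound_coding : sound B.
Proof.
split=> [x|x y z|x y|x y z|R o s|R R' o s s']; rewrite !holds_coding /=.
- by case: (element_cases x) => [[a ->]|[r [s [-> _ _]]]] //=; rewrite ltnn.
- case: (element_cases x) => [[a ->]|[r [s [-> _ _]]]] //=.
  case: (element_cases y) => [[b ->]|[r [s [-> _ _]]]] //=.
  case: (element_cases z) => [[c ->]|[r [s [-> _ _]]]] //=.
  exact: ltn_trans.
- case: (element_cases x) => [[a ->]|[r [s [-> _ _]]]] //= _.
  case: (element_cases y) => [[b ->]|[r [s [-> _ _]]]] //= _.
  case: ltngtP => //; rewrite ?orbT // => /val_inj/enum_rank_inj->.
  by rewrite eqxx.
- case: (element_cases x) => [[a ->]|[r [s [-> _ _]]]] //=.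
  case: (element_cases y) => [[b ->]|[r [s [-> _ _]]]] //=.
  move=> fol; case: (element_cases z) => [[c ->]|[r [s [-> _ _]]]] //= _.
  case/orP: fol => /andP[h1 /existsPn h2]; last first.
    by rewrite (existsPn h1 c) h2 orbT.
  by rewrite h1 h2.
- by case: (element_cases o) => [[a ->]|[r [s' [-> _ _]]]] /=; rewrite ?andbF.
- case: (element_cases o) => [[a ->]|[r [s0 [-> _ _]]]] /=; first by rewrite andbF.
  case/and4P=> _ /eqP Dr old_s /eqP Ds /and4P[_ /eqP Dr' old_s' /eqP Ds'].
  by rewrite -Dr -Dr'; split=> //; rewrite (all_old_names old_s) Ds (all_old_names old_s') Ds'.
Qed.

Lemma complete_coding : complete B.
Proof.
have old_old a : holds Old [:: old_element a] by rewrite holds_coding.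
split; first by exists (old_element (valuation A 0)).
move=> x; rewrite holds_coding /=.
case: (element_cases x) => [[a ->]|[r [s [-> _ _]]]] //= _.
suff [b fol] : exists b, follows a b.
  by exists (old_element b); rewrite old_old holds_coding.
have gt0 := dom_gt0 A; rewrite /follows.
have [lt_a|le_a] := ltnP (enum_rank a).+1 #|A|.
  exists (enum_val (Ordinal lt_a)); rewrite enum_valK ltnSn /=.
  apply/orP; left; apply/existsPn => c; lia.
exists (enum_val (Ordinal gt0)); rewrite enum_valK; apply/orP; right.
apply/andP; split; apply/existsPn => c //=.
by rewrite -leqNgt -ltnS (leq_trans _ le_a).
Qed.

Lemma coded_coding : coded prime old_element.
Proof.
have names_map := names_old.
split=> [|R s t' Dt'].
  split=> [a b [] //|b|R t hR].
    rewrite holds_coding /=; apply/idP/codomP => [|[a ->] //].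
    by case: (element_cases b) => [[a ->]|[r [s [-> _ _]]]] // _; exists a.
  have [old_t Dt] := names_old t.
  by rewrite holds_coding size_map size_tuple eqxx /= old_t Dt holds_tuple.
have [old_s Ds] := names_old s.
have hs : size s = arity R by rewrite -Dt' size_tuple arity_prime.
rewrite -holds_tuple Dt'; apply/idP/existsPn => [ht o|no_o].
  rewrite !holds_coding /=; case: (element_cases o) => [[a ->]|[r [s' [-> _ ns']]]] /=.
    by rewrite andbF.
  apply/negP => /andP[/and4P[_ /eqP Dr _ /eqP Ds'] _].
  by move: ns'; rewrite -Ds' Ds Dr ht.
apply: contraT => nht; have ho : (Some R, s) \in L by rewrite mem_universe /= hs eqxx.
have := no_o (SeqSub ho).
by rewrite !holds_coding /= size_map hs !eqxx old_s Ds eqxx.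
Qed.

Lemma encode_coding :
  description kind_dim kind_present coding_related A = encode B.
Proof. exact: (@encode_description _ _ _ _ _ _ A B (fun x => val x) (enum_universe _ _ _)). Qed.

End CodingStructure.

Lemma writable_coding : writable (fun A _ => encode (coding_structure A)).
Proof.
apply: eq_writable (writable_description definable_present definable_related) => A v.
exact: encode_coding.
Qed.

End CodingReduction.

(** One problem serves both classes. The reduction back decides soundness and
    completeness, which are first-order, before decoding. *)
Lemma extensional_coding (P : problem) : extensional_ESO P ->
  exists Q, [/\ monadic_extensional_ESO Q, co_HerFO Q & logspace_equivalent P Q].
Proof.
move=> hP; have [trP|/nontrivial[[A1 PA1] [A0 PA0]]] := classic (trivial P).
  exists P; split; [exact: trivial_monadic|exact: trivial_co_HerFO|].
  exact: logspace_equivalent_refl.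
case: hP => Psi [[prime [prime_inj clause]] DP].
have arE := arity_prime clause.
exists (coding_problem prime); split.
- exact: coding_monadic.
- exact: coding_co_HerFO.
split.
  apply: (@reduces_by P (coding_problem prime) (fun A => encode (coding_structure prime A))).
    exact: writable_coding.
  move=> A; exists (coding_structure prime A); split=> //; rewrite DP; apply: iff_sym.
  by apply: (coding_eso_coded clause (sound_coding _ _) (complete_coding _ _) (coded_coding arE _)).
pose sigma := coding_signature (psig P) (quantified Psi).
have [||word [hw Dw]] := @unary_interpretation sigma (psig P)
    (fun B b => holds Old [:: b]) (@decoding_relation _ Psi prime).
- by move=> x; apply: (@definable_holds sigma Old [:: x]).
- move=> R xs hxs; rewrite /decoding_relation; case: pickP => [r _|_].
    by apply: eq_definable (definable_sat (decoding r xs)) => B v; rewrite sat_decoding.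
  exact: (@definable_holds sigma (Base R)).
pose s B := sat (valuation B) (closure (axioms Psi)).
pose c B := sat (valuation B) (complete_formula Psi).
have hs : definable (fun B _ => s B).
  by apply: eq_definable (definable_sat (closure (axioms Psi))) => B v; apply: sat_sentence.
have hc : definable (fun B _ => c B).
  apply: eq_definable (definable_sat (complete_formula Psi)) => B v.
  by apply/idP/idP => /sat_complete h; apply/sat_complete.
apply: (@reduces_by (coding_problem prime) P (fun B =>
    if s B then if c B then word B else encode A0 else encode A1)).
  exact: writable_if hs (writable_if hc hw (writable_word _ _)) (writable_word _ _).
move=> B; have DS : s B <-> sound B by rewrite /s sat_closure soundP.
case: (boolP (s B)) => [/DS S|nS]; last first.
  exists A1; split=> //; split=> // _; apply: coding_eso_unsound => /DS.
  by rewrite (negPf nS).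
have DC : c B <-> complete B by apply: sat_complete.
case: (boolP (c B)) => [/DC C|nC]; last first.
  exists A0; split=> //; split=> // hB; case: (coding_eso_incomplete S _ hB) => /DC.
  by rewrite (negPf nC).
have gt0 := complete_gt0 C.
exists (decoded_structure prime gt0); split.
  apply: (Dw B (decoded_structure prime gt0) val) => //.
  by rewrite val_enum_sig; apply: eq_filter => b; rewrite inE.
by rewrite DP; apply: (coding_eso_coded clause S C (coded_decoded prime_inj gt0)).
Qed.

(** * Equality of power *)

Lemma monadic_extensional (P : problem) : monadic_extensional_ESO P -> extensional_ESO P.
Proof. by case=> Psi [_ h1 h2]; exists Psi. Qed.

Theorem theorem4p6 :
  same_power monadic_extensional_ESO extensional_ESO /\
  same_power extensional_ESO co_HerFO /\
  same_power monadic_extensional_ESO co_HerFO.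
Proof.
have to_monadic P : extensional_ESO P ->
    exists Q, monadic_extensional_ESO Q /\ logspace_equivalent P Q.
  by case/extensional_coding => Q [h1 _ h2]; exists Q.
have to_Her P : extensional_ESO P -> exists Q, co_HerFO Q /\ logspace_equivalent P Q.
  by case/extensional_coding => Q [_ h1 h2]; exists Q.
split; last split; split=> P.
- move=> /monadic_extensional hP; exists P; split=> //; exact: logspace_equivalent_refl.
- exact: to_monadic.
- exact: to_Her.
- by case/co_HerFO_monadic => Q [/monadic_extensional h1 h2]; exists Q.
- by move/monadic_extensional; apply: to_Her.
- exact: co_HerFO_monadic.
Qed.
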